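(* Let the covariates $Z_1,\dots,Z_N$, the function $h=(h_1,\dots,h_p)$, the functions $f_1,\dots,f_N$, the domain $D_0$, the constants $F_1,F_2,d_j,\sigma_0$ and the noise variables $\omega_1,\dots,\omega_N$ be as in the Gaussian setting described in the context (Regularity with $m=1$, Parameter Domain and Gaussian assumptions). Fix an arbitrary $\theta\in D_0$. Define positive constants $w_1,\dots,w_p$ by $$w_j^2=\sigma_0^{-2}\sum_{i=1}^N\mathrm{Var}(\omega_i)h_j(Z_i)^2.$$ Then for $v\in D_0$, $$\sum_{i=1}^N\omega_if_i(h(Z_i)^\top v)=\sum_{i=1}^N\omega_if_i(h(Z_i)^\top\theta)+\sigma_0F_1\,\xi_1\sum_{j=1}^pw_j|v_j-\theta_j|+\xi(v)\sum_{j=1}^pd_j|v_j-\theta_j|,$$ where $\{\xi(v):v\in D_0\}$ is a process with the upper tail property $$\Pr\Big\{\sup_{v\in D_0}|\xi(v)|>\sigma_0\big(A\sqrt{\ln(2p)}+B\sqrt{2\ln(p/q)}\big)\Big\}\le q,\qquad\forall q\in(0,1),$$ and $\xi_1$ is a random variable with the upper tail property $$\Pr\Big\{|\xi_1|>\sqrt{2\ln(p/q)}\Big\}\le q,\qquad\forall q\in(0,1).$$ Here $$R=\sup_{u,v\in D_0}\sum_{j=1}^p d_j|u_j-v_j|,\qquad\phi=\min\Big(2F_1,\frac{F_2R}2\Big),\qquad\psi=\frac{F_2}2,$$ $$A=8\psi R\sqrt{\max_{j\le p}\sum_{i=1}^N[h_j(Z_i)/d_j]^2},\qquad B=\phi\sqrt{\max_{j\le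 p}\sum_{i=1}^N[h_j(Z_i)/d_j]^2}.$$
   Context: Setting. $Z_1,\dots,Z_N\in\mathcal Z$ are fixed (nonrandom), where $\mathcal Z$ is a measurable space, $h=(h_1,\dots,h_p):\mathcal Z\to\mathbb R^p$ is a measurable function, and $Y_i=\mu_i-\omega_i$, where the $\mu_i$ are unknown constants and $\omega_1,\dots,\omega_N$ are independent mean-zero square-integrable random variables. $f_1,\dots,f_N:\mathbb R\to\mathbb R$ are given functions, and the loss functions are $\gamma_i(t,Y_i)=(Y_i-f_i(t))^2/2$. Put $d_j=\max_{i\le N}|h_j(Z_i)|$, assumed positive for all $j\le p$. Regularity assumption with $m=1$. There are $-\infty\le a_i<b_i\le\infty$, $i\le N$, such that each $f_i$ is differentiable on $(a_i,b_i)$ with $f_i'$ bounded and Lipschitz there. $F_1=\max_{i\le N}\sup_{t\in(a_i,b_i)}|f_i'(t)|$ and $F_2=\max_{i\le N}\|f_i'\|_{\rm Lip}$, where $\|f\|_{\rm Lip}=\sup_{x\ne y}|f(x)-f(y)|/|x-y|$ over $(a_i,b_i)$. Parameter Domain assumption. $D_0\subset\mathbb R^p$ is a nonempty domain (of candidate parameter values) with $h(Z_i)^\top v\in(a_i,b_i)$ for all $v\in D_0$, $i\le N$. Gaussian assumption. $\omega_1,\dots,\omega_N$ are independent (mean-zero) Gaussian variables with $\mathrm{Var}(\omega_i)\le\sigma_0^2$, $i\le N$, where $\sigma_0\in(0,\infty)$ is a constant.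
   Formalization: The random variable ξ₁ is allowed to depend on v, with the tail bound stated for sup over v in D₀ of |ξ₁(v)|; a single v-free ξ₁ is impossible (p=N=1, h=1, f(t)=t, D₀=(-1,1), θ=0). *)

(* Defs.v *)
From mathcomp Require Import all_boot all_order all_algebra.
From mathcomp Require Import all_classical all_reals all_analysis.

Set Implicit Arguments.
Unset Strict Implicit.
Unset Printing Implicit Defensive.

Import Order.TTheory GRing.Theory Num.Theory.
Import numFieldNormedType.Exports.

Local Open Scope classical_set_scope.
Local Open Scope ring_scope.

Section probability_notions.
Context {d : measure_display} {T : measurableType d} {R : realType}.
Variable P : probability T R.

Definition mutually_independent (N : nat) (X : 'I_N -> {RV P >-> R}) : Prop :=
  forall (J : {set 'I_N}) (B : 'I_N -> set R),
    (forall i, measurable (B i)) ->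
    P (\bigcap_(i in [set` J]) (X i @^-1` B i)) =
    (\prod_(i in J) P (X i @^-1` B i))%E.

(* A point mass counts as a Gaussian law with zero variance. It needs its own
   case, because normal_prob m 0 is the uniform law on `[0, 1]. *)
Definition gaussian_law (m s : R) (A : set R) : \bar R :=
  if s == 0 then \d_m A else normal_prob m s A.

Definition gaussian (X : {RV P >-> R}) : Prop :=
  exists m s : R,
    forall A : set R, measurable A -> distribution P X A = gaussian_law m s A.

Definition sup_abs (V : Type) (D : set V) (X : V -> {RV P >-> R}) (x : T) :
  \bar R := ereal_sup [set `|X v x|%:E | v in D].

(* The measurability clause is part of the claim: D may be uncountable, and P
   is only meaningful on measurable sets. *)
Definition tail_le (S : T -> \bar R) (c : \bar R) (q : R) : Prop :=
  let E := [set x | (c < S x)%E] in measurable E /\ (P E <= q%:E)%E.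

End probability_notions.

Section regression_quantities.
Context {R : realType}.

Definition open_interval (a b : \bar R) : set R :=
  [set t : R | (a < t%:E)%E /\ (t%:E < b)%E].

Definition lip_seminorm (A : set R) (g : R -> R) : R :=
  sup [set r | exists x y : R,
         [/\ A x, A y, x != y & r = `|g x - g y| / `|x - y|]].

Definition dot (p : nat) (u v : 'rV[R]_p) : R := \sum_(j < p) u 0 j * v 0 j.

(* Maxima of nonnegative quantities over 'I_n are taken with base value 0. *)

Definition F1_const (N : nat) (f : 'I_N -> R -> R) (a b : 'I_N -> \bar R) : R :=
  \big[Num.max/0]_(i < N)
    sup [set `|derive1 (f i) t| | t in open_interval (a i) (b i)].

Definition F2_const (N : nat) (f : 'I_N -> R -> R) (a b : 'I_N -> \bar R) : R :=
  \big[Num.max/0]_(i < N)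
    lip_seminorm (open_interval (a i) (b i)) (derive1 (f i)).

(* In the next definitions H i j stands for h_j(Z_i). *)

Definition d_const (N p : nat) (H : 'I_N -> 'rV[R]_p) (j : 'I_p) : R :=
  \big[Num.max/0]_(i < N) `|H i 0 j|.

Definition wdist1 (p : nat) (c : 'I_p -> R) (u v : 'rV[R]_p) : R :=
  \sum_(j < p) c j * `|u 0 j - v 0 j|.

(* Nothing prevents D0 from being unbounded, so the diameter, and with it phi,
   A and B, are extended reals; if F2 = 0 and the diameter is infinite, the
   products F2 R and psi R are 0 (0 * +oo = 0). *)

Definition R_const (p : nat) (c : 'I_p -> R) (D0 : set 'rV[R]_p) : \bar R :=
  ereal_sup [set r | exists u v : 'rV[R]_p,
               [/\ D0 u, D0 v & r = (wdist1 c u v)%:E]].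

Definition phi_const (F1 F2 : R) (diam : \bar R) : \bar R :=
  Order.min (2 * F1)%:E ((F2 / 2)%:E * diam)%E.

Definition psi_const (F2 : R) : R := F2 / 2.

Definition max_col (N p : nat) (H : 'I_N -> 'rV[R]_p) (c : 'I_p -> R) : R :=
  \big[Num.max/0]_(j < p) \sum_(i < N) (H i 0 j / c j) ^+ 2.

Definition A_const (N p : nat) (H : 'I_N -> 'rV[R]_p) (c : 'I_p -> R)
    (F2 : R) (diam : \bar R) : \bar R :=
  ((8 * psi_const F2)%:E * diam * (Num.sqrt (max_col H c))%:E)%E.

Definition B_const (N p : nat) (H : 'I_N -> 'rV[R]_p) (c : 'I_p -> R)
    (F1 F2 : R) (diam : \bar R) : \bar R :=
  (phi_const F1 F2 diam * (Num.sqrt (max_col H c))%:E)%E.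

(* s2 i stands for the variance of omega_i. *)
Definition w_const (N p : nat) (H : 'I_N -> 'rV[R]_p) (sigma0 : R)
    (s2 : 'I_N -> R) (j : 'I_p) : R :=
  Num.sqrt (sigma0 ^- 2 * \sum_(i < N) s2 i * H i 0 j ^+ 2).

End regression_quantities.

(* Main.v *)
From HB Require Import structures.
Require Import Defs.
From mathcomp Require Import all_boot all_order all_algebra.
From mathcomp Require Import all_classical all_reals all_analysis.
From mathcomp Require Import measurable_realfun.
From mathcomp Require Import ring lra.

Set Implicit Arguments.
Unset Strict Implicit.
Unset Printing Implicit Defensive.

Import Order.TTheory GRing.Theory Num.Theory.
Import numFieldNormedType.Exports.

Local Open Scope classical_set_scope.
Local Open Scope ring_scope.

(** Write [t i v] for the linear form [h(Z_i) . v]. The increment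
    [f_i (t i v) - f_i (t i theta)] splits into its linear part
    [f_i' (t i theta) * (t i v - t i theta)], from which [xi1] is made, and the
    product of [t i v - t i theta] with the gap between the divided difference of
    [f_i] and [f_i' (t i theta)], from which [xi] is made. Both processes are linear
    in the noise, with coefficients that depend on [v].

    For [xi1]: expanding [t i v - t i theta] in coordinates bounds [xi1 v], for every
    [v] at once, by the largest of [p] normalized Gaussian variables (the partial
    derivatives at [theta]). The tail [exp (- x ^ 2 / 2)] of one of them
    ([gaussian_form_tail]) and a union bound conclude.

    For [xi]: the same expansion bounds [xi v] by the largest of [p] remainders, one
    for each coordinate, so a union bound leaves the supremum over [v] of one
    Gaussian process, whose coefficients are the gaps up to factors of modulus at most
    one. Over a finite set of parameters, [gaussian_process_tail] combines three
    facts. The gaps are Lipschitz with constant [F2 / 2] ([slope_lipschitz]), so by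
    comparison ([gaussian_contraction]) the expected maximum is at most that of a
    linear process on an l1-ball, which is attained at the vertices and costs
    [sqrt (ln (2 * p))]; this is the term in [A]. Markov's inequality turns the
    expectation into a bound for a median. As the gaps are at most [phi], the maximum
    is a Lipschitz function of the noise, and it exceeds its median with a Gaussian
    tail of the optimal rate ([gaussian_concentration]); this is the term in [B].
    Finally the supremum over the whole domain is a countable one
    ([countable_sup_abs]), hence an increasing limit of finite ones.

    The concentration inequality comes from convexity. Brunn-Minkowski on the line,
    applied to level sets, gives the Prekopa-Leindler inequality; with the strong
    log-concavity of the Gaussian density it becomes an inequality between
    exponential means of two functions ([gauss_transport]) that passes from one
    coordinate to independent families ([joint_transport]); and two indicator
    functions turn it into concentration. *)

(** * Divided differences *)

Section divided_difference.
Variable R : realType.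
Implicit Types (f : R -> R) (I : set R).

(** The derivative fills the diagonal, which makes [slope f t0] continuous at [t0] for a
    differentiable [f]. *)
Definition slope f (t0 t : R) : R :=
  if t == t0 then derive1 f t0 else (f t - f t0) / (t - t0).

Lemma mul_slope f t0 t : (t - t0) * slope f t0 t = f t - f t0.
Proof.
rewrite /slope; case: eqVneq => [->|tt0]; first by rewrite !subrr mul0r.
by rewrite mulrC divfK// subr_eq0.
Qed.

Lemma slope_diag f t0 : slope f t0 t0 = derive1 f t0.
Proof. by rewrite /slope eqxx. Qed.

(** A primitive of [r |-> f' (t0 + r * (t - t0))] that vanishes at 0 and equals the
    divided difference at 1: bounds on [f'] pass to [slope] by the mean value theorem
    for [chord]. *)
Let chord f (t0 t r : R) : R :=
  if t == t0 then r * derive1 f t0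
  else (f (t0 + r * (t - t0)) - f t0) / (t - t0).

Let chord0 f t0 t : chord f t0 t 0 = 0.
Proof. by rewrite /chord !mul0r addr0 subrr !mul0r if_same. Qed.

Let chord1 f t0 t : chord f t0 t 1 = slope f t0 t.
Proof. by rewrite /chord /slope !mul1r addrCA subrr addr0. Qed.

Let is_derive_chord f (t0 t r : R) : derivable f (t0 + r * (t - t0)) 1 ->
  is_derive r 1 (chord f t0 t) (derive1 f (t0 + r * (t - t0))).
Proof.
rewrite /chord; case: eqVneq => [->|tt0] /= dft.
  rewrite subrr mulr0 addr0.
  by apply: is_derive_eq; rewrite /GRing.scale/=; ring.
have dlin : is_derive r 1 (fun r => t0 + r * (t - t0)) (t - t0).
  by apply: is_derive_eq; rewrite /GRing.scale/=; ring.
have df : is_derive (t0 + r * (t - t0)) 1 f (derive1 f (t0 + r * (t - t0))).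
  by rewrite derive1E; exact: derivableP.
have dcomp := is_derive1_comp (f := f) (g := fun r => t0 + r * (t - t0)).
have {}dcomp := dcomp _ _ _ df dlin.
have tt0' : t - t0 != 0 by rewrite subr_eq0.
by apply: is_derive_eq; rewrite /GRing.scale/=; field.
Qed.

Variables (I : set R) (f : R -> R).
Hypothesis I_itv : is_interval I.
Hypothesis df : forall t, I t -> derivable f t 1.

Let I_between (t0 t r : R) : I t0 -> I t -> 0 <= r <= 1 -> I (t0 + r * (t - t0)).
Proof.
move=> It0 It /andP[r0 r1]; have [tt0|/ltW tt0] := leP t0 t.
  by apply: (I_itv It0 It); apply/andP; split; nra.
by apply: (I_itv It It0); apply/andP; split; nra.
Qed.

Let chord_continuous t0 t : I t0 -> I t ->
  {within `[0, 1], continuous (chord f t0 t)}.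
Proof.
move=> It0 It; apply: derivable_within_continuous => r; rewrite in_itv/= => r01.
by have [] := is_derive_chord (df (I_between It0 It r01)).
Qed.

Lemma slope_bound (C : R) t0 t : (forall x, I x -> `|derive1 f x| <= C) ->
  I t0 -> I t -> `|slope f t0 t| <= C.
Proof.
move=> fC It0 It.
have [||c] := @MVT_segment R (chord f t0 t)
    (fun r => derive1 f (t0 + r * (t - t0))) 0 1 ler01.
- move=> r r01; apply: is_derive_chord; apply: df; apply: I_between => //.
  by move: r01; rewrite in_itv/= => /andP[/ltW -> /ltW ->].
- exact: chord_continuous.
rewrite in_itv/= => c01; rewrite chord0 chord1 !subr0 mulr1 => ->.
exact/fC/I_between.
Qed.

(** At the fraction [r] of the way, the two segments from [t0] are [r * |t - u|] apart,
    and the mean of [r] over the unit interval is one half. *)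
Lemma slope_lipschitz (L : R) t0 t u :
  (forall x y, I x -> I y -> `|derive1 f x - derive1 f y| <= L * `|x - y|) ->
  I t0 -> I t -> I u ->
  `|slope f t0 t - slope f t0 u| <= L / 2 * `|t - u|.
Proof.
move=> fL It0.
wlog suff bound : t u / I t -> I u ->
    slope f t0 t - slope f t0 u <= L / 2 * `|t - u|.
  by move=> It Iu; rewrite ler_norml bound// andbT lerNl opprB distrC bound.
(* the primitive of the bound [D * r] for the difference of the two derivatives *)
move=> It Iu; pose D := L * `|t - u|.
pose g r := chord f t0 t r - chord f t0 u r - D / 2 * r ^+ 2.
have dg (r : R) : r \in `[0, 1] -> is_derive r 1 g
    (derive1 f (t0 + r * (t - t0)) - derive1 f (t0 + r * (u - t0)) - D * r).
  rewrite in_itv/= => r01.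
  have d1 := is_derive_chord (df (I_between It0 It r01)).
  have d2 := is_derive_chord (df (I_between It0 Iu r01)).
  by apply: is_derive_eq; rewrite /GRing.scale/=; field.
pose dg1 (r : R) : R := derive1 f (t0 + r * (t - t0)) - derive1 f (t0 + r * (u - t0)) - D * r.
have dg1P (r : R) : r \in `]0, 1[ -> is_derive r 1 g (dg1 r).
  by move=> r01; apply: dg; exact: subset_itv_oo_cc r01.
have gcont : {within `[0, 1], continuous g}.
  by apply: derivable_within_continuous => r r01; have [] := dg _ r01.
have [c c01 gE] := MVT_segment ler01 dg1P gcont; move: c01 gE.
rewrite in_itv/= /dg1 => c01; have /andP[c0 c1] := c01.
rewrite /g !chord0 !chord1 expr0n/= mulr0 !subr0 expr1n !mulr1 => gE.
have := fL _ _ (I_between It0 It c01) (I_between It0 Iu c01).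
have -> : t0 + c * (t - t0) - (t0 + c * (u - t0)) = c * (t - u) by ring.
rewrite normrM (ger0_norm c0) => /ler_normlW le1.
rewrite -subr_le0 (_ : L / 2 * _ = D / 2) ?gE; last by rewrite /D mulrAC.
by rewrite subr_le0 (le_trans le1)// /D mulrCA mulrC.
Qed.

End divided_difference.

(** * The Brunn-Minkowski inequality on the line *)

Section lebesgue_affine.
Context {R : realType}.
Local Notation mu := (@lebesgue_measure R).

Lemma measurable_affine (c b : R) :
  measurable_fun setT (fun x : R => c * x + b).
Proof. by apply: measurable_funD => //; exact: measurable_funM. Qed.

Lemma lebesgue_measure_affine (c b : R) (A : set R) : 0 < c -> measurable A ->
  (c%:E * mu [set x | A (c * x + b)%R] = mu A)%E.
Proof.
move=> c0 mA.
pose phi : measurableTypeR R -> measurableTypeR R := fun x => c * x + b.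
have mphi : measurable_fun setT phi by exact: measurable_affine.
pose mphi_mixin := isMeasurableFun.Build _ _ _ _ _ mphi.
pose mphi_pack : {mfun _ >-> _} := HB.pack phi mphi_mixin.
pose c' := NngNum (ltW c0).
have /= -> := @lebesgue_measure_unique R (mscale c' (pushforward mu mphi_pack)) _ _ mA.
  by [].
move=> _ [[u v]] _ <-; rewrite /mscale/= /pushforward.
rewrite (_ : phi @^-1` _ = `](u - b) / c, (v - b) / c]%classic); last first.
  apply/seteqP; split => x /=; rewrite !in_itv/= /phi;
    by rewrite ltr_pdivrMr// ler_pdivlMr// ltrBlDr lerBrDr (mulrC x).
rewrite !lebesgue_measure_itv/= !lte_fin ltr_pM2r ?invr_gt0//.
rewrite ltrD2r; case: ifPn => _; last by rewrite mule0.
rewrite -!EFinD -EFinM; congr EFin.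
by rewrite -mulrBl opprB addrA subrK mulrC divfK// gt_eqF.
Qed.

Let le_mu (A B : set R) : measurable A -> measurable B -> A `<=` B ->
  (mu A <= mu B)%E.
Proof. by move=> mA mB AB; apply: le_measure => //; exact: mem_set. Qed.

(** The initial segments of [A] that end in a point of [A] exhaust it, except perhaps
    for the supremum of [A], which is a null set. *)
Lemma mu_initial_le (A : set R) (K : \bar R) : measurable A -> A !=set0 ->
  (forall a, A a -> (mu (A `&` [set x | (x <= a)%R]) <= K)%E) -> (mu A <= K)%E.
Proof.
move=> mA [a0 Aa0] AK.
have minit (a : R) : measurable [set x : R | (x <= a)%R].
  by rewrite -set_itvNyc; exact: measurable_itv.
have mono (r : nat -> R) : nondecreasing_seq r -> 
    (forall n, exists2 a, A a & r n <= a) ->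
    (mu (\bigcup_n (A `&` [set x | (x <= r n)%R])) <= K)%E.
  move=> ndr rA; pose F n := A `&` [set x | (x <= r n)%R].
  have mF n : measurable (F n) by apply: measurableI.
  have ndF : nondecreasing_seq F.
    move=> n m nm; apply/subsetPset => x [Ax/= xr]; split => //=.
    by rewrite (le_trans xr)// ndr.
  have /cvg_lim <- // :=
    nondecreasing_cvg_mu (mu := mu) mF (bigcupT_measurable _ mF) ndF.
  apply: lime_le.
    apply: ereal_nondecreasing_is_cvgn => n m nm; apply: le_mu => // x [Ax/= xr];
      split => //=.
    by rewrite (le_trans xr)// ndr.
  apply: nearW => n; have [a Aa rna] := rA n.
  apply: le_trans (AK _ Aa); apply: le_mu => //; first exact: measurableI.
  by move=> x [Ax/= xr]; split => //=; rewrite (le_trans xr).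
have [ubA|nubA] := pselect (has_ubound A); last first.
  pose r n : R := n%:R.
  have ndr : nondecreasing_seq r by move=> n m nm; rewrite ler_nat.
  have rA n : exists2 a, A a & r n <= a.
    apply: contrapT => nA; apply: nubA; exists n%:R => x Ax.
    by rewrite leNgt; apply/negP => nx; apply: nA; exists x => //; exact: ltW.
  apply: le_trans (mono r ndr rA); apply: le_mu => //.
    by apply: bigcupT_measurable => n; exact: measurableI.
  move=> x Ax; exists (Num.truncn `|x|).+1 => //; split => //=.
  by rewrite (le_trans (ler_norm _))// ltW// truncnS_gt.
have supA : has_sup A by split => //; exists a0.
pose r n : R := sup A - n.+1%:R^-1.
have ndr : nondecreasing_seq r.
  by move=> n m nm; rewrite /r lerD2l lerN2 lef_pV2 ?posrE// ler_nat.
have rA n : exists2 a, A a & r n <= a.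
  have [|a Aa ra] := @sup_adherent _ A n.+1%:R^-1 _ supA; first by [].
  by exists a => //; exact: ltW.
have mU : measurable (\bigcup_n (A `&` [set x | (x <= r n)%R])).
  by apply: bigcupT_measurable => n; exact: measurableI.
apply: le_trans (mono r ndr rA); rewrite -[X in (_ <= X)%E](@measureU0 _ _ _ mu _ [set sup A]) //.
- apply: le_mu => //; first exact: measurableU.
  move=> x Ax; have [->|xS] := eqVneq x (sup A); [by right|left].
  have {}xS : 0 < sup A - x by rewrite subr_gt0 lt_neqAle xS ub_le_sup.
  exists (Num.truncn (sup A - x)^-1) => //; split => //=.
  by rewrite /r lerBrDr -lerBrDl invf_ple ?posrE// ltW// truncnS_gt.
- exact: lebesgue_measure_set1.
Qed.

Lemma mu_final_le (A : set R) (K : \bar R) : measurable A -> A !=set0 ->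
  (forall a, A a -> (mu (A `&` [set x | (a <= x)%R]) <= K)%E) -> (mu A <= K)%E.
Proof.
move=> mA [a0 Aa0] AK.
have mN (B : set R) : measurable B -> measurable (-%R @^-1` B).
  move=> mB; rewrite -[X in measurable X]setTI.
    exact: (@oppr_measurable R setT measurableT _ mB).
have muN (B : set R) : measurable B -> mu (-%R @^-1` B) = mu B.
  exact: lebesgue_measureN.
rewrite -muN//; apply: mu_initial_le; first exact: mN.
  by exists (- a0); rewrite /= opprK.
move=> a /AK; rewrite -muN.
  congr (mu _ <= _)%E; apply/seteqP; split => x [Ax/= xa]; split => //=;
  by rewrite ?lerN2 // -lerN2.
by apply: measurableI => //; rewrite -set_itvcy; exact: measurable_itv.
Qed.

(** The set [C] stands for any measurable set around the Minkowski average,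
    which itself may fail to be measurable. Given [a] in [A] and [b] in [B], average
    the part of [A] left of [a] with [b], and [a] with the part of [B] right of [b]:
    the two sets obtained lie in [C] and overlap in one point at most, and their
    measures are known. *)
Lemma brunn_minkowski1 (s : R) (A B C : set R) : 0 < s < 1 ->
  measurable A -> measurable B -> measurable C -> A !=set0 -> B !=set0 ->
  (forall x y, A x -> B y -> C ((1 - s) * x + s * y)) ->
  ((1 - s)%:E * mu A + s%:E * mu B <= mu C)%E.
Proof.
move=> /andP[s0 s1] mA mB mC A0 B0 ABC; set r := 1 - s.
have r0 : 0 < r by rewrite subr_gt0.
have [->|Coo] := eqVneq (mu C) +oo%E; first by rewrite leey.
have muC : mu C \is a fin_num by rewrite ge0_fin_numE// ltey.
have minit (a : R) : measurable [set x : R | (x <= a)%R].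
  by rewrite -set_itvNyc; exact: measurable_itv.
have mfin (a : R) : measurable [set x : R | (a <= x)%R].
  by rewrite -set_itvcy; exact: measurable_itv.
have key a b : A a -> B b ->
    (r%:E * mu (A `&` [set x | (x <= a)%R]) +
     s%:E * mu (B `&` [set x | (b <= x)%R]) <= mu C)%E.
  move=> Aa Bb.
  have aff (c e : R) (D : set R) : 0 < c -> measurable D ->
      (c%:E * mu D = mu [set z | D (c^-1 * z + e)%R])%E.
    move=> c0 mD; rewrite -(@lebesgue_measure_affine c^-1 e D) ?invr_gt0//.
    by rewrite muleA -EFinM divff ?gt_eqF// mul1e.
  have mpre (c e : R) (D : set R) : measurable D ->
      measurable [set z : R | D (c * z + e)].
    by move=> mD; rewrite -[X in measurable X]setTI; exact: measurable_affine.
  have mA' : measurable (A `&` [set x | x <= a]) by exact: measurableI.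
  have mB' : measurable (B `&` [set x | b <= x]) by exact: measurableI.
  rewrite (aff r (- (r^-1 * (s * b)))) // (aff s (- (s^-1 * (r * a)))) //.
  set C1 := [set z | _]; set C2 := [set z | _].
  have mC1 : measurable C1 by exact: mpre.
  have mC2 : measurable C2 by exact: mpre.
  pose c := r * a + s * b.
  have C1le z : C1 z -> z <= c.
    rewrite /C1/= -mulrBr => -[_]; rewrite mulrC ler_pdivrMr// lerBlDr.
    by rewrite /c (mulrC a).
  have C2ge z : C2 z -> c <= z.
    rewrite /C2/= -mulrBr => -[_]; rewrite mulrC ler_pdivlMr// lerBrDr.
    by rewrite /c (mulrC b) addrC.
  have mc : measurable [set c] by [].
  have mC2c : measurable (C2 `\ c) by exact: measurableD.
  have leC2 : (mu C2 <= mu (C2 `\ c))%E.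
    rewrite -[X in (_ <= X)%E](@measureU0 _ _ _ mu _ [set c]) //; last exact: lebesgue_measure_set1.
    apply: le_mu => //; first exact: measurableU.
    by move=> z Cz; have [->|/eqP zc] := eqVneq z c; [right|left].
  apply: (le_trans (leeD2l _ leC2)); rewrite -measureU//; last first.
    apply/seteqP; split => z //= -[/C1le zc [/C2ge cz /= zNc]]; apply: zNc.
    by apply/eqP; rewrite eq_le zc.
  apply: le_mu => //; first exact: measurableU.
  move=> z [|[+ _]]; rewrite /C1 /C2 /= => -[h1 _].
    rewrite (_ : z = r * (r^-1 * z - r^-1 * (s * b)) + s * b); first exact: ABC.
    by rewrite -mulrBr mulVKf ?subrK// gt_eqF.
  rewrite (_ : z = r * a + s * (s^-1 * z - s^-1 * (r * a))); first exact: ABC.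
  by rewrite -mulrBr mulVKf ?gt_eqF// addrC subrK.
have fin1 x y : (0 <= x -> 0 <= y -> x + y <= mu C -> x \is a fin_num)%E.
  move=> x0 y0 xyC; rewrite ge0_fin_numE//; move: muC; rewrite ge0_fin_numE//.
  by apply: le_lt_trans; rewrite (le_trans _ xyC)// leeDl.
have r0' : (0 <= r%:E)%E by rewrite lee_fin ltW.
have s0' : (0 <= s%:E)%E by rewrite lee_fin ltW.
have key2 b : B b ->
    (r%:E * mu A + s%:E * mu (B `&` [set x | (b <= x)%R]) <= mu C)%E.
  move=> Bb; have [a Aa] := A0.
  have sB := fin1 _ _ (mule_ge0 s0' (measure_ge0 mu _))
    (mule_ge0 r0' (measure_ge0 mu _)).
  rewrite -leeBrDr; last by apply: sB; rewrite addeC; exact: key Aa Bb.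
  rewrite -lee_pdivlMl//; apply: mu_initial_le => // a' Aa'.
  rewrite lee_pdivlMl// leeBrDr; first exact: key.
  by apply: sB; rewrite addeC; exact: key Aa Bb.
have [b Bb] := B0.
have rA : (r%:E * mu A)%E \is a fin_num.
  by apply: fin1 (key2 _ Bb); rewrite mule_ge0.
rewrite addeC -leeBrDr// -lee_pdivlMl//; apply: mu_final_le => // b' Bb'.
by rewrite lee_pdivlMl// leeBrDr// addeC; exact: key2.
Qed.
End lebesgue_affine.

(** * The Prekopa-Leindler inequality on the line *)

Section level_sets.
Context d (T : measurableType d) (R : realType) (g : T -> R) (r : R).
Hypothesis mg : measurable_fun setT g.

Lemma measurable_superlevel : measurable [set x | r < g x].
Proof.
rewrite -[X in measurable X]setTI.
by have := measurable_fun_ltr (measurable_cst r) mg measurableT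
  (Y := [set true]); exact.
Qed.

Lemma measurable_sublevel : measurable [set x | g x <= r].
Proof.
rewrite -[X in measurable X]setTI.
by have := measurable_fun_ler mg (measurable_cst r) measurableT
  (Y := [set true]); exact.
Qed.

End level_sets.

Section layer_cake.
Context {R : realType}.
Local Notation mu := (@lebesgue_measure R).
Implicit Types u : R -> R.

(* the indicator of the region under the graph of [u], between heights 0 and 1 *)
Let below u (p : measurableTypeR R * measurableTypeR R) : \bar R :=
  (\1_[set q : R * R | 0 < q.2 < 1 /\ q.2 < u q.1] p)%:E.

Let measurable_below u : measurable_fun setT u -> measurable_fun setT (below u).
Proof.
move=> mu_; apply/measurable_EFinP/measurable_indic => /=.
pose g1 (q : measurableTypeR R * measurableTypeR R) := 0 < q.2.
pose g2 (q : measurableTypeR R * measurableTypeR R) := q.2 < 1.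
pose g3 (q : measurableTypeR R * measurableTypeR R) := q.2 < u q.1.
rewrite [X in measurable X](_ : _ = g1 @^-1` [set true] `&` g2 @^-1` [set true]
    `&` g3 @^-1` [set true]); last first.
  apply/seteqP; split => q /=; first by move=> [/andP[]].
  by rewrite /g1 /g2 /g3 => -[[-> ->] ->].
have m1 : measurable_fun setT g1 by exact: measurable_fun_ltr.
have m2 : measurable_fun setT g2 by exact: measurable_fun_ltr.
have m3 : measurable_fun setT g3.
  by apply: measurable_fun_ltr => //; exact: measurableT_comp.
by apply: measurableI; [apply: measurableI|]; rewrite -[X in measurable X]setTI;
  [exact: m1|exact: m2|exact: m3].
Qed.

Let below_ge0 u p : (0 <= below u p)%E.
Proof. by rewrite lee_fin. Qed.

Let below_section u t : measurable_fun setT u ->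
  (\int[mu]_x below u (x, t))%E =
  ((fun t => mu [set x | (t < u x)%R]) \_ (`]0, 1[%classic : set R)) t.
Proof.
move=> mu_; rewrite patchE; case: ifPn => [|].
  rewrite inE/= in_itv/= => t01.
  transitivity (\int[mu]_x (\1_[set x | (t < u x)%R] x)%:E)%E.
    apply: eq_integral => x _; rewrite /below !indicE; congr ((_ : bool)%:R%:E).
    by apply/idP/idP; rewrite !inE/=; [move=> [] | move=> ?; split].
  by rewrite integral_indic ?setIT//; exact: measurable_superlevel.
rewrite notin_setE/= in_itv/= => t01; apply: integral0_eq => x _.
by rewrite /below indicE memNset//= => -[].
Qed.

Lemma measurable_upper_level u : measurable_fun setT u ->
  measurable_fun (`]0, 1[%classic : set R) (fun t => mu [set x | (t < u x)%R]).
Proof.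
move=> mu_; apply/(measurable_restrictT _ (measurable_itv _)).
have := @measurable_fun_fubini_tonelli_G _ _ _ _ _ mu _ (measurable_below mu_) (@below_ge0 u).
by apply: eq_measurable_fun => t _; rewrite /fubini_G below_section.
Qed.

(** Capping [u] at 1 keeps only the levels below 1: these are the levels at which the
    level sets of a function of supremum 1 are nonempty. *)
Lemma layer_cake u : measurable_fun setT u -> (forall x, 0 <= u x) ->
  (\int[mu]_x (Num.min (u x) 1)%:E =
   \int[mu]_(t in `]0%R, 1%R[) mu [set x | (t < u x)%R])%E.
Proof.
move=> mu_ u0.
transitivity (\int[mu]_x \int[mu]_t below u (x, t))%E; last first.
  rewrite (fubini_tonelli _ (measurable_below mu_))//.
  rewrite [RHS]integral_mkcond; apply: eq_integral => t _.
  exact: below_section.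
apply: eq_integral => x _.
transitivity (\int[mu]_t (\1_(`]0%R, (Num.min (u x) 1)%R[%classic : set R) t)%:E)%E.
  rewrite integral_indic//= setIT lebesgue_measure_itv/= lte_fin.
  case: ifPn => [|]; first by rewrite sube0.
  rewrite -leNgt => min0; congr EFin; apply/eqP; rewrite eq_le min0/=.
  by rewrite le_min u0/=.
apply: eq_integral => t _; rewrite /below !indicE; congr ((_ : bool)%:R%:E).
apply/idP/idP; rewrite !inE/= !in_itv/=.
  by rewrite lt_min => /and3P[-> -> ->].
by rewrite lt_min => -[/andP[-> ->] ->].
Qed.

End layer_cake.

Section prekopa_leindler.
Context {R : realType}.
Local Notation mu := (@lebesgue_measure R).

Lemma weighted_amgm (s a b : R) : 0 < s < 1 -> 0 <= a -> 0 <= b ->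
  a `^ (1 - s) * b `^ s <= (1 - s) * a + s * b.
Proof.
move=> /andP[s0 s1] a0 b0; have r0 : 0 < 1 - s by rewrite subr_gt0.
have := @conjugate_powR R (a `^ (1 - s)) (b `^ s) (1 - s)^-1 s^-1.
rewrite !powR_ge0 !invr_gt0 r0 s0 !invrK subrK => /(_ isT isT isT isT erefl).
rewrite -!powRrM !divff ?gt_eqF// !powRr1// => le1;
  by rewrite (mulrC _ a) (mulrC _ b).
Qed.

(** After division of [u] and [v] by their suprema, their level sets at a common
    height below 1 are nonempty, and the level set of [h] contains their average.
    Brunn-Minkowski at every height and integration over the heights bound a weighted
    arithmetic mean, which dominates the geometric one. *)
Lemma prekopa_leindler1 (s M a b c : R) (u v h : R -> R) : 0 < s < 1 ->
  measurable_fun setT u -> measurable_fun setT v -> measurable_fun setT h ->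
  (forall x, 0 <= u x <= M) -> (forall x, 0 <= v x <= M) ->
  (forall x, 0 <= h x) ->
  (forall x y, u x `^ (1 - s) * v y `^ s <= h ((1 - s) * x + s * y)) ->
  (\int[mu]_x (u x)%:E = a%:E)%E -> (\int[mu]_x (v x)%:E = b%:E)%E ->
  (\int[mu]_x (h x)%:E = c%:E)%E ->
  a `^ (1 - s) * b `^ s <= c.
Proof.
move=> s01 mu_ mv mh uM vM h0 uvh ua vb hc.
have /andP[s0 s1] := s01; have r0 : 0 < 1 - s by rewrite subr_gt0.
have intge0 (g : R -> R) (e : R) : (forall x, 0 <= g x) ->
    (\int[mu]_x (g x)%:E = e%:E)%E -> 0 <= e.
  by move=> g0 ge; rewrite -lee_fin -ge; apply: integral_ge0 => x _; rewrite lee_fin.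
have u0 x : 0 <= u x by have /andP[] := uM x.
have v0 x : 0 <= v x by have /andP[] := vM x.
have a0 : 0 <= a by exact: intge0 ua.
have b0 : 0 <= b by exact: intge0 vb.
have c0 : 0 <= c by exact: intge0 hc.
have supM (g : R -> R) (e : R) : (forall x, 0 <= g x <= M) ->
    (\int[mu]_x (g x)%:E = e%:E)%E -> e != 0 ->
    [/\ 0 < sup (range g), forall x, g x <= sup (range g) &
        forall t, t < 1 -> exists x, t < g x / sup (range g)].
  move=> gM ge e0.
  have [x gx] : exists x, g x != 0.
    apply: contrapT => /forallNP g0; move: e0; rewrite -eqe -ge.
    rewrite integral0_eq ?eqxx// => x _; congr EFin; apply/eqP/negPn/negP.
    exact: g0.
  have gub : ubound (range g) M by move=> _ [y _ <-]; have /andP[] := gM y.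
  have supg : has_sup (range g) by split; [exists (g x), x|exists M].
  have gle y : g y <= sup (range g) by apply: ub_le_sup; [exists M|exists y].
  have sup0 : 0 < sup (range g).
    by apply: lt_le_trans (gle x); rewrite lt_neqAle eq_sym gx; have /andP[] := gM x.
  split => // t t1.
  have [|_ [y _ <-] tg] := @sup_adherent _ (range g) (sup (range g) * (1 - t)) _ supg.
    by rewrite mulr_gt0// subr_gt0.
  by exists y; rewrite ltr_pdivlMr// mulrC; lra.
have [aE0|an0] := eqVneq a 0; first by rewrite aE0 powR0 ?gt_eqF// mul0r.
have [bE0|bn0] := eqVneq b 0; first by rewrite bE0 powR0 ?gt_eqF// mulr0.
have [al0 ule uex] := supM u a uM ua an0.
have [be0 vle vex] := supM v b vM vb bn0.
set al := sup (range u) in al0 ule uex *; set be := sup (range v) in be0 vle vex *.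
pose ka := al `^ (1 - s) * be `^ s.
have ka0 : 0 < ka by rewrite mulr_gt0// powR_gt0.
have scaled (g : R -> R) (e k : R) : 0 < k -> measurable_fun setT g ->
    (forall x, 0 <= g x) -> (\int[mu]_x (g x)%:E = e%:E)%E ->
    (\int[mu]_x (g x / k)%:E = (e / k)%:E)%E.
  move=> k0 mg g0 ge; under eq_integral do rewrite EFinM.
  rewrite ge0_integralZr ?ge ?lee_fin ?invr_ge0 ?(ltW k0)//.
    exact/measurable_EFinP.
  by move=> x _; rewrite lee_fin.
have mdiv (g : R -> R) (k : R) : measurable_fun setT g ->
    measurable_fun setT (fun x => g x / k) by move=> mg; exact: measurable_funM.
have capped (g : R -> R) (k : R) : 0 < k -> (forall x, g x <= k) ->
    (\int[mu]_x (g x / k)%:E = \int[mu]_x (Num.min (g x / k) 1)%:E)%E.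
  move=> k0 gk; apply: eq_integral => x _; congr EFin; apply/esym/min_idPl.
  by rewrite ler_pdivrMr// mul1r.
have bm t : `]0, 1[%classic t ->
    ((1 - s)%:E * mu [set x | (t < u x / al)%R] + s%:E * mu [set x | (t < v x / be)%R]
      <= mu [set x | (t < h x / ka)%R])%E.
  rewrite /= in_itv/= => /andP[t0 t1].
  have mlev (g : R -> R) k : measurable_fun setT g ->
      measurable [set x | t < g x / k].
    by move=> mg; apply: measurable_superlevel; exact: mdiv.
  apply: brunn_minkowski1 => //; try exact: mlev; [exact: uex|exact: vex|].
  move=> x y /= tu tv; rewrite ltr_pdivlMr// (lt_le_trans _ (uvh x y))//.
  rewrite ltr_pdivlMr// in tu; rewrite ltr_pdivlMr// in tv.
  have -> : t * ka = (t * al) `^ (1 - s) * (t * be) `^ s.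
    rewrite !powRM ?(ltW t0) ?(ltW al0) ?(ltW be0)//.
    rewrite mulrACA -powRD; last by rewrite subrK oner_eq0.
    by rewrite subrK powRr1// ltW.
  apply: ltr_pM; rewrite ?powR_ge0//; apply: gt0_ltr_powR => //;
    by rewrite nnegrE// mulr_ge0// ltW.
have level : (((1 - s) * (a / al) + s * (b / be))%:E <= (c / ka)%:E)%E.
  rewrite -(scaled h c ka)//.
  apply: (@le_trans _ _ (\int[mu]_x (Num.min (h x / ka) 1)%:E)%E); last first.
    apply: ge0_le_integral => //.
    - by move=> x _; rewrite lee_fin le_min ler01 divr_ge0// ltW.
    - apply/measurable_EFinP; apply: measurable_minr => //; exact: mdiv.
    - by apply/measurable_EFinP; exact: mdiv.
    - by move=> x _; rewrite lee_fin ge_min lexx.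
  have hk0 x : 0 <= h x / ka by rewrite divr_ge0// ltW.
  have uk0 x : 0 <= u x / al by rewrite divr_ge0// ltW.
  have vk0 x : 0 <= v x / be by rewrite divr_ge0// ltW.
  rewrite EFinD (EFinM (1 - s)) (EFinM s) -(scaled u a al)// -(scaled v b be)//.
  rewrite (capped u al)// (capped v be)//.
  rewrite !layer_cake//; do 3?exact: mdiv.
  have mI : measurable (`]0, 1[%classic : set R) by exact: measurable_itv.
  have mlev (g : R -> R) k : measurable_fun setT g ->
      measurable_fun (`]0, 1[%classic : set R) (fun t => mu [set x | (t < g x / k)%R]).
    by move=> mg; apply: measurable_upper_level; exact: mdiv.
  have mZ (k : R) (g : R -> \bar R) : measurable_fun (`]0, 1[%classic : set R) g ->
      measurable_fun (`]0, 1[%classic : set R) (fun t => k%:E * g t)%E.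
    by move=> mg; exact: measurable_funeM.
  rewrite -!ge0_integralZl ?lee_fin ?(ltW r0) ?(ltW s0)//; try exact: mlev.
  rewrite -ge0_integralD//; try by apply: mZ; exact: mlev.
  - apply: ge0_le_integral => //.
    + by move=> t _; rewrite adde_ge0// mule_ge0// lee_fin ltW.
    + by apply: emeasurable_funD; apply: mZ; exact: mlev.
    + exact: mlev.
  - by move=> t _; rewrite mule_ge0// lee_fin ltW.
  - by move=> t _; rewrite mule_ge0// lee_fin ltW.
have := weighted_amgm s01 (divr_ge0 a0 (ltW al0)) (divr_ge0 b0 (ltW be0)).
rewrite !powRM ?invr_ge0 ?(ltW al0) ?(ltW be0)// => amgm.
have := le_trans amgm (level : _ <= _).
have powV (x r : R) : 0 <= x -> x^-1 `^ r = (x `^ r)^-1.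
  by move=> x0; rewrite -powR_inv1// -powRrM mulN1r powRN.
by rewrite !powV ?(ltW al0) ?(ltW be0)// mulrACA -invfM ler_pM2r ?invr_gt0.
Qed.
End prekopa_leindler.

(** * Integration against a density *)

Section density.
Context d (T : measurableType d) (R : realType).
Variables (mu nu : {measure set T -> \bar R}) (f : T -> R).
Hypotheses (mf : measurable_fun setT f) (f0 : forall x, 0 <= f x).
Hypothesis nuE : forall A, measurable A -> nu A = (\int[mu]_(x in A) (f x)%:E)%E.

Import HBNNSimple.

Let integral_density_nnsfun (h : {nnsfun T >-> R}) :
  (\int[nu]_x (h x)%:E = \int[mu]_x (h x * f x)%:E)%E.
Proof.
under [LHS]eq_integral do rewrite fimfunE -fsumEFin//.
rewrite [LHS]ge0_integral_fsum//; last 2 first.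
  - by move=> r; exact/measurable_EFinP/measurableT_comp.
  - by move=> n x _; rewrite EFinM nnfun_muleindic_ge0.
under [RHS]eq_integral.
  move=> x _; rewrite fimfunE mulrC mulr_fsumr -fsumEFin//; over.
rewrite [RHS]ge0_integral_fsum//; last 2 first.
  - move=> r; apply/measurable_EFinP/measurable_funM => //.
    exact: measurable_funM.
  - move=> r x _; rewrite lee_fin mulr_ge0//.
    by have := nnfun_muleindic_ge0 h r x; rewrite -EFinM lee_fin.
apply: eq_fsbigr => r /set_mem[y _ <-].
rewrite (eq_integral (fun x => (h y)%:E * (\1_(h @^-1` [set h y]) x)%:E)%E)//.
rewrite ge0_integralZl ?lee_fin//; try exact/measurable_EFinP.
rewrite integral_indic// setIT nuE//.
rewrite [RHS](eq_integral (fun x => (h y)%:E *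
   ((EFin \o f) \_ (h @^-1` [set h y])) x)%E); last first.
  move=> x _; rewrite mulrCA EFinM patchE indicE; congr (_ * _)%E.
  by case: (x \in _); rewrite ?mulr1 ?mulr0.
rewrite ge0_integralZl ?lee_fin//.
- by rewrite -integral_mkcond.
- apply/(measurable_restrictT (D := h @^-1` [set h y])) => //.
  by apply: measurable_funTS; exact/measurable_EFinP.
- by move=> x _; apply: erestrict_ge0 => z _; rewrite lee_fin.
Qed.

Lemma ge0_integral_density (g : T -> \bar R) : measurable_fun setT g ->
  (forall x, 0 <= g x)%E -> (\int[nu]_x g x = \int[mu]_x (g x * (f x)%:E))%E.
Proof.
move=> mg g0; pose h := nnsfun_approx measurableT mg.
have hg x : (h n x)%:E @[n --> \oo] --> g x.
  by apply: (cvg_nnsfun_approx measurableT mg).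
have nd_h x : {homo (fun n => h n x) : n m / (n <= m)%N >-> n <= m}.
  by move=> n m nm; exact/lefP/nd_nnsfun_approx.
transitivity (limn (fun n => \int[nu]_x (h n x)%:E)%E).
  rewrite -monotone_convergence//.
  - by apply: eq_integral => x _; apply/esym/cvg_lim => //; exact: hg.
  - by move=> n; exact/measurable_EFinP.
  - by move=> n x _; rewrite lee_fin.
  - by move=> x _ n m nm; rewrite lee_fin nd_h.
under eq_fun do rewrite integral_density_nnsfun.
rewrite -monotone_convergence//.
- apply: eq_integral => x _; apply: cvg_lim => //.
  under eq_fun do rewrite EFinM.
  by apply: cvgeZr => //; exact: hg.
- by move=> n; apply/measurable_EFinP; exact: measurable_funM.
- by move=> n x _; rewrite lee_fin mulr_ge0.
- by move=> x _ n m nm; rewrite lee_fin ler_wpM2r// nd_h.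
Qed.

End density.

(** * Gaussian laws on the line *)

Section gaussian_measure.
Context {R : realType}.
Local Notation mu := (@lebesgue_measure R).
Implicit Types (m s x y : R).

(* Carries [normal_prob] over to the sigma-algebra that random variables use. *)
Let idTR : measurableTypeR R -> R := idfun.

#[local] HB.instance Definition _ :=
  @isMeasurableFun.Build _ _ _ _ idTR (@measurable_id _ _ setT).

Let gauss_unlocked m s : probability R R :=
  if s == 0 then [the probability _ _ of \d_m]
  else [the probability _ _ of distribution (normal_prob m s) idTR].

Fact gauss_key : unit. Proof. exact: tt. Qed.

(** The lock keeps unification from unfolding the measure into the integral of a
    density. *)
Definition gauss m s := locked_with gauss_key (gauss_unlocked m s).

Lemma gaussE m s (A : set R) : gauss m s A = gaussian_law m s A.
Proof.
by rewrite /gauss unlock /gauss_unlocked /gaussian_law; case: ifP.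
Qed.

Lemma gauss0E m (A : set R) : gauss m 0 A = \d_m A.
Proof. by apply: (etrans (gaussE m 0 A)); rewrite /gaussian_law eqxx. Qed.

Lemma ge0_integral_gauss0E m (g : R -> \bar R) : measurable_fun setT g ->
  (\int[gauss m 0]_x g x = g m)%E.
Proof. by move=> mg; rewrite /gauss unlock /gauss_unlocked eqxx integral_dirac// diracT mul1e. Qed.

Lemma ge0_integral_gauss0 m (g : R -> R) : measurable_fun setT g ->
  (\int[gauss m 0]_x (g x)%:E = (g m)%:E)%E.
Proof. by move=> mg; rewrite ge0_integral_gauss0E//; exact/measurable_EFinP. Qed.

Lemma ge0_integral_gaussE m s (g : R -> \bar R) : s != 0 ->
  measurable_fun setT g -> (forall x, 0 <= g x)%E ->
  (\int[gauss m s]_x g x = \int[mu]_x (g x * (normal_pdf m s x)%:E))%E.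
Proof.
move=> s0 mg g0; rewrite /gauss unlock /gauss_unlocked (negbTE s0) ge0_integral_distribution//.
apply: (ge0_integral_density (nu := normal_prob m s) (mu := mu)) => //.
- exact: measurable_normal_pdf.
- by move=> x; exact: normal_pdf_ge0.
Qed.

Lemma ge0_integral_gauss m s (g : R -> R) : s != 0 -> measurable_fun setT g ->
  (forall x, 0 <= g x) ->
  (\int[gauss m s]_x (g x)%:E = \int[mu]_x (g x * normal_pdf m s x)%:E)%E.
Proof.
move=> s0 mg g0; rewrite ge0_integral_gaussE//; exact/measurable_EFinP.
Qed.

Let lintZ k (g : R -> R) : 0 <= k -> measurable_fun setT g ->
  (forall x, 0 <= g x) ->
  (k%:E * \int[mu]_x (g x)%:E = \int[mu]_x (k * g x)%:E)%E.
Proof.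
move=> k0 mg g0; under [RHS]eq_integral do rewrite EFinM.
rewrite ge0_integralZl//; first exact/measurable_EFinP.
by move=> x _; rewrite lee_fin.
Qed.

Let lintD (g1 g2 : R -> R) : measurable_fun setT g1 -> measurable_fun setT g2 ->
  (forall x, 0 <= g1 x) -> (forall x, 0 <= g2 x) ->
  (\int[mu]_x (g1 x)%:E + \int[mu]_x (g2 x)%:E = \int[mu]_x (g1 x + g2 x)%:E)%E.
Proof.
move=> m1 m2 g10 g20; under [RHS]eq_integral do rewrite EFinD.
rewrite ge0_integralD//; try exact/measurable_EFinP.
- by move=> x _; rewrite lee_fin.
- by move=> x _; rewrite lee_fin.
Qed.

Let le_lint (g1 g2 : R -> R) : measurable_fun setT g1 -> measurable_fun setT g2 ->
  (forall x, 0 <= g1 x) -> (forall x, g1 x <= g2 x) ->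
  (\int[mu]_x (g1 x)%:E <= \int[mu]_x (g2 x)%:E)%E.
Proof.
move=> m1 m2 g10 g12; apply: ge0_le_integral => //; try exact/measurable_EFinP.
- by move=> x _; rewrite lee_fin.
- by move=> x _; rewrite lee_fin.
Qed.

Lemma ge0_integral_affine (c b : R) (g : R -> \bar R) : 0 < c ->
  measurable_fun setT g -> (forall x, 0 <= g x)%E ->
  (c%:E * \int[mu]_x g (c * x + b)%R = \int[mu]_x g x)%E.
Proof.
move=> c0 mg g0.
pose phi : measurableTypeR R -> measurableTypeR R := fun x => c * x + b.
have mphi : measurable_fun setT phi by exact: measurable_affine.
pose nu0 := pushforward mu phi : {measure set (measurableTypeR R) -> \bar R}.
pose nu := nu0 mphi.
transitivity (\int[mscale (NngNum (ltW c0)) nu]_x g x)%E.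
  rewrite ge0_integral_mscale//; congr (_ * _)%E.
  by rewrite ge0_integral_pushforward.
apply: eq_measure_integral => A mA _.
exact: (lebesgue_measure_affine b c0 mA).
Qed.

Lemma ge0_integral_shift (b : R) (g : R -> \bar R) : measurable_fun setT g ->
  (forall x, 0 <= g x)%E -> (\int[mu]_x g (x + b)%R = \int[mu]_x g x)%E.
Proof.
move=> mg g0; rewrite -(ge0_integral_affine b ltr01 mg g0) mul1e.
by apply: eq_integral => x _; rewrite mul1r.
Qed.

Lemma ge0_integral_opp (g : R -> \bar R) : measurable_fun setT g ->
  (forall x, 0 <= g x)%E -> (\int[mu]_x g (- x)%R = \int[mu]_x g x)%E.
Proof.
move=> mg g0.
pose phi : measurableTypeR R -> measurableTypeR R := -%R.
have mphi : measurable_fun setT phi by exact: oppr_measurable.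
transitivity (\int[pushforward mu phi]_x g x)%E.
  by rewrite ge0_integral_pushforward.
by apply: eq_measure_integral => A mA _; exact: lebesgue_measureN.
Qed.

Lemma integral_gauss_indic m s (A : set R) : measurable A ->
  (gauss m s A = \int[gauss m s]_x (\1_A x)%:E)%E.
Proof. by move=> mA; rewrite integral_indic// setIT. Qed.

Lemma normal_pdfS m s x : s != 0 ->
  normal_pdf m s x = normal_peak s * expR (- (x - m) ^+ 2 / (s ^+ 2 *+ 2)).
Proof. by move=> s0; rewrite normal_pdfE. Qed.

(** Up to a constant, the factor [expR (l * x)] moves the mean of the density by
    [l * s ^ 2]. *)
Lemma mgf_gauss m s l :
  (\int[gauss m s]_x (expR (l * x))%:E = (expR (l * m + l ^+ 2 * s ^+ 2 / 2))%:E)%E.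
Proof.
have mexp : measurable_fun setT (fun x : R => expR (l * x)).
  by apply: measurableT_comp => //; exact: measurable_funM.
have [->|s0] := eqVneq s 0.
  by rewrite ge0_integral_gauss0// expr0n/= mulr0 mul0r addr0.
rewrite ge0_integral_gauss//.
transitivity (\int[mu]_x ((expR (l * m + l ^+ 2 * s ^+ 2 / 2))%:E *
   (normal_pdf (m + l * s ^+ 2) s x)%:E))%E.
  apply: eq_integral => x _; rewrite -EFinM !normal_pdfS// mulrCA [in RHS]mulrCA -!expRD.
  by congr (_ * expR _)%:E; field.
rewrite ge0_integralZl ?lee_fin ?expR_ge0//.
- by rewrite integral_normal_pdf mule1.
- by apply/measurable_EFinP; exact: measurable_normal_pdf.
- by move=> x _; rewrite lee_fin normal_pdf_ge0.
Qed.

Lemma gauss_opp s (A : set R) : measurable A ->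
  gauss 0 s [set x | A (- x)] = gauss 0 s A.
Proof.
move=> mA; have mNA : measurable [set x | A (- x)].
  by rewrite -[X in measurable X]setTI; exact: (@oppr_measurable R setT measurableT _ mA).
rewrite !integral_gauss_indic//.
have [->|s0] := eqVneq s 0.
  by rewrite !ge0_integral_gauss0// !indicE; congr ((_ : bool)%:R%:E); apply/idP/idP;
    rewrite !inE/= oppr0.
rewrite !ge0_integral_gauss// -[RHS]ge0_integral_opp.
- apply: eq_integral => x _; rewrite !normal_pdfS// !subr0 sqrrN.
  by rewrite !indicE; congr ((_ : bool)%:R * _)%:E; apply/idP/idP; rewrite !inE.
- apply/measurable_EFinP; apply: measurable_funM => //.
  exact: measurable_normal_pdf.
- by move=> x; rewrite lee_fin mulr_ge0// normal_pdf_ge0.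
Qed.

(** Comparing the densities of standard deviations [s] and [s / r], for [r > 1], the
    inequality [1 - exp (- z) <= z] bounds the difference of [normal_pdf 0 s] and
    [normal_pdf 0 (s / r) / r] by a multiple of [x ^ 2 * normal_pdf 0 s x]. Integrating
    and letting [r] tend to 1 gives the bound. *)
Lemma second_moment_gauss s :
  ((s ^+ 2)%:E <= \int[gauss 0 s]_x (x ^+ 2)%:E)%E.
Proof.
have msq : measurable_fun setT (fun x : R => x ^+ 2) by exact: measurable_funX.
have [->|s0] := eqVneq s 0.
  by rewrite expr0n/= integral_ge0// => x _; rewrite lee_fin sqr_ge0.
set V := (\int[_]_x _)%E.
have [->|Voo] := eqVneq V +oo%E; first by rewrite leey.
have V0 : (0 <= V)%E by apply: integral_ge0 => x _; rewrite lee_fin sqr_ge0.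
have Vfin : V \is a fin_num by rewrite ge0_fin_numE// ltey.
have s20 : 0 < s ^+ 2 by rewrite exprn_even_gt0.
have main (r : R) : 1 < r -> 2 * s ^+ 2 <= r * (r + 1) * fine V.
  move=> r1; have r0 : 0 < r by lra.
  have sr0 : s / r != 0 by rewrite mulf_neq0// invr_eq0 gt_eqF.
  have step : (1 <= (r^-1)%:E + ((r ^+ 2 - 1) / (2 * s ^+ 2))%:E * V)%E.
    have c0 : 0 <= (r ^+ 2 - 1) / (2 * s ^+ 2).
      by rewrite divr_ge0//; [nra|rewrite mulr_ge0// ltW].
    rewrite -[leLHS](integral_normal_pdf 0 s) -(mule1 (r^-1)%:E).
    rewrite -(integral_normal_pdf 0 (s / r)) /V ge0_integral_gauss//; last by move=> x; exact: sqr_ge0.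
    have mxpdf : measurable_fun setT (fun x => x ^+ 2 * normal_pdf 0 s x).
      by apply: measurable_funM => //; exact: measurable_normal_pdf.
    have xpdf0 (x : R) : 0 <= x ^+ 2 * normal_pdf 0 s x.
      by rewrite mulr_ge0 ?sqr_ge0 ?normal_pdf_ge0.
    have ri0 : 0 <= r^-1 by rewrite invr_ge0 ltW.
    have mZ k (g : R -> R) : measurable_fun setT g ->
      measurable_fun setT (fun x => k * g x) by move=> ?; exact: measurable_funM.
    have mpdf a := @measurable_normal_pdf R 0 a.
    rewrite !lintZ//; try by move=> x; exact: normal_pdf_ge0.
    rewrite lintD//; try exact: mZ; try by move=> x; rewrite mulr_ge0// normal_pdf_ge0.
    apply: le_lint => //; first by apply: measurable_funD; exact: mZ.
      by move=> x; exact: normal_pdf_ge0.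
    move=> x; rewrite !normal_pdfS// !subr0.
    have peakE : normal_peak (s / r) = r * normal_peak s.
      have -> : normal_peak (s / r) =
          (Num.sqrt (s ^+ 2 * pi *+ 2 * r^-1 ^+ 2))^-1.
        by congr (Num.sqrt _)^-1; rewrite expr_div_n exprVn mulrAC mulrnAl.
      rewrite sqrtrM; last by rewrite mulrn_wge0// mulr_ge0 ?pi_ge0// ltW.
      by rewrite sqrtr_sqr gtr0_norm ?invr_gt0// invfM invrK mulrC.
    rewrite peakE mulrA mulKf ?gt_eqF//.
    set b := x ^+ 2 / (s ^+ 2 *+ 2).
    have -> : - x ^+ 2 / (s ^+ 2 *+ 2) = - b by rewrite mulNr.
    have -> : - x ^+ 2 / ((s / r) ^+ 2 *+ 2) = - b + - ((r ^+ 2 - 1) * b).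
      by rewrite /b; field; rewrite s0 gt_eqF.
    have -> : (r ^+ 2 - 1) / (2 * s ^+ 2) * (x ^+ 2 * (normal_peak s * expR (- b))) =
        normal_peak s * (expR (- b) * ((r ^+ 2 - 1) * b)).
      by rewrite /b; field; rewrite s0.
    rewrite -mulrDr ler_wpM2l ?normal_peak_ge0// expRD -mulrDr.
    rewrite ler_peMr ?expR_ge0//.
    by have := expR_ge1Dx (- ((r ^+ 2 - 1) * b)); lra.
  move: step; rewrite -(fineK Vfin) -EFinM -EFinD lee_fin => step.
  have : 2 * s ^+ 2 * (r - 1) <= r * (r + 1) * fine V * (r - 1).
    have := ler_wpM2l (mulr_ge0 (ltW r0) (mulr_ge0 (ler0n R 2) (ltW s20))) step.
    rewrite (_ : r * (2 * s ^+ 2) * (r^-1 + _) =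
      2 * s ^+ 2 + r * (r ^+ 2 - 1) * fine V); first by move=> ?; lra.
    by field; rewrite s0 gt_eqF.
  by rewrite ler_pM2r// subr_gt0.
rewrite -(fineK Vfin) lee_fin leNgt; apply/negP => Vs.
have V0' : 0 <= fine V by exact: fine_ge0.
pose e := (s ^+ 2 - fine V) / (4 * s ^+ 2).
have eE : e * (4 * s ^+ 2) = s ^+ 2 - fine V.
  by rewrite /e divfK// mulf_neq0// ?gt_eqF.
have e0 : 0 < e by rewrite divr_gt0// ?subr_gt0// mulr_gt0.
have := main (1 + e); rewrite ltrDl => /(_ e0).
have e1 : e < 1 by nra.
nra.
Qed.

Lemma gauss_sqr s r (A : set R) : s ^+ 2 = r ^+ 2 -> gauss 0 s A = gauss 0 r A.
Proof.
move=> sr; suff lawE : gaussian_law 0 s A = gaussian_law 0 r A.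
  exact: etrans (gaussE 0 s A) (etrans lawE (esym (gaussE 0 r A))).
rewrite /gaussian_law; have sr0 : (s == 0) = (r == 0).
  by rewrite -(sqrf_eq0 s) sr sqrf_eq0.
rewrite sr0; case: ifPn => [_|r0]; first exact: erefl.
have s0 : s != 0 by rewrite sr0.
by apply: eq_integral => x _; rewrite !normal_pdfS// /normal_peak sr.
Qed.

(** Translating the half-line beyond [c = s0 * x] back to the origin costs a factor of
    at most [exp (- c ^ 2 / (2 * s ^ 2))] in the density, and the two half-lines at the
    origin have a total mass of at most one: hence no constant in front of the
    exponential. *)
Lemma gauss_tail s s0 x : 0 <= x -> 0 <= s0 -> s ^+ 2 <= s0 ^+ 2 ->
  (gauss 0 s [set y | (s0 * x < `|y|)%R] <= (expR (- x ^+ 2 / 2))%:E)%E.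
Proof.
move=> x0 s00 ss0; set c := s0 * x.
have c0 : 0 <= c by rewrite mulr_ge0.
have mgt (e : R) : measurable [set y : R | e < y].
  by rewrite -set_itvoy; exact: measurable_itv.
have mlt (e : R) : measurable [set y : R | y < e].
  by rewrite -set_itvNyo; exact: measurable_itv.
have mabs : measurable [set y : R | c < `|y|].
  rewrite (_ : [set _ | _] = [set y | c < y] `|` [set y | y < - c]).
    exact: measurableU.
  apply/seteqP; split => y /=; rewrite lter_normr [c < - y]ltrNr;
    by move/orP.
rewrite integral_gauss_indic//; have [sE|sn0] := eqVneq s 0.
  rewrite sE ge0_integral_gauss0// indicE memNset/= ?lee_fin ?expR_ge0//.
  by rewrite normr0 ltNge c0.
rewrite ge0_integral_gauss//.
pose G (A : set R) (e y : R) : R := \1_A y * normal_pdf 0 s (y + e).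
have mG (A : set R) e : measurable A -> measurable_fun setT (G A e).
  move=> mA; apply: measurable_funM => //.
  apply: measurableT_comp; first exact: measurable_normal_pdf.
  exact: measurable_funD.
have G0 A e y : 0 <= G A e y by rewrite mulr_ge0// normal_pdf_ge0.
have tailE (A B : set R) (e : R) : measurable A -> measurable B ->
    (forall y, A y <-> B (y + e)) -> (forall y, A y -> 0 <= y * e) -> e ^+ 2 = c ^+ 2 ->
    (\int[mu]_y (G B 0%R y)%:E <=
      (expR (- x ^+ 2 / 2))%:E * \int[mu]_y (G A 0%R y)%:E)%E.
  move=> mA mB AB Ae ec.
  have mGB := measurableT_comp (mG B 0 mB) (measurable_funD (@measurable_id _ _ setT)
    (measurable_cst e)).
  rewrite -(ge0_integral_shift e (g := fun y => (G B 0 y)%:E)); last 2 first.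
  - apply/measurable_EFinP; exact: (mG _ 0).
  - by move=> y; rewrite lee_fin.
  rewrite lintZ ?expR_ge0//; last exact: (mG _ 0).
  apply: le_lint => //; first by apply: measurable_funM => //; exact: (mG _ 0).
  move=> y; rewrite /G !addr0 !indicE; have [yA|yA] := boolP (y \in A); last first.
    rewrite (_ : (y + e \in B) = false) ?mul0r ?mulr0//.
    by apply/negbTE; move: yA; rewrite !notin_setE => /[swap] /AB.
  have {yA} Ay : A y by rewrite inE in yA.
  rewrite mem_set; last exact/AB.
  rewrite !mul1r !normal_pdfS// !subr0 mulrCA -expRD ler_wpM2l ?normal_peak_ge0//.
  rewrite ler_expR -subr_ge0.
  have s2 : 0 < s ^+ 2 by rewrite exprn_even_gt0.
  rewrite (_ : _ - _ = (2 * (y * e) + (e ^+ 2 - s ^+ 2 * x ^+ 2)) / (s ^+ 2 *+ 2));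
    last by field.
  rewrite divr_ge0 ?mulrn_wge0 ?(ltW s2)// addr_ge0//.
    by rewrite mulr_ge0// Ae.
  by rewrite ec /c exprMn -mulrBl mulr_ge0 ?sqr_ge0// subr_ge0.
have -> : (\int[mu]_y (\1_[set y0 | (c < `|y0|)%R] y * normal_pdf 0 s y)%:E =
    \int[mu]_y (G [set y | (c < y)%R] 0%R y)%:E +
    \int[mu]_y (G [set y | (y < - c)%R] 0%R y)%:E)%E.
  rewrite lintD//.
  - apply: eq_integral => y _; rewrite /G addr0 -mulrDl !indicE; congr (_ * _)%:E.
    rewrite -natrD; congr _%:R.
    have -> : (y \in [set y0 | c < `|y0|]) = (c < y) || (y < - c).
      by apply/idP/idP; rewrite inE/= lter_normr [c < - y]ltrNr.
    have -> : (y \in [set y0 | c < y0]) = (c < y) by apply/idP/idP; rewrite inE.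
    have -> : (y \in [set y0 | y0 < - c]) = (y < - c) by apply/idP/idP; rewrite inE.
    by case: (ltP c y); case: (ltP y (- c)) => //= ? ?; exfalso; lra.
  - exact: (mG _ 0).
  - exact: (mG _ 0).
have t1 := tailE [set y | 0 < y] [set y | c < y] c (mgt 0) (mgt c).
have t2 := tailE [set y | y < 0] [set y | y < - c] (- c) (mlt 0) (mlt (- c)).
have {}t1 := t1 _ _ erefl; have {}t2 := t2 _ _ (sqrrN c).
apply: le_trans (leeD (t1 _ _) (t2 _ _)) _.
- by move=> y /=; rewrite ltrDr.
- by move=> y /= /ltW y0; rewrite mulr_ge0.
- by move=> y /=; rewrite gtrDr.
- by move=> y /= /ltW y0; rewrite mulrN -mulNr mulr_ge0 ?oppr_ge0.
rewrite -ge0_muleDr; try by apply: integral_ge0 => y _; rewrite lee_fin.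
rewrite -[leRHS]mule1 lee_wpmul2l ?lee_fin ?expR_ge0//.
rewrite -(integral_normal_pdf 0 s) lintD//; [|exact: (mG _ 0)..].
apply: le_lint.
- by apply: measurable_funD; exact: (mG _ 0).
- exact: measurable_normal_pdf.
- by move=> y; rewrite addr_ge0.
- move=> y; rewrite /G addr0 -mulrDl ler_piMl ?normal_pdf_ge0//.
  rewrite !indicE; case: (boolP (y \in [set y0 | 0 < y0])) => [|_].
    rewrite inE/= => y0; rewrite memNset/= ?addr0//.
    by apply/negP; rewrite -leNgt ltW.
  by rewrite add0r lern1 leq_b1.
Qed.

Lemma gauss_scale c s (A : set R) : measurable A ->
  gauss 0 s [set x | A (c * x)] = gauss 0 (c * s) A.
Proof.
have main e (B : set R) : 0 < e -> measurable B ->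
    gauss 0 s [set x | B (e * x)] = gauss 0 (e * s) B.
  move=> e0 mB; have mBe : measurable [set x | B (e * x)].
    rewrite -[X in measurable X]setTI.
    have mM : measurable_fun setT (fun x : R => e * x) by exact: measurable_funM.
    exact: (mM measurableT B mB).
  apply: (etrans (integral_gauss_indic 0 s mBe)); apply/esym.
  apply: (etrans (integral_gauss_indic 0 (e * s) mB)); apply/esym.
  have indE (x : R) : \1_[set y | B (e * y)] x = \1_B (e * x) :> R.
    by rewrite !indicE; congr ((_ : bool)%:R); apply/idP/idP; rewrite !inE.
  have [->|s0] := eqVneq s 0.
    by rewrite mulr0 !ge0_integral_gauss0// indE mulr0.
  have es0 : e * s != 0 by rewrite mulf_neq0// gt_eqF.
  have ge0 (C : set R) x : 0 <= \1_C x :> R by [].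
  apply: (etrans (ge0_integral_gauss 0 s0 (measurable_indic mBe) (ge0 _))).
  apply/esym; apply: (etrans (ge0_integral_gauss 0 es0 (measurable_indic mB) (ge0 _))).
  have mg : measurable_fun setT (fun x => \1_B x * normal_pdf 0 (e * s) x).
    by apply: measurable_funM => //; exact: measurable_normal_pdf.
  have g0 x : 0 <= \1_B x * normal_pdf 0 (e * s) x.
    by rewrite mulr_ge0// normal_pdf_ge0.
  rewrite -(@ge0_integral_affine e 0 (fun x => (\1_B x * normal_pdf 0 (e * s) x)%:E))//.
  - rewrite lintZ ?(ltW e0)//.
    + apply: eq_integral => x _; rewrite addr0 indE mulrCA; congr (_ * _)%:E.
      rewrite !normal_pdfS// !subr0 mulrA; congr (_ * expR _).
        have -> : normal_peak (e * s) = (Num.sqrt (s ^+ 2 * pi *+ 2 * e ^+ 2))^-1.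
          by congr (Num.sqrt _)^-1; rewrite exprMn -mulrA mulrC mulrnAl.
        rewrite sqrtrM; last first.
          by rewrite mulrn_wge0//; apply: mulr_ge0; [exact: sqr_ge0|exact: pi_ge0].
        by rewrite sqrtr_sqr gtr0_norm// invfM mulrCA divff ?mulr1// gt_eqF.
      by field; rewrite s0 gt_eqF.
    + exact: (measurableT_comp mg (measurable_affine e 0)).
  - exact/measurable_EFinP.
move=> mA; have [c0|c0|->] := ltgtP c 0; last first.
- rewrite mul0r; apply/esym/(etrans (gauss0E 0 A))/esym; rewrite diracE.
  have [A0|A0] := pselect (A 0).
    rewrite (mem_set A0) (_ : [set _ | _] = setT) ?probability_setT//.
    by apply/seteqP; split => x //= _; rewrite mul0r.
  rewrite (memNset A0) (_ : [set _ | _] = set0) ?measure0//.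
  by apply/seteqP; split => x //=; rewrite mul0r.
- exact: main.
have mNA : measurable [set x | A (- x)].
  by rewrite -[X in measurable X]setTI; exact: (@oppr_measurable R setT measurableT _ mA).
have c0' : 0 < - c by rewrite oppr_gt0.
have mainA := etrans (main _ _ c0' mNA) (gauss_opp (- c * s) mA).
transitivity (gauss 0 s [set x | A (- (- c * x))]).
  by congr (gauss 0 s _); apply/seteqP; split => x /=; rewrite mulNr opprK.
by apply: (etrans mainA); apply: gauss_sqr; rewrite mulNr sqrrN.
Qed.

(** Completing the square turns the product of two centered densities at [z - y]
    and [y] into the density of the sum at [z] times a normal density in [y]. *)
Lemma gauss_conv s t r (A : set R) : r ^+ 2 = s ^+ 2 + t ^+ 2 -> measurable A ->
  (\int[gauss 0 t]_y gauss 0 s [set x | A (x + y)%R] = gauss 0 r A)%E.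
Proof.
move=> rst mA.
have mAy y : measurable [set x | A (x + y)].
  rewrite -[X in measurable X]setTI.
  exact: (measurable_funD (@measurable_id _ _ setT) (measurable_cst y)).
have gaussAy y : s != 0 -> gauss 0 s [set x | A (x + y)] =
    (\int[mu]_z (\1_A z * normal_pdf 0 s (z - y)%R)%:E)%E.
  move=> s0; rewrite (integral_gauss_indic 0 s (mAy y)).
  have ge0Ay x : 0 <= \1_[set x0 | A (x0 + y)] x :> R by [].
  apply: (etrans (ge0_integral_gauss 0 s0 (measurable_indic (mAy y)) ge0Ay)).
  rewrite -(ge0_integral_shift y (g := fun z => (\1_A z * normal_pdf 0 s (z - y))%:E)).
  - by apply: eq_integral => x _; rewrite addrK !indicE; congr (_%:R * _)%:E;
      congr nat_of_bool; apply/idP/idP; rewrite !inE.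
  - apply/measurable_EFinP/measurable_funM => //.
    apply: measurableT_comp; first exact: measurable_normal_pdf.
    exact: measurable_funB.
  - by move=> z; rewrite lee_fin mulr_ge0// normal_pdf_ge0.
have ge0A x : 0 <= \1_A x :> R by [].
have [s0|s0] := eqVneq s 0.
  transitivity (\int[gauss 0 t]_y (\1_A y)%:E)%E.
    apply: eq_integral => y _; rewrite s0 integral_gauss_indic//.
    rewrite ge0_integral_gauss0// !indicE; congr ((_ : bool)%:R%:E).
    by apply/idP/idP; rewrite !inE/= add0r.
  rewrite -(integral_gauss_indic 0 t mA); apply: gauss_sqr.
  by rewrite rst s0 expr0n/= add0r.
under eq_integral do rewrite gaussAy//.
pose k (p : measurableTypeR R * measurableTypeR R) :=
  (\1_A p.2 * normal_pdf 0 s (p.2 - p.1))%:E.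
have m1 : measurable_fun setT
    (fun p : measurableTypeR R * measurableTypeR R => p.1 : R).
  exact: measurable_fst.
have m2 : measurable_fun setT
    (fun p : measurableTypeR R * measurableTypeR R => p.2 : R).
  exact: measurable_snd.
have mk : measurable_fun setT k.
  apply/measurable_EFinP/measurable_funM.
    exact: (measurableT_comp (measurable_indic mA) m2).
  apply: (measurableT_comp (measurable_normal_pdf 0 s)).
  exact: measurable_funB.
have k0 p : (0 <= k p)%E by rewrite lee_fin mulr_ge0// normal_pdf_ge0.
have mF := @measurable_fun_fubini_tonelli_F _ _ _ _ _ mu _ mk k0.
have F0 y : (0 <= \int[mu]_z k (y, z))%E by apply: integral_ge0 => z _.
have [t0|t0] := eqVneq t 0.
  rewrite t0 ge0_integral_gauss0E; last exact: mF.
  under eq_integral do rewrite subr0.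
  rewrite -(ge0_integral_gauss 0 s0 (measurable_indic mA) ge0A).
  rewrite -(integral_gauss_indic 0 s mA); apply: gauss_sqr.
  by rewrite rst t0 expr0n/= addr0.
have r0 : r != 0.
  by rewrite -sqrf_eq0 rst paddr_eq0 ?sqr_ge0// !sqrf_eq0 negb_and s0.
apply: (etrans (ge0_integral_gaussE 0 t0 mF F0)); apply/esym.
apply: (etrans (integral_gauss_indic 0 r mA)).
apply: (etrans (ge0_integral_gauss 0 r0 (measurable_indic mA) ge0A)); apply/esym.
pose kt (p : measurableTypeR R * measurableTypeR R) :=
  (\1_A p.2 * normal_pdf 0 s (p.2 - p.1) * normal_pdf 0 t p.1)%:E.
transitivity (\int[mu]_y \int[mu]_z kt (y, z))%E.
  apply: eq_integral => y _; rewrite -ge0_integralZr ?lee_fin ?normal_pdf_ge0//.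
  exact: (measurableT_comp mk (measurable_pair1 y)).
have mkt : measurable_fun setT kt.
  apply/measurable_EFinP/measurable_funM.
    exact/measurable_EFinP.
  exact: (measurableT_comp (measurable_normal_pdf 0 t) m1).
rewrite (fubini_tonelli _ mkt); last first.
  by move=> p; rewrite lee_fin !mulr_ge0// normal_pdf_ge0.
apply: eq_integral => z _.
(* [q] is the conditional standard deviation of [y] given the sum [z]. *)
pose q := s * t / r; have q0 : q != 0 by rewrite !mulf_neq0// invr_eq0.
transitivity (\int[mu]_y ((\1_A z * normal_pdf 0 r z) *
    normal_pdf (z * t ^+ 2 / r ^+ 2) q y)%:E)%E.
  apply: eq_integral => y _; rewrite /kt/= -2!mulrA; congr (_ * _)%:E.
  have peaks : normal_peak s * normal_peak t = normal_peak r * normal_peak q.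
    have ge0 (e : R) : 0 <= e ^+ 2 * pi *+ 2.
      by rewrite mulrn_wge0//; apply: mulr_ge0; [exact: sqr_ge0|exact: pi_ge0].
    rewrite -!invfM -!sqrtrM//.
    have -> // : s ^+ 2 * pi *+ 2 * (t ^+ 2 * pi *+ 2) =
      r ^+ 2 * pi *+ 2 * (q ^+ 2 * pi *+ 2) by rewrite /q; field.
  rewrite !normal_pdfS// !subr0 mulrACA peaks [RHS]mulrACA -!expRD.
  congr (_ * expR _); rewrite /q.
  have s2E : s ^+ 2 = r ^+ 2 - t ^+ 2 by rewrite rst addrK.
  have st0 : r ^+ 2 - t ^+ 2 != 0 by rewrite -s2E sqrf_eq0.
  rewrite expr_div_n exprMn s2E; field.
  by rewrite r0 t0 st0.
rewrite -lintZ.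
- by rewrite integral_normal_pdf mule1.
- by rewrite mulr_ge0// normal_pdf_ge0.
- exact: measurable_normal_pdf.
- by move=> y; exact: normal_pdf_ge0.
Qed.

(** From [1 + y <= exp y], all exponential moments are at least one, that is
    [0 <= l * m + l ^ 2 * s ^ 2 / 2] for every [l]; a small [l] of the sign opposite to
    that of [m] leaves only [m = 0]. *)
Lemma gauss_mean0 m s : (\int[gauss m s]_x x%:E = 0)%E ->
  (gauss m s).-integrable setT EFin -> m = 0.
Proof.
move=> mean0 int_id.
have mexp l : measurable_fun setT (fun x : R => expR (l * x)).
  by apply: measurableT_comp => //; exact: measurable_funM.
have ge0 l : 0 <= l * m + l ^+ 2 * s ^+ 2 / 2.
  rewrite -ler_expR expR0 -lee_fin -mgf_gauss.
  have int_l : (gauss m s).-integrable setT (fun x => (l * x)%:E).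
    by under eq_fun do rewrite EFinM; exact: integrableZl.
  have int1 : (gauss m s).-integrable setT (fun=> 1%:E).
    exact: finite_measure_integrable_cst.
  apply: (@le_trans _ _ (\int[gauss m s]_x (1%:E + (l * x)%:E))%E).
    rewrite integralD// integral_cst//= probability_setT mule1.
    under [X in (_ + X)%E]eq_integral do rewrite EFinM.
    by rewrite integralZl// mean0 mule0 adde0.
  apply: le_integral => //.
  - exact: integrableD.
  - apply/integrableP; split; first exact/measurable_EFinP.
    under eq_integral do rewrite /= ger0_norm ?expR_ge0//.
    by rewrite mgf_gauss ltry.
  - by move=> x _; rewrite -EFinD lee_fin expR_ge1Dx.
have := ge0 (- m / (s ^+ 2 + 1)); set D := s ^+ 2 + 1.
have D0 : 0 < D by rewrite ltr_wpDl ?sqr_ge0.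
rewrite (_ : - m / D * m + _ = - (m / D) ^+ 2 * (D + 1) / 2); last first.
  by rewrite /D; field; rewrite -/D gt_eqF.
rewrite !mulNr oppr_ge0 => mD; apply/eqP/negPn/negP => m0; move: mD.
apply/negP; rewrite -ltNge divr_gt0// mulr_gt0//; last by rewrite addr_gt0.
by rewrite exprn_even_gt0//= mulf_neq0// invr_eq0 gt_eqF.
Qed.

(** The logarithm of the density is concave by the margin [l * (1 - l) * (x - y) ^ 2 /
    (2 * s ^ 2)], which pays for the exponential in the hypothesis, and
    Prekopa-Leindler applies to [U] and [V] times the density. In the logarithms of [U]
    and [V] this is an infimum-convolution inequality, the dual form of a transport
    inequality, whence the name; the constant [K] is there for the induction on the
    dimension. *)
Lemma gauss_transport (l sg m s M K : R) (U V : R -> R) : 0 < l < 1 -> 0 < sg ->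
  s ^+ 2 <= sg ^+ 2 -> 0 <= K ->
  measurable_fun setT U -> measurable_fun setT V ->
  (forall x, 0 <= U x <= M) -> (forall x, 0 <= V x <= M) ->
  (forall x y, U x `^ (1 - l) * V y `^ l <=
     K * expR (l * (1 - l) * (x - y) ^+ 2 / (2 * sg ^+ 2))) ->
  (\int[gauss m s]_x U x) `^ (1 - l) * (\int[gauss m s]_x V x) `^ l <= K.
Proof.
move=> l01 sg0 ssg K0 mU mV UM VM UVK; have /andP[l0 l1] := l01.
have [->|s0] := eqVneq s 0.
  rewrite /Rintegral !ge0_integral_gauss0//=.
  by have := UVK m m; rewrite subrr expr0n/= mulr0 mul0r expR0 mulr1.
have M0 : 0 <= M by have /andP[/le_trans] := UM 0; apply.
have int (W : R -> R) : measurable_fun setT W -> (forall x, 0 <= W x <= M) ->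
    (\int[mu]_x (W x * normal_pdf m s x)%:E = (\int[gauss m s]_x W x)%:E)%E.
  move=> mW WM; have W0 x : 0 <= W x by have /andP[] := WM x.
  rewrite -ge0_integral_gauss// /Rintegral fineK// ge0_fin_numE; last first.
    by apply: integral_ge0 => x _; rewrite lee_fin.
  apply: (@le_lt_trans _ _ (\int[gauss m s]_x M%:E)%E); last first.
    by rewrite integral_cst//= probability_setT mule1 ltry.
  apply: ge0_le_integral => //; first by move=> x _; rewrite lee_fin.
    exact/measurable_EFinP.
  by move=> x _; rewrite lee_fin; have /andP[] := WM x.
have mpdf := @measurable_normal_pdf R m s.
have WB (W : R -> R) x : (forall x, 0 <= W x <= M) ->
    0 <= W x * normal_pdf m s x <= M * normal_peak s.
  move=> /(_ x)/andP[W0 WM]; rewrite mulr_ge0 ?normal_pdf_ge0//=.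
  by rewrite ler_pM// ?normal_pdf_ge0// normal_pdf_ub.
have intK : (\int[mu]_x (K * normal_pdf m s x)%:E = K%:E)%E.
  rewrite -lintZ//; first by rewrite integral_normal_pdf mule1.
  by move=> x; exact: normal_pdf_ge0.
apply: (prekopa_leindler1 l01 _ _ _ _ _ _ _ (int U mU UM) (int V mV VM) intK).
- exact: measurable_funM.
- exact: measurable_funM.
- exact: measurable_funM.
- by move=> x; exact: WB.
- by move=> x; exact: WB.
- by move=> x; rewrite mulr_ge0// normal_pdf_ge0.
move=> x y.
have U0 : 0 <= U x by have /andP[] := UM x.
have V0 : 0 <= V y by have /andP[] := VM y.
rewrite !powRM ?normal_pdf_ge0// mulrACA.
have s2 : 0 < s ^+ 2 by rewrite exprn_even_gt0.
have powexp (e r : R) : expR e `^ r = expR (e * r) by rewrite -expRM.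
have -> : normal_pdf m s x `^ (1 - l) * normal_pdf m s y `^ l =
   normal_pdf m s ((1 - l) * x + l * y) *
     expR (- (l * (1 - l) * (x - y) ^+ 2 / (2 * s ^+ 2))).
  rewrite !normal_pdfS// !powRM ?normal_peak_ge0 ?expR_ge0//.
  rewrite mulrACA -powRD; last by rewrite subrK oner_eq0.
  rewrite subrK powRr1 ?normal_peak_ge0// !powexp -expRD -[RHS]mulrA -[in RHS]expRD.
  by congr (_ * expR _); field.
rewrite mulrCA [leRHS]mulrC ler_wpM2l ?normal_pdf_ge0//.
rewrite expRN ler_pdivrMr ?expR_gt0//.
apply: (le_trans (UVK x y)); rewrite ler_wpM2l// ler_expR.
apply: ler_wpM2l.
  by apply: mulr_ge0; [apply: mulr_ge0; lra|exact: sqr_ge0].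
have sg2 : 0 < sg ^+ 2 by rewrite exprn_gt0.
have pos2 (e : R) : 0 < e -> 2 * e \is Num.pos by move=> e0; rewrite posrE mulr_gt0.
rewrite (lef_pV2 (pos2 _ sg2) (pos2 _ s2)); lra.
Qed.

End gaussian_measure.

(** * Independent families *)

Section tuple_law.
Context {R : realType}.

Definition rectangle n (B : 'I_n -> set R) : set (n.-tuple R) :=
  [set w | forall i, B i (tnth w i)].

Lemma measurable_rectangle n (B : 'I_n -> set R) :
  (forall i, measurable (B i)) -> measurable (rectangle B).
Proof.
move=> mB; rewrite (_ : rectangle B =
    \bigcap_(i in [set: 'I_n]) ((fun w : n.-tuple R => tnth w i) @^-1` B i)).
  apply: fin_bigcap_measurable => // i _.
  by rewrite -[X in measurable X]setTI; exact: measurable_tnth.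
by apply/seteqP; split => [w wB i _|w wB i]; [exact: wB|exact: wB].
Qed.

(** Rectangles are closed under intersection and generate the sigma-algebra. *)
Lemma tuple_measure_unique n (m1 m2 : {measure set (n.-tuple R) -> \bar R}) :
  (m1 setT < +oo)%E ->
  (forall B : 'I_n -> set R, (forall i, measurable (B i)) ->
     m1 (rectangle B) = m2 (rectangle B)) ->
  forall A, measurable A -> m1 A = m2 A.
Proof.
move=> m1oo m12 A mA.
pose G := [set C | exists2 B : 'I_n -> set R,
  (forall i, measurable (B i)) & C = rectangle B].
have GT : G setT.
  by exists (fun=> setT) => //; apply/seteqP; split.
apply: (@g_sigma_algebra_measure_unique _ _ _ G _ (fun=> setT)) => //.
- by move=> _ [B mB ->]; exact: measurable_rectangle.
- by apply/seteqP; split => // w _; exists 0%N.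
- move=> _ _ [B mB ->] [B' mB' ->]; exists (fun i => B i `&` B' i).
    by move=> i; exact: measurableI.
  by apply/seteqP; split => [w [wB wB'] i|w wBB']; [split; [exact: wB|exact: wB']|
    split => i; have [] := wBB' i].
- by move=> _ [B mB ->]; exact: m12.
- move: A mA; apply: smallest_sub; first exact: smallest_sigma_algebra.
  move=> C; rewrite -bigcup_seq => -[i _ [B mB <-]].
  apply: sub_sigma_algebra; exists (fun j => if j == i then B else setT).
    by move=> j; case: ifP.
  apply/seteqP; split => [w [_ wB] j|w wB]; first by case: eqP => [->|].
  by split => //; have := wB i; rewrite eqxx.
Qed.

End tuple_law.

Section independent_family.
Context d (T : measurableType d) (R : realType) (P : probability T R).

(** The product rule for the full index set only: subfamilies are covered by taking
    the whole line for the other factors. *)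
Definition rect_indep n (X : 'I_n -> {RV P >-> R}) : Prop :=
  forall B : 'I_n -> set R, (forall i, measurable (B i)) ->
    (P [set x | forall i, B i (X i x)] = \prod_(i < n) P (X i @^-1` B i))%E.

Lemma mutually_independent_rect n (X : 'I_n -> {RV P >-> R}) :
  mutually_independent X -> rect_indep X.
Proof.
move=> indX B mB; have := indX finset.setT B mB.
rewrite (eq_bigl xpredT); last by move=> i; rewrite finset.in_setT.
move=> <-; congr (P _); apply/seteqP; split => [x xB i _|x xB i]; first exact: xB.
by apply: xB; rewrite /= finset.in_setT.
Qed.

Definition joint n (X : 'I_n -> T -> R) (x : T) : n.-tuple R :=
  [tuple X i x | i < n].

Lemma measurable_joint n (X : 'I_n -> {RV P >-> R}) :
  measurable_fun setT (joint X).
Proof.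
apply/measurable_fun_tnthP => i.
rewrite (_ : _ \o _ = X i); first exact: measurable_funPT.
by apply/funext => x; rewrite /= tnth_mktuple.
Qed.

HB.instance Definition _ n (X : 'I_n -> {RV P >-> R}) :=
  isMeasurableFun.Build _ _ _ _ (joint X) (measurable_joint X).

Lemma joint_rectangle n (X : 'I_n -> {RV P >-> R}) (B : 'I_n -> set R) :
  joint X @^-1` rectangle B = [set x | forall i, B i (X i x)].
Proof.
by apply/seteqP; split => x xB i; have := xB i; rewrite tnth_mktuple.
Qed.

Lemma rect_indep_behead n (X : 'I_n.+1 -> {RV P >-> R}) :
  rect_indep X -> rect_indep (fun i => X (lift ord0 i)).
Proof.
move=> indX B mB.
have := indX (fun i => if unlift ord0 i is Some j then B j else setT).
rewrite big_ord_recl unlift_none preimage_setT probability_setT mul1e.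
under eq_bigr do rewrite liftK.
move=> <-; last by move=> i; case: unlift.
congr (P _); apply/seteqP; split => [x xB i|x xB i].
  by case: unliftP => [j ->|//]; exact: xB.
by have := xB (lift ord0 i); rewrite liftK.
Qed.

(** For a fixed [A] both sides are finite measures in [B], and they agree on
    rectangles. *)
Lemma rect_indep_pair n (X : 'I_n.+1 -> {RV P >-> R}) (A : set R)
    (B : set (n.-tuple R)) : rect_indep X -> measurable A -> measurable B ->
  (P (X ord0 @^-1` A `&` joint (fun i => X (lift ord0 i)) @^-1` B) =
   P (X ord0 @^-1` A) * P (joint (fun i => X (lift ord0 i)) @^-1` B))%E.
Proof.
move=> indX mA mB; set X' := fun i : 'I_n => X (lift ord0 i).
have mXA : measurable (X ord0 @^-1` A).
  by rewrite -[X in measurable X]setTI; exact: measurable_funPT.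
have PA0 : 0 <= fine (P (X ord0 @^-1` A)) by exact: fine_ge0.
pose m0 := pushforward (mrestr P mXA) (joint X') :
  {measure set (n.-tuple R) -> \bar R}.
pose m1 := m0 (measurable_joint X').
pose m2 : {measure set (n.-tuple R) -> \bar R} :=
  mscale (NngNum PA0) (distribution P (joint X')).
have m1E C : m1 C = P (joint X' @^-1` C `&` X ord0 @^-1` A) by [].
have m2E C : m2 C = (P (X ord0 @^-1` A) * P (joint X' @^-1` C))%E.
  by rewrite /m2 /= /mscale /= fineK // fin_num_measure.
rewrite setIC -m1E -m2E; apply: tuple_measure_unique => //.
  apply: le_lt_trans (ltry 1); rewrite m1E preimage_setT setTI.
  exact: probability_le1.
move=> C mC; rewrite m1E m2E !joint_rectangle (rect_indep_behead indX)//.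
have := indX (fun i => if unlift ord0 i is Some j then C j else A).
rewrite big_ord_recl unlift_none; under eq_bigr do rewrite liftK.
move=> <-; last by move=> i; case: unlift.
congr (P _); apply/seteqP; split => [x [xC xA] i|x xCA].
  by case: unliftP => [j ->|->]; [exact: xC|exact: xA].
split => [i|]; first by have := xCA (lift ord0 i); rewrite liftK.
by have := xCA ord0; rewrite unlift_none.
Qed.

(** By [rect_indep_pair] the joint law of the first variable and of the others is the
    product of their laws, to which Fubini's theorem applies. *)
Lemma rect_indep_fubini n (X : 'I_n.+1 -> {RV P >-> R})
    (G : R * n.-tuple R -> \bar R) : rect_indep X ->
  measurable_fun setT G -> (forall p, 0 <= G p)%E ->
  (\int[P]_x G (X ord0 x, joint (fun i => X (lift ord0 i)) x) =
   \int[distribution P (X ord0)]_a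
     \int[P]_x G (a, joint (fun i => X (lift ord0 i)) x))%E.
Proof.
move=> indX mG G0; set X' := fun i : 'I_n => X (lift ord0 i).
pose Z x := (X ord0 x, joint X' x).
have mZ : measurable_fun setT Z by exact: measurable_fun_pair.
pose Zm : {mfun T >-> (R * n.-tuple R)%type} := HB.pack Z
  (isMeasurableFun.Build _ _ _ _ Z mZ).
transitivity (\int[distribution P Zm]_p G p)%E.
  by rewrite ge0_integral_distribution.
transitivity (\int[distribution P (X ord0) \x distribution P (joint X')]_p G p)%E.
  apply: eq_measure_integral => C mC _; apply/esym.
  apply: product_measure_unique mC => A B mA mB.
  by rewrite -[RHS]rect_indep_pair.
rewrite fubini_tonelli1//; apply: eq_integral => a _.
rewrite /fubini_F ge0_integral_distribution//.
exact: measurableT_comp.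
Qed.

End independent_family.

(** * From one coordinate to Gaussian families *)

Section gaussian_family.
Context d (T : measurableType d) (R : realType) (P : probability T R).

Lemma Rintegral_bounded (M : R) (f : T -> R) : measurable_fun setT f ->
  (forall x, 0 <= f x <= M) ->
  (\int[P]_x (f x)%:E = (\int[P]_x f x)%:E)%E /\ 0 <= \int[P]_x f x <= M.
Proof.
move=> mf fM; have f0 x : 0 <= f x by have /andP[] := fM x.
have I0 : (0 <= \int[P]_x (f x)%:E)%E by apply: integral_ge0 => x _; rewrite lee_fin.
have IM : (\int[P]_x (f x)%:E <= M%:E)%E.
  apply: (@le_trans _ _ (\int[P]_x M%:E)%E); last first.
    by rewrite integral_cst//= probability_setT mule1.
  apply: ge0_le_integral => //; first by move=> x _; rewrite lee_fin.
    exact/measurable_EFinP.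
  by move=> x _; rewrite lee_fin; have /andP[] := fM x.
have Ifin : (\int[P]_x (f x)%:E)%E \is a fin_num.
  by rewrite ge0_fin_numE// (le_lt_trans IM)// ltry.
rewrite /Rintegral fineK//; split => //.
by rewrite fine_ge0//= -lee_fin fineK.
Qed.

Lemma joint_cons n (X : 'I_n.+1 -> T -> R) x :
  joint X x = [the n.+1.-tuple R of
    X ord0 x :: joint (fun i => X (lift ord0 i)) x].
Proof.
apply: eq_from_tnth => i; rewrite tnth_mktuple.
by case: (unliftP ord0 i) => [j ->|->]; rewrite ?tnthS ?tnth0 ?tnth_mktuple.
Qed.

Definition gaussian_family n (X : 'I_n -> {RV P >-> R}) (s : 'I_n -> R) : Prop :=
  rect_indep X /\
  forall i A, measurable A -> distribution P (X i) A = gauss 0 (s i) A.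

Lemma gaussian_family_behead n (X : 'I_n.+1 -> {RV P >-> R}) s :
  gaussian_family X s ->
  gaussian_family (fun i => X (lift ord0 i)) (fun i => s (lift ord0 i)).
Proof. by move=> [indX Xs]; split; [exact: rect_indep_behead|move=> i; exact: Xs]. Qed.

Lemma ge0_integral_gaussian_family n (X : 'I_n -> {RV P >-> R}) s i
    (g : R -> \bar R) : gaussian_family X s -> 
  (\int[distribution P (X i)]_a g a = \int[gauss 0 (s i)]_a g a)%E.
Proof. by move=> [_ Xs]; apply: eq_measure_integral => A mA _; exact: Xs. Qed.

(** The transport inequality tensorizes: conditionally on the first coordinate the
    remaining ones contribute the factor of the induction hypothesis, in which the
    squared distance of the first coordinates is a constant. *)
Lemma joint_transport n (X : 'I_n -> {RV P >-> R}) (s : 'I_n -> R)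
    (l sg M K : R) (U V : n.-tuple R -> R) : 0 < l < 1 -> 0 < sg -> 0 <= K ->
  gaussian_family X s -> (forall i, s i ^+ 2 <= sg ^+ 2) ->
  measurable_fun setT U -> measurable_fun setT V ->
  (forall w, 0 <= U w <= M) -> (forall w, 0 <= V w <= M) ->
  (forall v w, U v `^ (1 - l) * V w `^ l <= K * expR (l * (1 - l) *
     (\sum_(i < n) (tnth v i - tnth w i) ^+ 2) / (2 * sg ^+ 2))) ->
  (\int[P]_x U (joint X x)) `^ (1 - l) * (\int[P]_x V (joint X x)) `^ l <= K.
Proof.
move=> l01 sg0; elim: n => [|n IH] in X s K U V *.
  move=> K0 _ _ _ _ _ _ /(_ [tuple] [tuple]).
  rewrite big_ord0 mulr0 mul0r expR0 mulr1.
  have cstE (W : 0.-tuple R -> R) : \int[P]_x W (joint X x) = W [tuple].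
    under eq_Rintegral do rewrite [joint X _]tuple0.
    by rewrite Rintegral_cst//= probability_setT mulr1.
  by rewrite !cstE.
move=> K0 Xs ssg mU mV UM VM UVK.
have indX := Xs.1; have Xs' := gaussian_family_behead Xs.
set X' := fun i => X (lift ord0 i) in Xs'.
pose cons (a : R) (w : n.-tuple R) := [the n.+1.-tuple R of a :: w].
have mcons : measurable_fun setT (fun p : R * n.-tuple R => cons p.1 p.2).
  exact: measurable_cons.
have mcons1 a : measurable_fun setT (cons a).
  by apply: measurable_cons => //; exact: measurable_id.
pose avg (W : n.+1.-tuple R -> R) (a : R) := \int[P]_x W (cons a (joint X' x)).
have avgE (W : n.+1.-tuple R -> R) : measurable_fun setT W ->
    (forall w, 0 <= W w <= M) ->
    [/\ measurable_fun setT (avg W), forall a, 0 <= avg W a <= M &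
        \int[P]_x W (joint X x) = \int[gauss 0 (s ord0)]_a avg W a].
  move=> mW WM; have W0 w : 0 <= W w by have /andP[] := WM w.
  have mWa a : measurable_fun setT (fun x => W (cons a (joint X' x))).
    by apply: measurableT_comp => //; apply: measurableT_comp; [exact: mcons1|
      exact: measurable_joint].
  have avg1 a := Rintegral_bounded (mWa a) (fun x => WM _).
  pose G (p : R * n.-tuple R) := (W (cons p.1 p.2))%:E.
  have mG : measurable_fun setT G by apply/measurable_EFinP; exact: measurableT_comp.
  have G0 p : (0 <= G p)%E by rewrite lee_fin.
  have fubini := rect_indep_fubini indX mG G0.
  have mavg : measurable_fun setT (EFin \o avg W).
    have mF := @measurable_fun_fubini_tonelli_F _ _ _ _ _
      (distribution P (joint X')) _ mG G0.
    apply: eq_measurable_fun mF => a _; rewrite /fubini_F/= -(avg1 a).1.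
    rewrite ge0_integral_distribution//.
    by apply: (measurableT_comp mG); exact: measurable_pair1.
  split; [exact/measurable_EFinP|by move=> a; exact: (avg1 a).2|].
  rewrite /Rintegral; congr fine.
  transitivity (\int[P]_x G (X ord0 x, joint X' x))%E.
    by apply: eq_integral => x _; rewrite /G joint_cons.
  rewrite fubini (ge0_integral_gaussian_family _ _ Xs).
  by apply: eq_integral => a _; exact: (avg1 a).1.
have [mU' U'M ->] := avgE U mU UM; have [mV' V'M ->] := avgE V mV VM.
apply: (@gauss_transport R l sg 0 (s ord0) M) => // a b.
apply: (IH X' (fun i => s (lift ord0 i))
  (K * expR (l * (1 - l) * (a - b) ^+ 2 / (2 * sg ^+ 2)))
  (U \o cons a) (V \o cons b)) => //.
- by rewrite mulr_ge0// expR_ge0.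
- exact: measurableT_comp.
- exact: measurableT_comp.
- by move=> v; exact: UM.
- by move=> v; exact: VM.
- move=> v w; apply: le_trans (UVK _ _) _.
  rewrite -[leRHS]mulrA -expRD big_ord_recl !tnth0.
  under eq_bigr do rewrite !tnthS.
  by rewrite ler_wpM2l// ler_expR -mulrDl -mulrDr.
Qed.

End gaussian_family.

(** * Gaussian concentration *)

Section concentration.
Context d (T : measurableType d) (R : realType) (P : probability T R).

(** The transport inequality is applied to the indicators of [F <= m], of probability
    at least one half, and of the tail. Points of these two sets are more than
    [sg * t] apart, because [F] is Lipschitz; the rate [tau ^ 2 / 2] is exact because
    the interpolation parameter is optimized. *)
Lemma gaussian_concentration n (X : 'I_n -> {RV P >-> R}) (s : 'I_n -> R)
    (sg L m tau : R) (F : n.-tuple R -> R) : 0 < sg -> 0 <= L -> 0 <= tau ->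
  gaussian_family X s -> (forall i, s i ^+ 2 <= sg ^+ 2) ->
  measurable_fun setT F ->
  (forall v w, F w - F v <= L * Num.sqrt (\sum_(i < n) (tnth v i - tnth w i) ^+ 2)) ->
  (2^-1%:E <= P [set x | (F (joint X x) <= m)%R])%E ->
  (P [set x | (m + L * sg * (Num.sqrt (2 * ln 2) + tau) < F (joint X x))%R] <=
    (expR (- tau ^+ 2 / 2))%:E)%E.
Proof.
move=> sg0 L0 tau0 Xs ssg mF lipF med.
set c := Num.sqrt (2 * ln 2); set t := c + tau.
have ln20 : 0 < ln 2 :> R by rewrite ln_gt0// ltr1n.
have c0 : 0 < c by rewrite sqrtr_gt0 mulr_gt0.
have c2 : c ^+ 2 = 2 * ln 2 by rewrite sqr_sqrtr// mulr_ge0// ltW.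
have t0 : 0 < t by rewrite ltr_wpDr.
have mB : measurable [set w : n.-tuple R | m + L * sg * t < F w].
  exact: measurable_superlevel.
have mA : measurable [set w : n.-tuple R | F w <= m].
  exact: measurable_sublevel.
set A := [set w | F w <= m] in mA; set B := [set w | _ < F w] in mB.
have preim (C : set (n.-tuple R)) : measurable C -> measurable (joint X @^-1` C).
  by move=> mC; rewrite -[X in measurable X]setTI; exact: measurable_joint.
have [tauE|taun0] := eqVneq tau 0.
  by rewrite tauE expr0n/= oppr0 mul0r expR0; apply: probability_le1; exact: (preim B mB).
have taup : 0 < tau by rewrite lt_neqAle eq_sym taun0.
(* the maximizer of the exponent [(1 - l) * t ^ 2 / 2 - (1 - l) / l * ln 2] *)
pose l := c / t.
have lE : 1 - l = tau / t by rewrite /l /t; field; rewrite gt_eqF.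
have l01 : 0 < l < 1.
  by rewrite divr_gt0//= -subr_gt0 lE divr_gt0.
have /andP[l0 l1] := l01; have r0 : 0 < 1 - l by rewrite subr_gt0.
(* the weight of the tail that makes the constant of the inequality equal to 1 *)
pose e := expR ((1 - l) * t ^+ 2 / 2).
have e1 : 1 <= e.
  by rewrite -expR0 ler_expR divr_ge0// mulr_ge0 ?sqr_ge0// ltW.
have e0 : 0 <= e by exact: le_trans e1.
have ind01 (C : set (n.-tuple R)) w : 0 <= (\1_C w : R) <= 1.
  by rewrite indicE; case: (_ \in _) => /=; rewrite ?lexx ?ler01.
have intE (C : set (n.-tuple R)) : measurable C ->
    \int[P]_x \1_C (joint X x) = fine (P (joint X @^-1` C)).
  move=> mC; have mpC := preim C mC; rewrite /Rintegral; congr fine.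
  transitivity (\int[P]_x (\1_(joint X @^-1` C) x)%:E)%E.
    by apply: eq_integral => x _; rewrite !indicE; congr ((_ : bool)%:R%:E);
      apply/idP/idP; rewrite !inE.
  by rewrite integral_indic// setIT.
have mVB : measurable_fun setT (fun w => e * \1_B w).
  by apply: measurable_funM => //; exact: measurable_indic.
have := @joint_transport _ _ _ P n X s l sg e 1 (\1_A) (fun w => e * \1_B w)
  l01 sg0 ler01 Xs ssg (measurable_indic mA) mVB.
have -> : \int[P]_x (e * \1_B (joint X x)) = e * fine (P (joint X @^-1` B)).
  rewrite RintegralZl//; first by rewrite intE.
  have mBj : measurable_fun setT (fun x => \1_B (joint X x) : R).
    exact: (measurableT_comp (measurable_indic mB) (measurable_joint X)).
  apply/integrableP; split; first exact/measurable_EFinP.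
  under eq_integral do rewrite /= ger0_norm//.
  by rewrite (Rintegral_bounded P mBj (fun x => ind01 B _)).1 ltry.
rewrite intE// => tr.
have {}tr : fine (P (joint X @^-1` A)) `^ (1 - l) *
    (e * fine (P (joint X @^-1` B))) `^ l <= 1.
  apply: tr => [w|w|v w].
  - by have /andP[-> /le_trans->] := ind01 A w.
  - have /andP[B0 B1] := ind01 B w.
    by rewrite mulr_ge0//= -[leRHS]mulr1 ler_wpM2l.
  rewrite mul1r !indicE.
  have [vA|vA] := boolP (v \in A); last first.
    by rewrite powR0 ?gt_eqF// mul0r expR_ge0.
  have [wB|wB] := boolP (w \in B); last first.
    by rewrite mulr0 (powR0 (negbT (gt_eqF l0))) mulr0 expR_ge0.
  rewrite powR1 mul1r mulr1 /e -expRM ler_expR.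
  rewrite inE /A /= in vA; rewrite inE /B /= in wB.
  set S := \sum_(i < n) _; have S0 : 0 <= S by apply: sumr_ge0 => i _; exact: sqr_ge0.
  have := lipF v w; rewrite -/S => lipS.
  have LtS : L * (sg * t) < L * Num.sqrt S by lra.
  have tS : sg * t < Num.sqrt S.
    by move: LtS; have [->|Ln0] := eqVneq L 0; [rewrite !mul0r ltxx|
      rewrite ltr_pM2l// lt_neqAle eq_sym Ln0].
  have {}tS : (sg * t) ^+ 2 <= S.
    rewrite -[leRHS](sqr_sqrtr S0) lerXn2r ?nnegrE ?sqrtr_ge0 ?(ltW tS)//.
    by rewrite mulr_ge0// ltW.
  have sg2 : 0 < sg ^+ 2 by rewrite exprn_gt0.
  rewrite ler_pdivlMr; last by rewrite mulr_gt0.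
  rewrite exprMn in tS.
  rewrite (_ : _ * (2 * sg ^+ 2) = l * (1 - l) * (sg ^+ 2 * t ^+ 2)); last by field.
  by rewrite ler_wpM2l// mulr_ge0// ltW.
have Pfin C : measurable C -> (P (joint X @^-1` C) = (fine (P (joint X @^-1` C)))%:E)%E.
  by move=> mC; rewrite fineK// fin_num_measure//; exact: preim.
have := med; rewrite -[X in (_ <= X)%E -> _](_ : P (joint X @^-1` A) = _)// (Pfin A)//.
rewrite lee_fin; set a := fine _ in tr * => a2.
rewrite -[X in (X <= _)%E](_ : P (joint X @^-1` B) = _)// (Pfin B)// lee_fin.
set b := fine _ in tr *.
have b0 : 0 <= b by exact: fine_ge0.
have [->|bn0] := eqVneq b 0; first exact: expR_ge0.
have bp : 0 < b by rewrite lt_neqAle eq_sym bn0.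
have ap : 0 < a by apply: lt_le_trans a2; rewrite invr_gt0.
rewrite -ler_ln ?posrE ?expR_gt0// expRK.
have ep : 0 < e by exact: lt_le_trans e1.
move: tr; rewrite -ler_ln ?posrE ?mulr_gt0 ?powR_gt0 ?mulr_gt0//.
rewrite ln1 lnM ?posrE ?powR_gt0 ?mulr_gt0// !ln_powR lnM ?posrE// /e expRK.
have lna : - ln 2 <= ln a by rewrite -lnV ?posrE// ler_ln ?posrE// invr_gt0.
have ln2E : ln 2 = c ^+ 2 / 2 by rewrite c2 mulrC mulKf.
move=> tr; rewrite -(ler_pM2l l0).
have lt_c : l * t = c by rewrite /l divfK// gt_eqF.
have rt_tau : (1 - l) * t = tau by rewrite lE divfK// gt_eqF.
have := ler_wpM2l (ltW r0) lna; rewrite ln2E => lna'.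
have -> : l * (- tau ^+ 2 / 2) =
    (1 - l) * (c ^+ 2 / 2) - l * ((1 - l) * t ^+ 2 / 2).
  by rewrite -{1}rt_tau -lt_c; field.
lra.
Qed.

End concentration.

(** * Linear forms in Gaussian variables *)

Section gaussian_linear_forms.
Context d (T : measurableType d) (R : realType) (P : probability T R).

Lemma indic_preimage (U V : Type) (A : set V) (g : U -> V) x :
  \1_[set y | A (g y)] x = \1_A (g x) :> R.
Proof. by rewrite !indicE; congr ((_ : bool)%:R); apply/idP/idP; rewrite !inE. Qed.

Lemma measurable_linear_form n (a : 'I_n -> R) :
  measurable_fun setT (fun w : n.-tuple R => \sum_(i < n) a i * tnth w i).
Proof.
apply: measurable_sum => i; apply: measurable_funM => //.
exact: measurable_tnth.
Qed.

(** The first variable is integrated out against its own law, and the convolution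
    formula adds it to the Gaussian law of the others. *)
Lemma gaussian_sum n (X : 'I_n -> {RV P >-> R}) (s a : 'I_n -> R) (A : set R) :
  gaussian_family X s -> measurable A ->
  P [set x | A (\sum_(i < n) a i * X i x)] =
  gauss 0 (Num.sqrt (\sum_(i < n) a i ^+ 2 * s i ^+ 2)) A.
Proof.
elim: n => [|n IH] in X s a A *.
  move=> _ mA; rewrite big_ord0 sqrtr0.
  apply: etrans (esym (gauss0E 0 A)); rewrite diracE.
  have [A0|A0] := pselect (A 0).
    rewrite (mem_set A0) (_ : [set _ | _] = setT) ?probability_setT//.
    by apply/seteqP; split => x //= _; rewrite big_ord0.
  rewrite (memNset A0) (_ : [set _ | _] = set0) ?measure0//.
  by apply/seteqP; split => x //=; rewrite big_ord0.
move=> Xs mA; have indX := Xs.1; have Xs' := gaussian_family_behead Xs.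
set X' := fun i => X (lift ord0 i) in Xs'.
pose a' i := a (lift ord0 i); pose s' i := s (lift ord0 i).
pose r' := Num.sqrt (\sum_(i < n) a' i ^+ 2 * s' i ^+ 2).
pose S (p : R * n.-tuple R) := a ord0 * p.1 + \sum_(i < n) a' i * tnth p.2 i.
have mS : measurable_fun setT S.
  apply: measurable_funD; first by apply: measurable_funM => //; exact: measurable_fst.
  exact: (measurableT_comp (measurable_linear_form a') measurable_snd).
have mG : measurable_fun setT (fun p => (\1_A (S p))%:E : \bar R).
  by apply/measurable_EFinP; exact: (measurableT_comp (measurable_indic mA) mS).
have mshift y : measurable [set x | A (x + y)].
  rewrite -[X in measurable X]setTI.
  exact: (measurable_funD (@measurable_id _ _ setT) (measurable_cst y)).
have mset n' (Y : 'I_n' -> {RV P >-> R}) (e : 'I_n' -> R) (B : set R) :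
    measurable B -> measurable [set x | B (\sum_(i < n') e i * Y i x)].
  move=> mB; rewrite -[X in measurable X]setTI.
  suff mY : measurable_fun setT (fun x => \sum_(i < n') e i * Y i x) by exact: mY.
  by apply: measurable_sum => i; exact: measurable_funM.
pose H (y : R) : \bar R := gauss 0 r' [set x | A (x + y)].
have mH : measurable_fun setT H.
  have mk : measurable_fun setT (fun p : R * R => (\1_A (p.2 + p.1))%:E : \bar R).
    apply/measurable_EFinP; apply: (measurableT_comp (measurable_indic mA)).
    by apply: measurable_funD; [exact: measurable_snd|exact: measurable_fst].
  have k0 p : (0 <= (\1_A (p.2 + p.1) : R)%:E)%E by rewrite lee_fin.
  have := @measurable_fun_fubini_tonelli_F _ _ _ _ _ (gauss 0 r') _ mk k0.
  apply: eq_measurable_fun => y _; apply/esym.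
  apply: (etrans (integral_gauss_indic 0 r' (mshift y))).
  by apply: eq_integral => x _; rewrite indic_preimage.
transitivity (\int[distribution P (X ord0)]_y H (a ord0 * y)%R)%E.
  rewrite (_ : P _ = \int[P]_x (\1_A (S (X ord0 x, joint X' x)))%:E)%E; last first.
    transitivity (\int[P]_x (\1_[set x | A (\sum_(i < n.+1) a i * X i x)%R] x)%:E)%E.
      by rewrite integral_indic ?setIT//; exact: mset.
    apply: eq_integral => x _; rewrite indic_preimage big_ord_recl /S/=.
    by under [in RHS]eq_bigr do rewrite tnth_mktuple.
  rewrite (rect_indep_fubini (G := fun p => (\1_A (S p))%:E) indX mG)//.
  apply: eq_integral => y _; rewrite /H -(IH X' s' a' _ Xs' (mshift _)).
  transitivity (\int[P]_x (\1_[set x | A (\sum_(i < n) a' i * X' i x + a ord0 * y)%R] x)%:E)%E.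
    apply: eq_integral => x _; rewrite (indic_preimage A) /S/= addrC.
    by under eq_bigr do rewrite tnth_mktuple.
  rewrite integral_indic ?setIT//; exact: (mset _ X' a' _ (mshift _)).
rewrite (ge0_integral_gaussian_family _ _ Xs).
pose phi (y : R) := a ord0 * y.
have mphi : measurable_fun setT phi by exact: measurable_funM.
transitivity (\int[pushforward (gauss 0 (s ord0)) phi]_y H y)%E.
  by rewrite ge0_integral_pushforward// => y _; exact: measure_ge0.
transitivity (\int[gauss 0 (a ord0 * s ord0)]_y H y)%E.
  by apply: eq_measure_integral => B mB _; exact: gauss_scale.
apply: gauss_conv => //; rewrite !sqr_sqrtr ?sumr_ge0//; try by move=> i _; rewrite mulr_ge0// sqr_ge0.
by rewrite big_ord_recl exprMn addrC.
Qed.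

End gaussian_linear_forms.

(** * Comparison of Gaussian maxima *)

Section finite_maximum.
Context {R : realType} (V : finType) (v0 : V).

(** The base value is a competitor itself, so negative values of [g] are allowed. *)
Definition fmax (g : V -> R) : R := \big[Num.max/g v0]_(v : V) g v.

Lemma fmax_ge g v : g v <= fmax g.
Proof. exact: le_bigmax. Qed.

Lemma fmax_ex g : exists v, fmax g = g v.
Proof.
rewrite /fmax; apply: (big_ind (fun y => exists v, y = g v)).
- by exists v0.
- by move=> x y [u ->] [v ->]; case: (leP (g u) (g v)) => _; [exists v|exists u].
- by move=> v _; exists v.
Qed.

Lemma fmax_le g y : (forall v, g v <= y) -> fmax g <= y.
Proof. by move=> gy; have [v ->] := fmax_ex g. Qed.

Lemma measurable_bigmax d (T : measurableType d) (h : T -> R) (g : T -> V -> R) :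
  measurable_fun setT h -> (forall v, measurable_fun setT (g ^~ v)) ->
  measurable_fun setT (fun x => \big[Num.max/h x]_(v : V) g x v).
Proof.
move=> mh mg; elim: (index_enum V) => [|v r IH].
  by under eq_fun do rewrite big_nil.
by under eq_fun do rewrite big_cons; exact: measurable_maxr.
Qed.

Lemma measurable_fmax d (T : measurableType d) (g : T -> V -> R) :
  (forall v, measurable_fun setT (g ^~ v)) ->
  measurable_fun setT (fun x => fmax (g x)).
Proof. by move=> mg; apply: measurable_bigmax. Qed.

(** The two-point case of the comparison: replacing the increments of [a] by larger
    ones increases the sum of the maxima over both signs, because the maximizers [u]
    and [v] on the left may be used on the right in the better of the two orders. *)
Lemma fmax_sign_le (A a b : V -> R) (r : R) :
  (forall u v, `|a u - a v| <= `|b u - b v|) ->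
  fmax (fun v => r * a v + A v) + fmax (fun v => - r * a v + A v) <=
  fmax (fun v => r * b v + A v) + fmax (fun v => - r * b v + A v).
Proof.
move=> ab; have [u ->] := fmax_ex (fun v => r * a v + A v).
have [v ->] := fmax_ex (fun v => - r * a v + A v).
have le1 : r * (a u - a v) <= `|r * (b u - b v)|.
  by rewrite (le_trans (ler_norm _))// !normrM ler_wpM2l.
have p1 := fmax_ge (fun v => r * b v + A v); have p2 := fmax_ge (fun v => - r * b v + A v).
have := p1 u; have := p2 v; have := p1 v; have := p2 u; move: le1.
by case: (ler0P (r * (b u - b v))) => _ /=; nra.
Qed.

End finite_maximum.

Section contraction.
Context d (T : measurableType d) (R : realType) (P : probability T R).

(** The two joint laws give the same mass to rectangles. *)
Lemma gaussian_family_law n (X Y : 'I_n -> {RV P >-> R}) (s : 'I_n -> R)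
    (G : n.-tuple R -> \bar R) : gaussian_family X s -> gaussian_family Y s ->
  measurable_fun setT G -> (forall w, 0 <= G w)%E ->
  (\int[P]_x G (joint X x) = \int[P]_x G (joint Y x))%E.
Proof.
move=> Xs Ys mG G0.
transitivity (\int[distribution P (joint X)]_w G w)%E.
  by rewrite ge0_integral_distribution.
transitivity (\int[distribution P (joint Y)]_w G w)%E; last first.
  by rewrite ge0_integral_distribution.
apply: eq_measure_integral => A mA _.
apply: (tuple_measure_unique (m1 := distribution P (joint X))) => //.
  by apply: le_lt_trans (ltry 1); exact: probability_le1.
move=> B mB.
have jointE (Z : 'I_n -> {RV P >-> R}) : gaussian_family Z s ->
    distribution P (joint Z) (rectangle B) = (\prod_(i < n) gauss 0 (s i) (B i))%E.
  move=> [indZ Zs]; rewrite /distribution /pushforward joint_rectangle indZ//.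
  by apply: eq_bigr => i _; exact: Zs.
exact: (etrans (jointE X Xs) (esym (jointE Y Ys))).
Qed.

Definition flip n (k : 'I_n) (w : n.-tuple R) : n.-tuple R :=
  [tuple (if i == k then - tnth w i else tnth w i) | i < n].

Lemma gaussian_family_flip n (X : 'I_n -> {RV P >-> R}) (s : 'I_n -> R) k
    (G : n.-tuple R -> \bar R) : gaussian_family X s ->
  measurable_fun setT G -> (forall w, 0 <= G w)%E ->
  (\int[P]_x G (flip k (joint X x)) = \int[P]_x G (joint X x))%E.
Proof.
move=> Xs mG G0.
pose Yf i x := if i == k then - X i x else X i x.
have mYf i : measurable_fun setT (Yf i).
  rewrite /Yf; case: (i == k) => //.
  exact: (measurableT_comp (@oppr_measurable R setT)).
pose Y i : {RV P >-> R} := HB.pack (Yf i) (isMeasurableFun.Build _ _ _ _ _ (mYf i)).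
have mN (A : set R) : measurable A -> measurable [set x | A (- x)].
  by move=> mA; rewrite -[X in measurable X]setTI;
    exact: (@oppr_measurable R setT measurableT _ mA).
have Ys : gaussian_family Y s.
  split => [B mB|i A mA].
    pose C i := if i == k then [set x | B i (- x)] else B i.
    have YX i x : B i (Y i x) <-> C i (X i x) by rewrite /C /= /Yf; case: (i == k).
    have PYX i : P (X i @^-1` C i) = P (Y i @^-1` B i).
      by congr (P _); apply/seteqP; split => x /= /YX.
    transitivity (P [set x | forall i, C i (X i x)]).
      by congr (P _); apply/seteqP; split => x xB i; apply/YX; exact: xB.
    rewrite Xs.1; last by move=> i; rewrite /C; case: ifP => _ //; exact: mN.
    by apply: eq_bigr => i _; exact: PYX.
  rewrite /distribution /pushforward.
  have := eqVneq i k => -[ik|ik].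
    rewrite (_ : Y i @^-1` A = X i @^-1` [set x | A (- x)]).
      exact: (etrans (Xs.2 i _ (mN _ mA)) (gauss_opp (s i) mA)).
    by apply/seteqP; split => x; rewrite /= /Yf ik eqxx.
  rewrite (_ : Y i @^-1` A = X i @^-1` A); first exact: Xs.2.
  by apply/seteqP; split => x; rewrite /= /Yf (negbTE ik).
rewrite (gaussian_family_law Xs Ys mG G0); apply: eq_integral => x _; congr G.
by apply: eq_from_tnth => i; rewrite !tnth_mktuple.
Qed.

Variables (V : finType) (v0 : V).

Lemma measurable_fmax_form n (a : V -> 'I_n -> R) :
  measurable_fun setT (fun w : n.-tuple R => fmax v0 (fun v => \sum_(i < n) a v i * tnth w i)).
Proof.
by apply: (measurable_fmax v0 (g := fun w v => \sum_(i < n) a v i * tnth w i)) => v;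
  exact: measurable_linear_form.
Qed.

Let E n (X : 'I_n -> {RV P >-> R}) (a : V -> 'I_n -> R) : \bar R :=
  (\int[P]_x (fmax v0 (fun v => \sum_(i < n) a v i * X i x)%R)%:E)%E.

Lemma fmax_form_ge0 n (a : V -> 'I_n -> R) (x : 'I_n -> R) :
  (forall i, a v0 i = 0) -> 0 <= fmax v0 (fun v => \sum_(i < n) a v i * x i).
Proof.
move=> a0; apply: le_trans (fmax_ge v0 _ v0).
by rewrite big1// => i _; rewrite a0 mul0r.
Qed.

(* Averaging over the sign of the [k]-th variable, which keeps the law, reduces the
   change of one coordinate to [fmax_sign_le]. *)
Let contraction1 n (X : 'I_n -> {RV P >-> R}) (s : 'I_n -> R) (k : 'I_n)
    (a b : V -> 'I_n -> R) : gaussian_family X s ->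
  (forall i, a v0 i = 0) -> (forall i, b v0 i = 0) ->
  (forall v i, i != k -> a v i = b v i) ->
  (forall u v, `|a u k - a v k| <= `|b u k - b v k|) ->
  (E X a <= E X b)%E.
Proof.
move=> Xs a0 b0 abk ab.
pose F (e : V -> 'I_n -> R) (w : n.-tuple R) := fmax v0 (fun v => \sum_(i < n) e v i * tnth w i).
have F0 e w : (forall i, e v0 i = 0) -> 0 <= F e w.
  exact: (fmax_form_ge0 (tnth w)).
have mF e : measurable_fun setT (F e) by exact: measurable_fmax_form.
have mFX e : measurable_fun setT (fun x => F e (joint X x)).
  exact: (measurableT_comp (mF e) (measurable_joint X)).
have mflip : measurable_fun setT (flip k).
  apply/measurable_fun_tnthP => i.
  rewrite (_ : _ \o _ = fun w : n.-tuple R => if i == k then - tnth w i else tnth w i).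
    case: (i == k); last exact: measurable_tnth.
    exact: (measurableT_comp (@oppr_measurable R setT) (measurable_tnth i)).
  by apply/funext => w; rewrite /= tnth_mktuple.
have mFf e : measurable_fun setT (fun x => F e (flip k (joint X x))).
  exact: (measurableT_comp (measurableT_comp (mF e) mflip) (measurable_joint X)).
have EE e : E X e = (\int[P]_x (F e (joint X x))%:E)%E.
  apply: eq_integral => x _; congr (fmax _ _)%:E; apply/funext => v.
  by apply: eq_bigr => i _; rewrite tnth_mktuple.
have E2 e : (forall i, e v0 i = 0) -> (2%:E * E X e =
    \int[P]_x (F e (joint X x) + F e (flip k (joint X x)))%:E)%E.
  move=> e0; rewrite EE; under [RHS]eq_integral do rewrite EFinD.
  rewrite ge0_integralD//.
  - rewrite (gaussian_family_flip (G := fun w => (F e w)%:E) k Xs).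
    + by rewrite -[2%:E]/(1 + 1)%:E EFinD ge0_muleDl ?lee_fin// mul1e.
    + exact/measurable_EFinP.
    + by move=> w; rewrite lee_fin F0.
  - by move=> x _; rewrite lee_fin F0.
  - exact/measurable_EFinP.
  - by move=> x _; rewrite lee_fin F0.
  - exact/measurable_EFinP.
rewrite -(@lee_pmul2l _ 2%:E)// !E2//.
apply: ge0_le_integral => //.
- by move=> x _; rewrite lee_fin addr_ge0// F0.
- by apply/measurable_EFinP; exact: measurable_funD.
- by apply/measurable_EFinP; exact: measurable_funD.
move=> x _; rewrite lee_fin; set w := joint X x.
pose A v := \sum_(i < n | i != k) b v i * tnth w i.
have split1 e : (forall v i, i != k -> e v i = b v i) ->
    F e w = fmax v0 (fun v => tnth w k * e v k + A v).
  move=> eb; congr fmax; apply/funext => v; rewrite (bigD1 k)//= mulrC.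
  by congr (_ + _); apply: eq_bigr => i ik; rewrite eb.
have split2 e : (forall v i, i != k -> e v i = b v i) ->
    F e (flip k w) = fmax v0 (fun v => - tnth w k * e v k + A v).
  move=> eb; congr fmax; apply/funext => v; rewrite (bigD1 k)//= mulrC.
  rewrite tnth_mktuple eqxx; congr (_ + _); apply: eq_bigr => i ik.
  by rewrite eb// tnth_mktuple (negbTE ik).
rewrite !split1// !split2//; exact: fmax_sign_le.
Qed.

(** The coordinates are replaced one at a time. As in the comparison theorem of
    Sudakov and Fernique, larger increments make a larger expected maximum; here the
    increments are compared coordinate by coordinate. *)
Lemma gaussian_contraction n (X : 'I_n -> {RV P >-> R}) (s : 'I_n -> R)
    (a b : V -> 'I_n -> R) : gaussian_family X s ->
  (forall i, a v0 i = 0) -> (forall i, b v0 i = 0) ->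
  (forall u v i, `|a u i - a v i| <= `|b u i - b v i|) ->
  (\int[P]_x (fmax v0 (fun v => \sum_(i < n) a v i * X i x)%R)%:E <=
   \int[P]_x (fmax v0 (fun v => \sum_(i < n) b v i * X i x)%R)%:E)%E.
Proof.
move=> Xs a0 b0 ab.
pose c (j : nat) v (i : 'I_n) := if (i < j)%N then b v i else a v i.
have cn : c n = b by apply/funext => v; apply/funext => i; rewrite /c ltn_ord.
suff main j : (j <= n)%N -> (E X a <= E X (c j))%E by have := main n (leqnn n); rewrite cn.
elim: j => [_|j IH jn]; first exact: le_refl.
apply: le_trans (IH (ltnW jn)) _.
apply: (@contraction1 _ X s (Ordinal jn)) => //.
- by move=> i; rewrite /c a0 b0 if_same.
- by move=> i; rewrite /c a0 b0 if_same.
- move=> v i ij; rewrite /c ltnS [(i <= j)%N]leq_eqVlt.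
  have -> : (nat_of_ord i == j) = false by exact: negbTE ij.
  by [].
- by move=> u v; rewrite /c /= ltnn ltnSn.
Qed.

End contraction.

(** * Tail and expected maximum of linear forms *)

Section gaussian_maxima.
Context d (T : measurableType d) (R : realType) (P : probability T R).
Variables (n : nat) (X : 'I_n -> {RV P >-> R}) (s : 'I_n -> R).
Hypothesis Xs : gaussian_family X s.

Let form (a : 'I_n -> R) (x : T) : R := \sum_(i < n) a i * X i x.

Let measurable_form a : measurable_fun setT (form a).
Proof. by apply: measurable_sum => i; exact: measurable_funM. Qed.

Lemma gaussian_form_tail (a : 'I_n -> R) (r x : R) : 0 <= r -> 0 <= x ->
  \sum_(i < n) a i ^+ 2 * s i ^+ 2 <= r ^+ 2 ->
  (P [set t | (r * x < `|\sum_(i < n) a i * X i t|)%R] <=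
    (expR (- x ^+ 2 / 2))%:E)%E.
Proof.
move=> r0 x0 ar.
have mA : measurable [set y : R | r * x < `|y|].
  by apply: measurable_superlevel; exact: normr_measurable.
have /= -> := gaussian_sum a Xs mA; apply: gauss_tail => //.
by rewrite sqr_sqrtr// sumr_ge0// => i _; rewrite mulr_ge0// sqr_ge0.
Qed.

Lemma gaussian_form_mgf (a : 'I_n -> R) (l : R) :
  (\int[P]_x (expR (l * \sum_(i < n) a i * X i x)%R)%:E =
   (expR (l ^+ 2 * (\sum_(i < n) a i ^+ 2 * s i ^+ 2) / 2))%:E)%E.
Proof.
set r2 := \sum_(i < n) a i ^+ 2 * _.
have r20 : 0 <= r2 by apply: sumr_ge0 => i _; rewrite mulr_ge0// sqr_ge0.
have := mgf_gauss 0 (Num.sqrt r2) l.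
rewrite mulr0 add0r (sqr_sqrtr r20) => <-.
have mexp : measurable_fun setT (fun y : R => (expR (l * y))%:E : \bar R).
  by apply/measurable_EFinP/measurableT_comp => //; exact: measurable_funM.
transitivity (\int[pushforward P (form a)]_y (expR (l * y))%:E)%E.
  by rewrite (ge0_integral_pushforward (measurable_form a) _ measurableT).
by apply: eq_measure_integral => A mA _; exact: (gaussian_sum a Xs mA).
Qed.

(** A maximum of absolute values is at most the logarithm of a sum of [2 * p]
    exponentials. The linear bound [1 + z <= exp z], taken at a point [c] with the
    expected sum at most [exp c], takes the place of Jensen's inequality for the
    logarithm. *)
Lemma expected_max_abs_le (p : nat) (g : 'I_p -> 'I_n -> R) (r : R) :
  (0 < p)%N -> 0 < r ->
  (forall k, \sum_(i < n) g k i ^+ 2 * s i ^+ 2 <= r ^+ 2) ->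
  (\int[P]_x (\big[Num.max/0]_(k < p) `|\sum_(i < n) g k i * X i x|)%R%:E <=
   (r * Num.sqrt (2 * ln (2 * p%:R)))%:E)%E.
Proof.
move=> p0 r0 gr; set q := Num.sqrt _.
have p2 : 1 < 2 * p%:R :> R.
  by rewrite -natrM ltr1n (leq_trans _ (leq_mul (leqnn 2) p0)).
have lnp : 0 < ln (2 * p%:R) :> R by rewrite ln_gt0.
have q0 : 0 < q by rewrite sqrtr_gt0 mulr_gt0.
have q2 : q ^+ 2 = 2 * ln (2 * p%:R) by rewrite sqr_sqrtr// mulr_ge0// ltW.
pose l := q / r; have l0 : 0 < l by rewrite divr_gt0.
pose c := q ^+ 2.
pose mx x := \big[Num.max/0]_(k < p) `|form (g k) x|.
have mmx : measurable_fun setT mx.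
  apply: (measurable_bigmax (g := fun x k => `|form (g k) x|)) => // k.
  by apply: measurableT_comp => //; exact: measurable_form.
have mx0 x : 0 <= mx x.
  by apply: (big_ind (fun y => 0 <= y)) => // y z y0 z0; rewrite le_max y0.
pose ex k (e : R) x := expR (- c) * expR (e * form (g k) x).
have mex k e : measurable_fun setT (ex k e).
  apply: measurable_funM => //; apply: measurableT_comp => //.
  by apply: measurable_funM => //; exact: measurable_form.
have ex0 k e x : 0 <= ex k e x by rewrite mulr_ge0 ?expR_ge0.
have pw x : l * mx x + 1 <= c + \sum_(k < p) (ex k l x + ex k (- l) x).
  have key k : l * `|form (g k) x| + 1 <= c + (ex k l x + ex k (- l) x).
    have : 1 + (l * `|form (g k) x| - c) <= ex k l x + ex k (- l) x.
      apply: le_trans (expR_ge1Dx _) _.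
      have exE e : expR (e * form (g k) x - c) = ex k e x by rewrite addrC expRD.
      have [f0|/ltW f0] := leP 0 (form (g k) x).
        by rewrite (ger0_norm f0) exE lerDl.
      by rewrite (ler0_norm f0) mulrN -mulNr exE lerDr.
    by lra.
  have sum0 k : 0 <= ex k l x + ex k (- l) x by rewrite addr_ge0.
  have [k ->] : exists k, mx x = `|form (g k) x|.
    have -> : mx x = fmax (Ordinal p0) (fun k => `|form (g k) x|).
      apply/eqP; rewrite eq_le; apply/andP; split; last first.
        by apply: fmax_le => k; exact: le_bigmax.
      apply/bigmax_leP; split => [|k _]; last exact: (fmax_ge _ (fun k => `|form (g k) x|)).
      exact: le_trans (normr_ge0 _)
        (fmax_ge (Ordinal p0) (fun k => `|form (g k) x|) (Ordinal p0)).
    exact: fmax_ex.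
  apply: le_trans (key k) _; rewrite lerD2l (bigD1 k)//= lerDl.
  by apply: sumr_ge0.
have intex k e : e ^+ 2 = l ^+ 2 ->
    (\int[P]_x (ex k e x)%:E <= ((2 * p%:R)^-1)%:E)%E.
  move=> el; under eq_integral do rewrite EFinM.
  rewrite ge0_integralZl ?lee_fin ?expR_ge0//; last first.
    apply/measurable_EFinP/measurableT_comp => //.
    by apply: measurable_funM => //; exact: measurable_form.
  rewrite gaussian_form_mgf -EFinM -expRD lee_fin el.
  rewrite -[X in _ <= X]lnK ?posrE ?invr_gt0 ?(lt_trans ltr01)// ler_expR.
  rewrite lnV ?posrE ?(lt_trans ltr01)//.
  have : l ^+ 2 * (\sum_(i < n) g k i ^+ 2 * s i ^+ 2) <= c.
    have -> : c = l ^+ 2 * r ^+ 2 by rewrite -exprMn /l divfK// gt_eqF.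
    by rewrite ler_wpM2l ?sqr_ge0.
  by rewrite /c; lra.
have step : (l%:E * \int[P]_x (mx x)%:E + 1 <= c%:E + 1)%E.
  have PT : (\int[P]_x 1%:E = 1 :> \bar R)%E.
    by rewrite integral_cst//= probability_setT mule1.
  have PC : (\int[P]_x c%:E = c%:E :> \bar R)%E.
    by rewrite integral_cst//= probability_setT mule1.
  rewrite -{1}PT -ge0_integralZl//; [|exact/measurable_EFinP|
    by move=> x _; rewrite lee_fin|by rewrite lee_fin ltW].
  rewrite -ge0_integralD//; [|by move=> x _; rewrite lee_fin mulr_ge0// ltW|
    by apply/measurable_EFinP; exact: measurable_funM].
  apply: (@le_trans _ _ (\int[P]_x (c%:E + \sum_(k < p) (ex k l x + ex k (- l) x)%:E))%E).
    apply: ge0_le_integral => //.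
    - by move=> x _; rewrite lee_fin addr_ge0// mulr_ge0// ltW.
    - by apply/measurable_EFinP/measurable_funD => //; exact: measurable_funM.
    - apply: emeasurable_funD => //; apply: emeasurable_sum => k.
      by apply/measurable_EFinP; exact: measurable_funD.
    - by move=> x _; rewrite sumEFin -EFinD lee_fin.
  rewrite ge0_integralD//; last 3 first.
  - by move=> x _; rewrite lee_fin sqr_ge0.
  - by move=> x _; apply: sume_ge0 => k _; rewrite lee_fin addr_ge0.
  - apply: emeasurable_sum => k.
    by apply/measurable_EFinP; exact: measurable_funD.
  rewrite PC leeD2l// ge0_integral_sum//; last 2 first.
  - by move=> k; apply/measurable_EFinP; exact: measurable_funD.
  - by move=> k x _; rewrite lee_fin addr_ge0.
  apply: (@le_trans _ _ (\sum_(k < p) (p%:R^-1)%:E)%E).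
    apply: lee_sum => k _; under eq_integral do rewrite EFinD.
    rewrite ge0_integralD//; try exact/measurable_EFinP;
      try by move=> x _; rewrite lee_fin.
    apply: le_trans (leeD (intex k l erefl) (intex k (- l) (sqrrN l))) _.
    rewrite -EFinD lee_fin.
    have pn0 : p%:R != 0 :> R by rewrite pnatr_eq0 -lt0n.
    have -> // : ((2 * p%:R)^-1 + (2 * p%:R)^-1 = p%:R^-1 :> R)%R by field.
  rewrite sumEFin sumr_const card_ord -(mulr_natr p%:R^-1) mulVf//.
  by rewrite pnatr_eq0 -lt0n.
have {}step : (l%:E * \int[P]_x (mx x)%:E <= c%:E)%E by rewrite -(@leeD2rE _ 1%E).
have -> : r * q = l^-1 * c by rewrite /c /l invf_div; field; rewrite gt_eqF.
by rewrite EFinM lee_pdivlMl.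
Qed.

End gaussian_maxima.

(** * Tail of a finite Gaussian process *)

Lemma sum_cauchy_schwarz (R : realType) n (a c : 'I_n -> R) :
  (\sum_(i < n) a i * c i) ^+ 2 <= (\sum_(i < n) a i ^+ 2) * (\sum_(i < n) c i ^+ 2).
Proof.
rewrite -subr_ge0 -(pmulr_rge0 _ (ltr0n R 2)).
have -> : 2 * ((\sum_(i < n) a i ^+ 2) * (\sum_(i < n) c i ^+ 2) -
    (\sum_(i < n) a i * c i) ^+ 2) =
    \sum_(i < n) \sum_(j < n) (a i * c j - a j * c i) ^+ 2.
  rewrite mulrBr expr2 [X in X - _]mulr_natl mulr2n {2}mulrC !big_distrlr/=.
  rewrite mulr_sumr -big_split -sumrB; apply: eq_bigr => i _.
  rewrite mulr_sumr -big_split -sumrB; apply: eq_bigr => j _ /=.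
  by ring.
by apply: sumr_ge0 => i _; apply: sumr_ge0 => j _; exact: sqr_ge0.
Qed.

Section process_tail.
Context d (T : measurableType d) (R : realType) (P : probability T R).
Variables (n : nat) (X : 'I_n -> {RV P >-> R}) (s : 'I_n -> R).
Hypothesis Xs : gaussian_family X s.
Variables (V : finType) (v0 : V).

(** The tail of a finite Gaussian process whose increments are dominated by those
    of a linear process with coordinates in an l1-ball. Comparison reduces the
    expected maximum to that of [p] Gaussian variables, the extreme points of the
    ball; Markov's inequality turns it into a bound for a median, and concentration
    adds the deviation with the sharp constant. In units of
    [sg * D * M * sqrt (ln (2 * p))], the median costs [4 * sqrt 2] and the loss
    [sqrt (2 * ln 2)] in the concentration above it at most [sqrt 2], which makes less
    than 8. *)
Lemma gaussian_process_tail (p : nat) (a : V -> 'I_n -> R) (e : V -> 'I_p -> R)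
    (g : 'I_p -> 'I_n -> R) (sg D M B tau : R) :
  (0 < p)%N -> 0 < sg -> 0 <= D -> 0 < M -> 0 <= B <= D * M -> 0 <= tau ->
  (forall i, s i ^+ 2 <= sg ^+ 2) ->
  (forall i, a v0 i = 0) -> (forall k, e v0 k = 0) ->
  (forall v, \sum_(k < p) `|e v k| <= D) ->
  (forall k, \sum_(i < n) g k i ^+ 2 <= M ^+ 2) ->
  (forall v, \sum_(i < n) a v i ^+ 2 <= B ^+ 2) ->
  (forall u v i, `|a u i - a v i| <=
     `|\sum_(k < p) e u k * g k i - \sum_(k < p) e v k * g k i|) ->
  (P [set x | exists v, (sg * (8 * D * M * Num.sqrt (ln (2 * p%:R)) + B * tau) <
      `|\sum_(i < n) a v i * X i x|)%R] <= (expR (- tau ^+ 2 / 2))%:E)%E.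
Proof.
move=> p0 sg0 D0 M0 /andP[B0 BDM] tau0 ssg a0 e0 eD gM aB ab.
have lnp : 0 < ln (2 * p%:R) :> R.
  by rewrite ln_gt0// -natrM ltr1n (leq_trans _ (leq_mul (leqnn 2) p0)).
have [Dz|Dn0] := eqVneq D 0.
  rewrite (_ : [set x | _] = set0) ?measure0 ?lee_fin ?expR_ge0//.
  apply/seteqP; split => x //= -[v].
  have Bz : B = 0 by apply/eqP; rewrite eq_le B0 andbT (le_trans BDM)// Dz mul0r.
  have av i : a v i = 0.
    have := aB v; rewrite Bz expr0n/= => av0.
    have /eqP : \sum_(i < n) a v i ^+ 2 = 0.
      by apply/eqP; rewrite eq_le av0/= sumr_ge0// => j _; exact: sqr_ge0.
    rewrite psumr_eq0; last by move=> j _; exact: sqr_ge0.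
    by move=> /allP/(_ i); rewrite mem_index_enum => /(_ isT)/=; rewrite sqrf_eq0 => /eqP.
  rewrite big1; last by move=> i _; rewrite av mul0r.
  by rewrite normr0 Dz Bz !(mul0r, mulr0) addr0 mulr0 ltxx.
have Dp : 0 < D by rewrite lt_neqAle eq_sym Dn0.
pose b (v : V) (i : 'I_n) := \sum_(k < p) e v k * g k i.
have b0 i : b v0 i = 0 by rewrite /b big1// => k _; rewrite e0 mul0r.
pose F (w : n.-tuple R) := fmax v0 (fun v => `|\sum_(i < n) a v i * tnth w i|).
have mF : measurable_fun setT F.
  apply: (measurable_fmax v0 (g := fun w v => `|\sum_(i < n) a v i * tnth w i|)) => v.
  by apply: measurableT_comp => //; exact: measurable_linear_form.
have mFX : measurable_fun setT (fun x => F (joint X x)).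
  exact: (measurableT_comp mF (measurable_joint X)).
have F0 w : 0 <= F w.
  exact: le_trans (normr_ge0 _) (fmax_ge v0 (fun v => `|\sum_(i < n) a v i * tnth w i|) v0).
have FE x : F (joint X x) = fmax v0 (fun v => `|\sum_(i < n) a v i * X i x|).
  by congr fmax; apply/funext => v; under eq_bigr do rewrite tnth_mktuple.
pose q : R := Num.sqrt (2 * ln (2 * p%:R)).
have q0 : 0 < q by rewrite sqrtr_gt0 mulr_gt0.
(* A linear form on the l1-ball of radius [D] is at most [D] times its largest
   coefficient in absolute value. *)
have boundb : (\int[P]_x (fmax v0 (fun v => \sum_(i < n) b v i * X i x)%R)%:E <=
    (D * (sg * M * q))%:E)%E.
  have gM' k : \sum_(i < n) g k i ^+ 2 * s i ^+ 2 <= (sg * M) ^+ 2.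
    apply: (@le_trans _ _ (\sum_(i < n) g k i ^+ 2 * sg ^+ 2)).
      by apply: ler_sum => i _; rewrite ler_wpM2l ?sqr_ge0.
    by rewrite -mulr_suml exprMn mulrC ler_wpM2l ?sqr_ge0.
  have mx_le := expected_max_abs_le Xs p0 (mulr_gt0 sg0 M0) gM'.
  pose mx x := \big[Num.max/0]_(k < p) `|\sum_(i < n) g k i * X i x|.
  have mform (c : 'I_n -> R) : measurable_fun setT (fun x => \sum_(i < n) c i * X i x).
    by apply: measurable_sum => i; exact: measurable_funM.
  have mmx : measurable_fun setT mx.
    apply: (measurable_bigmax (g := fun x k => `|\sum_(i < n) g k i * X i x|)) => // k.
    exact: measurableT_comp.
  have mx0 x : 0 <= mx x.
    by apply: (big_ind (fun y => 0 <= y)) => // y z y0 z0; rewrite le_max y0.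
  apply: (@le_trans _ _ (\int[P]_x (D * mx x)%:E)%E).
    apply: ge0_le_integral => //.
    - by move=> x _; rewrite lee_fin (fmax_form_ge0 (fun i => X i x)).
    - apply/measurable_EFinP.
      by apply: (measurable_fmax v0 (g := fun x v => \sum_(i < n) b v i * X i x)) => v.
    - by apply/measurable_EFinP; exact: measurable_funM.
    move=> x _; rewrite lee_fin; apply: fmax_le => v.
    rewrite /b; under eq_bigr do rewrite mulr_suml.
    rewrite exchange_big /=.
    apply: (@le_trans _ _ (\sum_(k < p) `|e v k| * mx x)); last first.
      by rewrite -mulr_suml ler_wpM2r.
    apply: ler_sum => k _; under eq_bigr do rewrite -mulrA.
    rewrite -mulr_sumr (le_trans (ler_norm _))// normrM ler_wpM2l//.
    exact: (le_bigmax _ (fun k => `|\sum_(i < n) g k i * X i x|)).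
  under eq_integral do rewrite EFinM.
  rewrite ge0_integralZl ?lee_fin//; [|exact/measurable_EFinP|by move=> x _; rewrite lee_fin].
  by rewrite EFinM lee_wpmul2l ?lee_fin.
have abN u v i : `|- a u i - - a v i| <= `|b u i - b v i|.
  by rewrite opprK addrC distrC -normrN opprB distrC; exact: ab.
have aN0 i : - a v0 i = 0 by rewrite a0 oppr0.
have le1 := le_trans (gaussian_contraction Xs a0 b0 ab) boundb.
have le2 := le_trans (gaussian_contraction (a := fun v i => - a v i) Xs aN0 b0 abN) boundb.
have EF : (\int[P]_x (F (joint X x))%:E <= (2 * (D * (sg * M * q)))%:E)%E.
  have mform (c : V -> 'I_n -> R) :
      measurable_fun setT (fun x => fmax v0 (fun v => \sum_(i < n) c v i * X i x)).
    apply: (measurable_fmax v0 (g := fun x v => \sum_(i < n) c v i * X i x)) => v.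
    by apply: measurable_sum => i; exact: measurable_funM.
  have form0 (c : V -> 'I_n -> R) x : (forall i, c v0 i = 0) ->
      0 <= fmax v0 (fun v => \sum_(i < n) c v i * X i x).
    exact: (fmax_form_ge0 (fun i => X i x)).
  rewrite mulr_natl mulr2n EFinD; apply: le_trans (leeD le1 le2).
  rewrite -ge0_integralD//; try exact/measurable_EFinP;
    try by move=> x _; rewrite lee_fin form0.
  apply: ge0_le_integral => //.
  - by move=> x _; rewrite lee_fin.
  - exact/measurable_EFinP.
  - by apply: emeasurable_funD; exact/measurable_EFinP.
  move=> x _; rewrite -EFinD lee_fin FE; apply: fmax_le => v.
  have p1 := fmax_ge v0 (fun v => \sum_(i < n) a v i * X i x) v.
  have p2 := fmax_ge v0 (fun v => \sum_(i < n) (- a v i) * X i x) v.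
  have q1 := form0 a x a0; have q2 := form0 (fun v i => - a v i) x aN0.
  rewrite ler_norml; apply/andP; split; last by rewrite (le_trans p1)// lerDl.
  rewrite lerNl; have <- : \sum_(i < n) (- a v i) * X i x = - \sum_(i < n) a v i * X i x.
    by rewrite -sumrN; apply: eq_bigr => i _; rewrite mulNr.
  by apply: (le_trans p2); rewrite lerDr.
(* twice the bound on the expectation, so that Markov's inequality gives one half *)
pose m := 4 * (D * (sg * M * q)).
have m0 : 0 < m by rewrite !mulr_gt0.
have mgt r : measurable [set x | r < F (joint X x)] by exact: measurable_superlevel.
have half : (P [set x | (m < F (joint X x))%R] <= 2^-1%:E)%E.
  have markov : (m%:E * P [set x | (m < F (joint X x))%R] <=
      \int[P]_x (F (joint X x))%:E)%E.
    have -> : P [set x | (m < F (joint X x))%R] =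
        (\int[P]_x (\1_[set x | (m < F (joint X x))%R] x)%:E)%E.
      by rewrite integral_indic ?setIT.
    rewrite -ge0_integralZl//.
    - apply: ge0_le_integral => //.
      + by move=> x _; rewrite mule_ge0// lee_fin ltW.
      + by apply: measurable_funeM; exact/measurable_EFinP.
      + exact/measurable_EFinP.
      + move=> x _; rewrite -EFinM lee_fin indicE.
        case: (boolP (x \in _)) => [|_]; last by rewrite mulr0.
        by rewrite inE mulr1 => /ltW.
    - exact/measurable_EFinP.
    - by rewrite lee_fin ltW.
  have := le_trans markov EF.
  have -> : 2 * (D * (sg * M * q)) = m * 2^-1.
    by rewrite /m (_ : 4 = 2 * 2) -?natrM// -!mulrA [_ * 2^-1]mulrC; field.
  by rewrite (EFinM m 2^-1) lee_pmul2l// lte_fin.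
have med : (2^-1%:E <= P [set x | (F (joint X x) <= m)%R])%E.
  rewrite (_ : [set x | _] = ~` [set x | m < F (joint X x)]); last first.
    by apply/seteqP; split => x /=; [move/le_gtF => ->|move/negP; rewrite -leNgt].
  rewrite probability_setC// -[leLHS](_ : (1 - 2^-1%:E)%E = _); last first.
    by rewrite -EFinB; congr EFin; field.
  by rewrite leeB.
have lipF v w : F w - F v <= B * Num.sqrt (\sum_(i < n) (tnth v i - tnth w i) ^+ 2).
  have [u Fu] := fmax_ex v0 (fun u => `|\sum_(i < n) a u i * tnth w i|).
  have Fv := fmax_ge v0 (fun u => `|\sum_(i < n) a u i * tnth v i|) u.
  rewrite /F Fu; apply: (le_trans (lerB (lexx _) Fv)).
  apply: (le_trans (ler_norm _)); apply: (le_trans (ler_dist_dist _ _)).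
  rewrite -sumrB -sqrtr_sqr -[B]ger0_norm// -sqrtr_sqr -sqrtrM ?sqr_ge0//.
  apply: ler_wsqrtr; rewrite -sqrrN -sumrN.
  under eq_bigr do rewrite -mulrBr -mulrN opprB.
  apply: le_trans (sum_cauchy_schwarz _ _) _.
  by rewrite ler_wpM2r// sumr_ge0// => i _; exact: sqr_ge0.
set y := Num.sqrt (ln (2 * p%:R)).
have y0 : 0 <= y by rewrite sqrtr_ge0.
have q2 : q ^+ 2 = 2 * y ^+ 2.
  by rewrite /q /y !sqr_sqrtr ?mulr_ge0// ltW.
have q8y : 5 * q <= 8 * y by nra.
have cq : Num.sqrt (2 * ln 2) <= q.
  apply: ler_wsqrtr; rewrite ler_pM2l// ler_ln ?posrE//.
    by rewrite -natrM ler_nat (leq_mul (leqnn 2) p0).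
  by rewrite mulr_gt0// ltr0n.
set c := Num.sqrt _ in cq.
have thr : m + B * sg * (c + tau) <= sg * (8 * D * M * y + B * tau).
  have c0 : 0 <= c by exact: sqrtr_ge0.
  have Bc : B * c <= D * M * q by rewrite ler_pM.
  have DM0 : 0 < D * M by rewrite mulr_gt0.
  have Dq : D * M * (5 * q) <= D * M * (8 * y) by rewrite ler_pM2l.
  have : sg * (B * c + D * M * (4 * q)) <= sg * (D * M * (8 * y)).
    by rewrite ler_pM2l//; lra.
  by rewrite /m; lra.
set t := sg * _ in thr *.
have -> : [set x | exists v, (t < `|\sum_(i < n) a v i * X i x|)] =
    [set x | t < F (joint X x)].
  apply/seteqP; split => x /=; rewrite FE.
    move=> [v tv]; apply: lt_le_trans tv _.
    exact: (fmax_ge v0 (fun v => `|\sum_(i < n) a v i * X i x|) v).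
  by have [v ->] := fmax_ex v0 (fun v => `|\sum_(i < n) a v i * X i x|); exists v.
apply: le_trans (gaussian_concentration sg0 B0 tau0 Xs ssg mF lipF med).
apply: le_measure; [exact/mem_set/mgt|exact/mem_set/mgt|].
by move=> x /=; exact: le_lt_trans.
Qed.

End process_tail.

(** * Centered Gaussian variables *)

Section gaussian_variables.
Context d (T : measurableType d) (R : realType) (P : probability T R).

(** A centered variable has [m = 0] by [gauss_mean0], and [second_moment_gauss] bounds
    [s ^ 2]. *)
Lemma gaussian_centered (X : {RV P >-> R}) : gaussian X ->
  (X : T -> R) \in Lfun P 2%:E -> ('E_P[X] = 0)%E ->
  exists s : R, (forall A, measurable A -> distribution P X A = gauss 0 s A) /\
    s ^+ 2 <= fine 'V_P[X].
Proof.
move=> [m [s Xms]] X2 X0.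
have Xgauss A : measurable A -> distribution P X A = gauss m s A.
  by move=> mA; rewrite Xms// gaussE.
have lawE (f : R -> \bar R) :
    (\int[gauss m s]_x f x = \int[distribution P X]_x f x)%E.
  by apply: eq_measure_integral => A mA _; exact/esym/Xgauss.
have X1 : (X : T -> R) \in Lfun P 1.
  by apply: (Lfun_subset12 _ X2); rewrite fin_num_measure.
have intX : P.-integrable setT (EFin \o X) by exact/Lfun1_integrable.
have mid : measurable_fun setT (EFin : R -> \bar R) by exact/measurable_EFinP/measurable_id.
have int_id : (gauss m s).-integrable setT (EFin : R -> \bar R).
  apply/integrableP; split => //.
  rewrite lawE ge0_integral_distribution//; last exact: measurableT_comp.
  by have /integrableP[] := intX.
have mean : (\int[gauss m s]_x x%:E = 0)%E.
  rewrite lawE integral_distribution//.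
  by move: X0; rewrite expectation_def.
have m0 := gauss_mean0 mean int_id; exists s; rewrite m0 in Xgauss lawE; split=> //.
rewrite -lee_fin fineK; last exact: variance_fin_num.
rewrite varianceE// X0 expe2 mul0e sube0.
apply: (le_trans (second_moment_gauss s)).
rewrite unlock lawE ge0_integral_distribution//.
- by apply/measurable_EFinP; exact: measurable_funX.
- by move=> x; rewrite lee_fin sqr_ge0.
Qed.

Lemma gauss00_null (X : {RV P >-> R}) :
  (forall A, measurable A -> distribution P X A = gauss 0 0 A) ->
  P [set x | X x != 0] = 0%E.
Proof.
move=> X0; have mN0 : measurable (~` [set 0 : R]) by exact: measurableC.
rewrite (_ : [set x | _] = X @^-1` (~` [set 0])); last first.
  by apply/seteqP; split => x /= => [/eqP|/eqP].
apply: (etrans (X0 _ mN0)).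
by apply: (etrans (gauss0E 0 _)); rewrite diracE memNset//=.
Qed.

Lemma union_bound (p : nat) (E : 'I_p -> set T) (q : R) : (0 < p)%N ->
  (forall j, measurable (E j)) -> (forall j, (P (E j) <= (q / p%:R)%:E)%E) ->
  (P (\bigcup_j E j) <= q%:E)%E.
Proof.
move=> p0 mE PE; pose F n := if insub n is Some j then E j else set0.
have mF n : measurable (F n) by rewrite /F; case: insub.
have -> : \bigcup_j E j = \big[setU/set0]_(n < p) F n.
  rewrite -bigcup_mkord; apply/seteqP; split => x.
    by move=> [j _ xE]; exists (j : nat); rewrite /= ?ltn_ord// /F valK.
  by move=> [n /= np]; rewrite /F; case: insubP => [j _ _ xE|_ []]; exists j.
apply: (le_trans (Boole_inequality _ _)); first by move=> n _; exact: mF.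
apply: (@le_trans _ _ (\sum_(n < p) (q / p%:R)%:E)%E).
  by apply: lee_sum => n _; rewrite /F valK; exact: PE.
rewrite sumEFin sumr_const card_ord lee_fin -(mulr_natr (q / _)) divfK//.
by rewrite pnatr_eq0 -lt0n.
Qed.

End gaussian_variables.

(** * Suprema over arbitrary sets of linear forms *)

Section separability.
Variable R : realType.

(** The countable subset has one form for every rational point and every mesh, with
    coefficients within that mesh of that point if the set contains such a form: it
    is dense in the coefficients, on which the values depend continuously. *)
Lemma countable_sup_abs (V : Type) (D : set V) n (c : V -> 'I_n -> R) :
  D !=set0 -> exists2 u : nat -> V, (forall k, D (u k)) &
    forall (x : 'I_n -> R) (r : R) v, D v -> r < `|\sum_(i < n) c v i * x i| ->
      exists k, r < `|\sum_(i < n) c (u k) i * x i|.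
Proof.
move=> [w0 Dw0].
pose near (z : {ffun 'I_n -> rat} * nat) v :=
  D v /\ forall i, `|c v i - ratr (z.1 i)| < z.2.+1%:R^-1.
have [pick pickP] : {pick : {ffun 'I_n -> rat} * nat -> V &
    forall z, D (pick z) /\ ((exists v, near z v) -> near z (pick z))}.
  apply: (@choice _ _ (fun z v => D v /\ ((exists v, near z v) -> near z v))) => z.
  have [[v zv]|nz] := pselect (exists v, near z v).
    by exists v; split => // ; case: zv.
  by exists w0; split => // /nz.
exists (fun k => if unpickle k is Some z then pick z else w0).
  by move=> k; case: unpickle => // z; have [] := pickP z.
move=> x r v Dv rv; set S := \sum_(i < n) _ in rv.
pose B := 1 + \sum_(i < n) `|x i|.
have sx0 : 0 <= \sum_(i < n) `|x i| by exact: sumr_ge0.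
have B0 : 0 < B by rewrite ltr_pwDl.
pose eps := (`|S| - r) / (2 * B).
have eps0 : 0 < eps by rewrite divr_gt0 ?subr_gt0// mulr_gt0.
pose m := Num.truncn eps^-1.
have meps : m.+1%:R^-1 < eps.
  by rewrite invf_plt ?posrE// truncnS_gt.
have m0 : 0 < m.+1%:R^-1 :> R by rewrite invr_gt0.
have rat_near i : exists z : rat, `|c v i - ratr z| < m.+1%:R^-1.
  have [|z] := @rat_in_itvoo R (c v i - m.+1%:R^-1) (c v i + m.+1%:R^-1).
    by move: m0; move: (m.+1%:R^-1) => e e0; lra.
  rewrite in_itv/= => /andP[z1 z2]; exists z; rewrite ltr_norml.
  by move: z1 z2; move: (m.+1%:R^-1) => e z1 z2; apply/andP; split; lra.
have [z zP] := choice rat_near.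
pose code : {ffun 'I_n -> rat} * nat := ([ffun i => z i], m).
have nearv : near code v by split => // i; rewrite /= ffunE.
have [_ /(_ (ex_intro _ v nearv)) [Dp pP]] := pickP code.
exists (pickle code); rewrite pickleK.
have close i : `|c v i - c (pick code) i| <= 2 * eps.
  have h1 := zP i; have h2 := pP i; rewrite /= ffunE in h2.
  rewrite (_ : c v i - _ = (c v i - ratr (z i)) - (c (pick code) i - ratr (z i)));
    last by ring.
  apply: (le_trans (ler_normB _ _)); rewrite mulr_natl mulr2n lerD//;
    by rewrite ltW// (lt_trans _ meps).
set S' := \sum_(i < n) _.
have SS : `|S - S'| <= 2 * eps * \sum_(i < n) `|x i|.
  rewrite /S /S' -sumrB mulr_sumr; apply: (le_trans (ler_norm_sum _ _ _)).
  apply: ler_sum => i _; rewrite -mulrBl normrM ler_wpM2r//; exact: close.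
have epsB : 2 * eps * B = `|S| - r.
  by rewrite /eps; field; rewrite gt_eqF.
have := ler_dist_dist S S'; rewrite /B in epsB; have := ler_norm (`|S| - `|S'|).
by nra.
Qed.

End separability.

Section supremum_tail.
Context d (T : measurableType d) (R : realType) (P : probability T R).
Variables (n : nat) (X : 'I_n -> {RV P >-> R}) (V : Type) (D : set V).
Variables (c : V -> 'I_n -> R) (Y : V -> {RV P >-> R}).
Hypothesis D0 : D !=set0.
Hypothesis YE : forall v x, Y v x = \sum_(i < n) c v i * X i x.

(** The supremum of a process of linear forms is a countable supremum, hence
    measurable, and its tail is the limit of the tails over finite subsets. *)
Lemma sup_abs_tail (r q : R) :
  (forall m (u : 'I_m.+1 -> V), (forall k, D (u k)) ->
     (P [set x | exists k, (r < `|Y (u k) x|)%R] <= q%:E)%E) ->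
  tail_le P (sup_abs D Y) r%:E q.
Proof.
move=> Pq; have [u Du uP] := countable_sup_abs c D0.
pose A k := [set x | r < `|Y (u k) x|].
have mA k : measurable (A k).
  by apply: measurable_superlevel; exact: measurableT_comp.
rewrite /tail_le (_ : [set x | _] = \bigcup_k A k); last first.
  apply/seteqP; split => [x /ereal_sup_gtP[_ [v Dv <-]]|x [k _ rk]].
    rewrite lte_fin YE => /(uP (fun i => X i x) _ _ Dv)[k rk].
    by exists k => //; rewrite /A /= YE.
  by apply/ereal_sup_gtP; exists (`|Y (u k) x|%:E) => //; exists (u k).
split; first exact: bigcupT_measurable.
pose B m := \bigcup_(k in `I_m.+1) A k.
have mB m : measurable (B m) by apply: bigcup_measurable => k _; exact: mA.
have ndB : nondecreasing_seq B.
  move=> m m' mm'; apply/subsetPset => x [k /= km xk]; exists k => //=.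
  exact: (leq_trans km).
have UB : \bigcup_m B m = \bigcup_k A k.
  apply/seteqP; split => x; first by move=> [m _ [k _ xk]]; exists k.
  by move=> [k _ xk]; exists k => //; exists k => /=.
rewrite -UB; have /cvg_lim <- // :=
  nondecreasing_cvg_mu (mu := P) mB (bigcupT_measurable _ mB) ndB.
apply: lime_le.
  apply: ereal_nondecreasing_is_cvgn => m m' mm'; apply: le_measure;
    [exact/mem_set/mB|exact/mem_set/mB|exact/subsetPset/ndB].
apply: nearW => m /=.
rewrite (_ : B m = [set x | exists k : 'I_m.+1, r < `|Y (u k) x|]); last first.
  apply/seteqP; split => x; first by move=> [k /= km xk]; exists (Ordinal km).
  by move=> [k xk]; exists (k : nat) => //=; exact: ltn_ord.
by apply: Pq => k; exact: Du.
Qed.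

End supremum_tail.

(** * The bounds on the derivatives *)

Section regularity_constants.
Context {R : realType}.

Lemma is_interval_open_interval (a b : \bar R) : is_interval (open_interval a b).
Proof.
move=> x y [ax xb] [ay yb] z /andP[xz zy]; split.
  by apply: lt_le_trans ax _; rewrite lee_fin.
by apply: le_lt_trans yb; rewrite lee_fin.
Qed.

Variables (N : nat) (f : 'I_N -> R -> R) (a b : 'I_N -> \bar R).
Let I i := open_interval (a i) (b i).
Hypothesis hbdd : forall i, [bounded derive1 (f i) t | t in I i].
Hypothesis hlip : forall i, [lipschitz derive1 (f i) t | t in I i].

Lemma F1_const_ge0 : 0 <= F1_const f a b.
Proof. exact: bigmax_ge_id. Qed.

Lemma F2_const_ge0 : 0 <= F2_const f a b.
Proof. exact: bigmax_ge_id. Qed.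

Lemma F1_constP i t : I i t -> `|derive1 (f i) t| <= F1_const f a b.
Proof.
move=> It; have [M [_ HM]] := hbdd i.
apply: le_trans (le_bigmax _ _ i); apply: ub_le_sup; last by exists t.
by exists (M + 1) => _ [x Ix <-]; apply: HM => //; rewrite ltrDl.
Qed.

Lemma F2_constP i x y : I i x -> I i y ->
  `|derive1 (f i) x - derive1 (f i) y| <= F2_const f a b * `|x - y|.
Proof.
move=> Ix Iy; have [->|xy] := eqVneq x y; first by rewrite !subrr normr0 mulr0.
have [M [_ HM]] := hlip i.
have xy0 (z w : R) : z != w -> 0 < `|z - w| by move=> zw; rewrite normr_gt0 subr_eq0.
rewrite -ler_pdivrMr ?xy0//.
apply: le_trans (le_bigmax _ _ i); apply: ub_le_sup; last by exists x, y.
exists (M + 1) => _ [z [w [Iz Iw zw ->]]]; rewrite ler_pdivrMr ?xy0//.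
have M1 : M < M + 1 by rewrite ltrDl.
exact: (HM _ M1 (z, w)).
Qed.

End regularity_constants.

(** * The two processes of the regression model *)

Section regression_process.
Context d (T : measurableType d) (R : realType) (P : probability T R).
Variables (N p : nat) (H : 'I_N -> 'rV[R]_p) (f : 'I_N -> R -> R) (dd : 'I_p -> R).
Variables (a b : 'I_N -> \bar R) (D0 : set 'rV[R]_p) (theta : 'rV[R]_p).
Variables (X : 'I_N -> {RV P >-> R}) (s var : 'I_N -> R) (sigma0 : R).
Hypothesis p0 : (0 < p)%N.
Hypothesis hd : forall j, dd j = d_const H j.
Hypothesis d_gt0 : forall j, 0 < dd j.
Let I i := open_interval (a i) (b i).
Hypothesis hdiff : forall i t, I i t -> derivable (f i) t 1.
Hypothesis hbdd : forall i, [bounded derive1 (f i) t | t in I i].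
Hypothesis hlip : forall i, [lipschitz derive1 (f i) t | t in I i].
Hypothesis hdom : forall v i, D0 v -> I i (dot (H i) v).
Hypothesis htheta : D0 theta.
Hypothesis sigma0_gt0 : 0 < sigma0.
Hypothesis Xs : gaussian_family X s.
Hypothesis s_var : forall i, s i ^+ 2 <= var i.
Hypothesis var_sigma0 : forall i, var i <= sigma0 ^+ 2.

Let F1 := F1_const f a b.
Let F2 := F2_const f a b.
Let w := w_const H sigma0 var.
Let M := Num.sqrt (max_col H dd).
Let t i v := dot (H i) v.
Let t0 i := dot (H i) theta.
Let W v := wdist1 w v theta.
Let D v := wdist1 dd v theta.

Let slope_gap i v := slope (f i) (t0 i) (t i v) - derive1 (f i) (t0 i).
Let alpha j i := H i 0 j / dd j.

Let dotB i u v : t i u - t i v = \sum_(k < p) H i 0 k * (u 0 k - v 0 k).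
Proof. by rewrite /t /dot -sumrB; apply: eq_bigr => k _; rewrite mulrBr. Qed.

Let alphaK i k : H i 0 k = dd k * alpha k i.
Proof. by rewrite /alpha mulrC divfK// gt_eqF. Qed.

Let alpha_le1 j i : `|alpha j i| <= 1.
Proof.
rewrite /alpha normrM normfV (gtr0_norm (d_gt0 j)) ler_pdivrMr// mul1r hd.
exact: (le_bigmax _ (fun i => `|H i 0 j|)).
Qed.

Let D_ge0 v : 0 <= D v.
Proof. by apply: sumr_ge0 => k _; rewrite mulr_ge0// ltW. Qed.

Let t_le i v : `|t i v - t0 i| <= D v.
Proof.
rewrite dotB; apply: (le_trans (ler_norm_sum _ _ _)); apply: ler_sum => k _.
rewrite alphaK normrM ler_wpM2r// normrM (gtr0_norm (d_gt0 k)).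
by rewrite ler_piMr// ltW.
Qed.

Let slope_gap_theta i : slope_gap i theta = 0.
Proof. by rewrite /slope_gap slope_diag subrr. Qed.

Let slope_gap_lip i u v : D0 u -> D0 v ->
  `|slope_gap i u - slope_gap i v| <= F2 / 2 * `|t i u - t i v|.
Proof.
move=> Du Dv; rewrite /slope_gap opprB addrA subrK.
apply: (slope_lipschitz (I := I i)); [exact: is_interval_open_interval|exact: hdiff|
  by move=> x y; exact: F2_constP|exact: hdom..].
Qed.

Let slope_gap_le (ph : R) i v : D0 v -> 2 * F1 <= ph \/ F2 / 2 * D v <= ph ->
  `|slope_gap i v| <= ph.
Proof.
move=> Dv [] /(le_trans _) -> //.
  rewrite mulr_natl mulr2n; apply: (le_trans (ler_normB _ _)); apply: lerD.
    apply: (slope_bound (I := I i)); [exact: is_interval_open_interval|exact: hdiff|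
      by move=> x; exact: F1_constP|exact: hdom..].
  by apply: F1_constP => //; exact: hdom.
rewrite -[slope_gap i v]subr0 -(slope_gap_theta i).
apply: (le_trans (slope_gap_lip i Dv htheta)).
by rewrite ler_wpM2l// divr_ge0// F2_const_ge0.
Qed.

Let max_col_ge j : \sum_(i < N) alpha j i ^+ 2 <= M ^+ 2.
Proof.
have ge0 k : 0 <= \sum_(i < N) alpha k i ^+ 2 by apply: sumr_ge0 => i _; exact: sqr_ge0.
rewrite /M sqr_sqrtr; first exact: (le_bigmax _ (fun k => \sum_(i < N) alpha k i ^+ 2)).
exact: bigmax_ge_id.
Qed.

Let M_gt0 : 0 < M.
Proof.
pose j := Ordinal p0.
have [i aij] : exists i, alpha j i ^+ 2 = 1.
  have : d_const H j != 0 by rewrite -hd gt_eqF.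
  rewrite /d_const; have : forall y, y = \big[Num.max/0]_(i < N) `|H i 0 j| ->
      y != 0 -> exists i, y = `|H i 0 j|.
    move=> y ->; apply: (big_ind (fun y => y != 0 -> exists i, y = `|H i 0 j|)).
    - by rewrite eqxx.
    - by move=> x z Hx Hz; case: (leP x z).
    - by move=> i _ _; exists i.
  move=> /(_ _ erefl) ex /ex[i iE]; exists i.
  rewrite -real_normK ?num_real// normrM normfV (gtr0_norm (d_gt0 j)) -iE.
  by rewrite -/(d_const H j) -hd divff ?expr1n// gt_eqF.
have : 1 <= M ^+ 2.
  apply: le_trans (max_col_ge j); rewrite (bigD1 i)//= aij lerDl.
  by apply: sumr_ge0 => k _; exact: sqr_ge0.
have : 0 <= M by exact: sqrtr_ge0.
by rewrite le_eqVlt => /orP[/eqP <-|//]; rewrite expr0n/= ler10.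
Qed.

Let s_sigma0 i : s i ^+ 2 <= sigma0 ^+ 2.
Proof. exact: le_trans (s_var i) (var_sigma0 i). Qed.

(* Expanding [t i v - t i theta] in coordinates makes the remainder a combination of
   these [p] processes. *)
Let rem j v x := \sum_(i < N) (alpha j i * slope_gap i v) * X i x.

(* [None] stands for [theta], where the process vanishes. *)
Let remainder_tail (E ph tau : R) m (u : 'I_m.+1 -> 'rV[R]_p) j :
  (forall k, D0 (u k)) -> (forall v, D0 v -> F2 / 2 * D v <= E) ->
  (forall i v, D0 v -> `|slope_gap i v| <= ph) -> 0 <= ph <= E -> 0 <= tau ->
  (P [set x | exists k, (sigma0 * (8 * E * M * Num.sqrt (ln (2 * p%:R)) + ph * M * tau) <
     `|rem j (u k) x|)%R] <= (expR (- tau ^+ 2 / 2))%:E)%E.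
Proof.
move=> Du DE gap_ph /andP[ph0 phE] tau0.
have psi0 : 0 <= F2 / 2 by rewrite divr_ge0// F2_const_ge0.
pose pt (o : option 'I_m.+1) := if o is Some k then u k else theta.
have Dpt o : D0 (pt o) by case: o => [k|//]; exact: Du.
pose A (o : option 'I_m.+1) i := alpha j i * slope_gap i (pt o).
pose e (o : option 'I_m.+1) (k : 'I_p) := F2 / 2 * (dd k * (pt o 0 k - theta 0 k)).
pose g (k : 'I_p) i := alpha j i * alpha k i.
have egE o i : \sum_(k < p) e o k * g k i = F2 / 2 * (alpha j i * (t i (pt o) - t0 i)).
  rewrite dotB !mulr_sumr; apply: eq_bigr => k _.
  by rewrite /e /g (alphaK i k); ring.
have E0 : 0 <= E by exact: le_trans phE.
have := @gaussian_process_tail _ _ _ P _ X s Xs (option 'I_m.+1) None p A e g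
  sigma0 E M (ph * M) tau p0 sigma0_gt0 E0 M_gt0 _ tau0 s_sigma0.
have -> : [set x | exists k, (sigma0 * (8 * E * M * Num.sqrt (ln (2 * p%:R)) + ph * M * tau) <
     `|rem j (u k) x|)%R] = [set x | exists v : option 'I_m.+1,
      (sigma0 * (8 * E * M * Num.sqrt (ln (2 * p%:R)) + ph * M * tau) <
      `|\sum_(i < N) A v i * X i x|)%R].
  apply/seteqP; split => x /=; first by move=> [k kx]; exists (Some k).
  move=> [[k|] kx]; [by exists k|exfalso; move: kx].
  rewrite big1 ?normr0; last by move=> i _; rewrite /A slope_gap_theta mulr0 mul0r.
  apply/negP; rewrite -leNgt mulr_ge0 ?(ltW sigma0_gt0)// addr_ge0// !mulr_ge0 ?sqrtr_ge0//.
apply.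
- by rewrite mulr_ge0 ?ler_wpM2r// ?ltW.
- by move=> i; rewrite /A slope_gap_theta mulr0.
- by move=> k; rewrite /e subrr !mulr0.
- move=> o; apply: le_trans (DE _ (Dpt o)); rewrite /D /wdist1 mulr_sumr.
  by apply: ler_sum => k _; rewrite /e normrM (ger0_norm psi0) normrM (gtr0_norm (d_gt0 k)).
- move=> k; apply: le_trans (max_col_ge k); apply: ler_sum => i _.
  rewrite /g exprMn ler_piMl ?sqr_ge0// -real_normK ?num_real//.
  by rewrite expr_le1.
- move=> o; rewrite exprMn; apply: le_trans (ler_wpM2l (sqr_ge0 ph) (max_col_ge j)).
  rewrite mulr_sumr; apply: ler_sum => i _; rewrite /A exprMn mulrC ler_wpM2r ?sqr_ge0//.
  by rewrite -real_normK ?num_real// lerXn2r ?nnegrE// gap_ph.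
move=> o o' i; rewrite !egE /A -mulrBr (normrM (alpha j i)).
have -> : F2 / 2 * (alpha j i * (t i (pt o) - t0 i)) -
    F2 / 2 * (alpha j i * (t i (pt o') - t0 i)) =
    alpha j i * (F2 / 2 * (t i (pt o) - t i (pt o'))) by ring.
rewrite (normrM (alpha j i)) ler_wpM2l// normrM (ger0_norm psi0).
exact: slope_gap_lip.
Qed.

(* The weights [w] ignore the variables of variance zero, so the bound on [xi] by the
   remainders holds only where these variables vanish. *)
Let N0 := [set x | exists i, s i = 0 /\ X i x != 0].

Let N0_null : measurable N0 /\ P N0 = 0%E.
Proof.
pose A i := if s i == 0 then [set x | X i x != 0] else set0.
have mA i : measurable (A i).
  rewrite /A; case: ifP => // _.
  rewrite (_ : [set x | _] = X i @^-1` (~` [set 0])).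
    by rewrite -[X in measurable X]setTI; apply: measurable_funPT => //; exact: measurableC.
  by apply/seteqP; split => x /= => [/eqP|/eqP].
have PA i : P (A i) = 0%E.
  rewrite /A; case: eqP => [si|_]; last by rewrite measure0.
  by have Xi := Xs.2 i; rewrite si in Xi; exact: gauss00_null Xi.
have N0E : N0 = \bigcup_i A i.
  apply/seteqP; split => x; first by move=> [i [si Xi]]; exists i; rewrite // /A si eqxx.
  by move=> [i _]; rewrite /A; case: eqP => // si Xi; exists i.
have mN0 : measurable N0 by rewrite N0E; exact: fin_bigcup_measurable.
split => //; have [N_eq0|N_gt0] := posnP N; last first.
  apply/eqP; rewrite eq_le measure_ge0 andbT N0E.
  by apply: (union_bound (q := 0) N_gt0 mA) => i; rewrite PA mul0r.
rewrite (_ : N0 = set0) ?measure0//; apply/seteqP; split => // x [i _].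
by have := ltn_ord i; rewrite [X in (_ < X)%N]N_eq0.
Qed.

Let tail_radius (q : R) := Num.sqrt (2 * ln (p%:R / q)).

Let tail_radiusE (q : R) : 0 < q < 1 -> expR (- tail_radius q ^+ 2 / 2) = q / p%:R.
Proof.
move=> /andP[q0 q1]; have pq : 1 < p%:R / q.
  by rewrite ltr_pdivlMr// mul1r (lt_le_trans q1)// ler1n.
rewrite /tail_radius sqr_sqrtr; last by rewrite mulr_ge0// ltW// ln_gt0.
rewrite mulNr mulrAC divff// mul1r -lnV ?posrE ?(lt_trans ltr01)// invf_div lnK//.
by rewrite posrE divr_gt0// ltr0n.
Qed.

Let measurable_exists m (g : 'I_m -> T -> R) (r : R) :
  (forall k, measurable_fun setT (g k)) ->
  measurable [set x | exists k, r < `|g k x|].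
Proof.
move=> mg; rewrite (_ : [set x | _] = \bigcup_k [set x | r < `|g k x|]).
  apply: fin_bigcup_measurable => // k _.
  by apply: measurable_superlevel; exact: measurableT_comp.
by apply/seteqP; split => x [k]; [exists k|move=> _; exists k].
Qed.

Let union_bound_N0 (E : 'I_p -> set T) (C : set T) (q : R) : 0 < q < 1 ->
  measurable C -> (forall j, measurable (E j)) ->
  (forall j, (P (E j) <= (expR (- tail_radius q ^+ 2 / 2))%:E)%E) ->
  C `<=` N0 `|` \bigcup_j E j -> (P C <= q%:E)%E.
Proof.
move=> q01 mC mE PE CE; have [mN0 PN0] := N0_null.
have mU : measurable (\bigcup_j E j) by exact: fin_bigcup_measurable.
apply: (@le_trans _ _ (P (N0 `|` \bigcup_j E j))).
  by apply: le_measure; [exact/mem_set|exact/mem_set/measurableU|].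
rewrite setUC measureU0//; apply: union_bound => // j.
by rewrite -(tail_radiusE q01); exact: PE.
Qed.

Let linear_part i v := derive1 (f i) (t0 i) * (t i v - t0 i).

(** A quotient with denominator 0 is 0. If the weights in the denominator vanish
    while the linear part of a variable does not, [xi_coef] takes over this part: so the
    decomposition holds at every sample point, and the processes differ from the
    intended ones only on a null set. *)
Definition xi1_coef (v : 'rV[R]_p) (i : 'I_N) : R :=
  linear_part i v / (sigma0 * F1 * W v).

Definition xi_coef (v : 'rV[R]_p) (i : 'I_N) : R :=
  (f i (t i v) - f i (t0 i) - sigma0 * F1 * W v * xi1_coef v i) / D v.

Variables xi1 xi : 'rV[R]_p -> {RV P >-> R}.
Hypothesis xi1E : forall v x, xi1 v x = \sum_(i < N) xi1_coef v i * X i x.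
Hypothesis xiE : forall v x, xi v x = \sum_(i < N) xi_coef v i * X i x.

Let D_eq0 v : D v = 0 -> v = theta.
Proof.
move=> /eqP; rewrite psumr_eq0; last by move=> k _; rewrite mulr_ge0// ltW.
move=> /allP Dv; apply/rowP => k; have := Dv k; rewrite mem_index_enum => /(_ isT)/=.
by rewrite mulf_eq0 gt_eqF//= normr_eq0 subr_eq0 => /eqP.
Qed.

Lemma decomposition v x :
  \sum_(i < N) X i x * f i (dot (H i) v) =
  \sum_(i < N) X i x * f i (dot (H i) theta)
  + sigma0 * F1 * xi1 v x * wdist1 w v theta + xi v x * wdist1 dd v theta.
Proof.
rewrite xi1E xiE mulrAC [X in _ = _ + X + _]mulr_sumr mulr_suml -!big_split/=.
apply: eq_bigr => i _; rewrite /xi_coef -/(W v) -/(D v) -/(t i v) -/(t0 i).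
have [D0v|D0v] := eqVneq (D v) 0; last by field.
have vth := D_eq0 D0v; rewrite D0v mulr0 addr0.
rewrite /W vth /wdist1 big1 => [|k _]; last by rewrite subrr normr0 mulr0.
by rewrite mulr0 mul0r addr0.
Qed.

Let F1_ge0 : 0 <= F1. Proof. exact: F1_const_ge0. Qed.

Let var_ge0 i : 0 <= var i. Proof. exact: le_trans (sqr_ge0 _) (s_var i). Qed.

Let w_ge0 j : 0 <= w j. Proof. exact: sqrtr_ge0. Qed.

Let w_sqr j : sigma0 ^+ 2 * w j ^+ 2 = \sum_(i < N) var i * H i 0 j ^+ 2.
Proof.
have sum0 : 0 <= \sum_(i < N) var i * H i 0 j ^+ 2.
  by apply: sumr_ge0 => i _; rewrite mulr_ge0// sqr_ge0.
rewrite /w /w_const sqr_sqrtr; last by rewrite mulr_ge0// invr_ge0 sqr_ge0.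
by rewrite mulVKf// sqrf_eq0 gt_eqF.
Qed.

(* If [w k = 0], every [H i 0 k] with [0 < var i] is 0. *)
Let W_eq0 v i : 0 < var i -> W v = 0 -> t i v = t0 i.
Proof.
move=> vi /eqP; rewrite psumr_eq0; last by move=> k _; rewrite mulr_ge0.
move=> /allP Wv; apply/eqP; rewrite -subr_eq0 dotB big1// => k _.
have := Wv k; rewrite mem_index_enum => /(_ isT)/=.
rewrite mulf_eq0 normr_eq0 => /orP[/eqP wk|/eqP ->]; last by rewrite mulr0.
have := w_sqr k; rewrite wk expr0n/= mulr0 => /esym/eqP.
rewrite psumr_eq0; last by move=> j _; rewrite mulr_ge0// sqr_ge0.
move=> /allP/(_ i); rewrite mem_index_enum => /(_ isT)/=.
by rewrite mulf_eq0 gt_eqF//= sqrf_eq0 => /eqP ->; rewrite mul0r.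
Qed.

Let xi_regular v i : D0 v -> 0 < var i ->
  xi_coef v i = slope_gap i v * (t i v - t0 i) / D v.
Proof.
move=> Dv vi; rewrite /xi_coef; congr (_ / _).
have -> : sigma0 * F1 * W v * xi1_coef v i = linear_part i v.
  have [|nz] := eqVneq (sigma0 * F1 * W v) 0; last by rewrite /xi1_coef mulrC divfK.
  move=> /eqP; rewrite !mulf_eq0 (gt_eqF sigma0_gt0)/= => /orP[/eqP F10|/eqP W0].
    have := F1_constP hbdd (hdom i htheta); rewrite -/F1 F10 normr_le0 => /eqP d0.
    by rewrite mulr0 !mul0r /linear_part d0 mul0r.
  by rewrite W0 mulr0 mul0r /linear_part (W_eq0 vi W0) subrr mulr0.
by rewrite -(mul_slope (f i)) /linear_part /slope_gap; ring.
Qed.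

(* Divided by [D v], the coordinates of [v - theta] times [dd] are the coefficients of
   a combination of the remainders, with absolute values of total 1. *)
Let xi_bound v x r : D0 v -> ~ N0 x -> 0 <= r ->
  (forall j, `|rem j v x| <= r) -> `|xi v x| <= r.
Proof.
move=> Dv Nx r0 remr.
have -> : xi v x = (\sum_(k < p) (v 0 k - theta 0 k) * dd k * rem k v x) / D v.
  rewrite xiE.
  transitivity (\sum_(i < N) (slope_gap i v * (t i v - t0 i) / D v) * X i x).
    apply: eq_bigr => i _; have [->|Xi] := eqVneq (X i x) 0; first by rewrite !mulr0.
    rewrite xi_regular//; apply: lt_le_trans (s_var i).
    rewrite exprn_even_gt0//=; apply/negP => /eqP si.
    by apply: Nx; exists i.
  under [in RHS]eq_bigr do rewrite mulr_sumr.
  rewrite exchange_big/= mulr_suml; apply: eq_bigr => i _.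
  rewrite dotB mulr_sumr !mulr_suml; apply: eq_bigr => k _.
  by rewrite (alphaK i k); ring.
have [D0v|D0v] := eqVneq (D v) 0; first by rewrite D0v invr0 mulr0 normr0.
have Dp : 0 < D v by rewrite lt_neqAle eq_sym D0v D_ge0.
rewrite normrM normfV (gtr0_norm Dp) ler_pdivrMr//.
apply: (le_trans (ler_norm_sum _ _ _)); rewrite /D /wdist1 mulr_sumr.
apply: ler_sum => k _; rewrite !normrM (gtr0_norm (d_gt0 k)) mulrC ler_pM//.
  by rewrite mulr_ge0// ltW.
by rewrite mulrC.
Qed.

Let grad j x := \sum_(i < N) (derive1 (f i) (t0 i) * H i 0 j) * X i x.

Let xi1_bound v x y : 0 <= y ->
  (forall j, `|grad j x| <= sigma0 * F1 * w j * y) -> `|xi1 v x| <= y.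
Proof.
move=> y0 grady.
have -> : xi1 v x = (\sum_(k < p) (v 0 k - theta 0 k) * grad k x) / (sigma0 * F1 * W v).
  rewrite xi1E; under [in RHS]eq_bigr do rewrite mulr_sumr.
  rewrite exchange_big/= mulr_suml; apply: eq_bigr => i _.
  rewrite /xi1_coef /linear_part dotB mulr_sumr !mulr_suml; apply: eq_bigr => k _.
  by ring.
have W0 : 0 <= W v by apply: sumr_ge0 => k _; rewrite mulr_ge0.
have z0 : 0 <= sigma0 * F1 * W v by rewrite !mulr_ge0// ltW.
have [zE|zn0] := eqVneq (sigma0 * F1 * W v) 0; first by rewrite zE invr0 mulr0 normr0.
have zp : 0 < sigma0 * F1 * W v by rewrite lt_neqAle eq_sym zn0.
rewrite normrM normfV (gtr0_norm zp) ler_pdivrMr//.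
apply: (le_trans (ler_norm_sum _ _ _)); rewrite /W /wdist1 !mulr_sumr.
apply: ler_sum => k _; rewrite normrM.
apply: le_trans (ler_wpM2l (normr_ge0 _) (grady k)) _.
by rewrite le_eqVlt; apply/orP; left; apply/eqP; ring.
Qed.

Let tail_radius_ge0 q : 0 <= tail_radius q. Proof. exact: sqrtr_ge0. Qed.

Let xi_tail (E ph q : R) : 0 < q < 1 ->
  (forall v, D0 v -> F2 / 2 * D v <= E) ->
  (forall i v, D0 v -> `|slope_gap i v| <= ph) -> 0 <= ph <= E ->
  tail_le P (sup_abs D0 xi)
    (sigma0 * (8 * E * M * Num.sqrt (ln (2 * p%:R)) + ph * M * tail_radius q))%:E q.
Proof.
move=> q01 DE gap_ph phE; apply: (sup_abs_tail _ xiE); first by exists theta.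
move=> m u Du; set thr := sigma0 * _.
have mxi k : measurable_fun setT (xi (u k)) by exact: measurable_funPT.
have mrem j k : measurable_fun setT (rem j (u k)).
  by apply: measurable_sum => i; exact: measurable_funM.
have thr0 : 0 <= thr.
  have /andP[ph0 phE'] := phE; have E0 : 0 <= E by exact: le_trans phE'.
  by rewrite mulr_ge0 ?(ltW sigma0_gt0)// addr_ge0// !mulr_ge0 ?sqrtr_ge0.
apply: (union_bound_N0 (E := fun j => [set x | exists k, thr < `|rem j (u k) x|]) q01).
- exact: (measurable_exists (g := fun k => xi (u k))).
- by move=> j; exact: (measurable_exists (g := fun k => rem j (u k))).
- by move=> j; exact: remainder_tail.
move=> x /= [k xk]; have [Nx|Nx] := pselect (N0 x); [by left|right].
apply: contrapT => noj; move: xk; apply/negP; rewrite -leNgt.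
apply: xi_bound => // j; rewrite leNgt; apply/negP => jk.
by apply: noj; exists j => //; exists k.
Qed.

Lemma xi1_tail (q : R) : 0 < q < 1 ->
  tail_le P (sup_abs D0 xi1) (tail_radius q)%:E q.
Proof.
move=> q01; apply: (sup_abs_tail _ xi1E); first by exists theta.
move=> m u Du; set thr := tail_radius q.
have mxi k : measurable_fun setT (xi1 (u k)) by exact: measurable_funPT.
have mgrad j : measurable_fun setT (grad j).
  by apply: measurable_sum => i; exact: measurable_funM.
apply: (union_bound_N0
  (E := fun j => [set x | sigma0 * F1 * w j * thr < `|grad j x|]) q01).
- exact: (measurable_exists (g := fun k => xi1 (u k))).
- by move=> j; apply: measurable_superlevel; exact: measurableT_comp.
- move=> j; have := @gaussian_form_tail _ _ _ P _ X s Xs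
    (fun i => derive1 (f i) (t0 i) * H i 0 j) (sigma0 * F1 * w j) thr; apply.
  + by rewrite !mulr_ge0// ltW.
  + exact: tail_radius_ge0.
  have -> : (sigma0 * F1 * w j) ^+ 2 = F1 ^+ 2 * (sigma0 ^+ 2 * w j ^+ 2) by ring.
  rewrite w_sqr mulr_sumr; apply: ler_sum => i _.
  have -> : (derive1 (f i) (t0 i) * H i 0 j) ^+ 2 * s i ^+ 2 =
      derive1 (f i) (t0 i) ^+ 2 * (s i ^+ 2 * H i 0 j ^+ 2) by ring.
  apply: ler_pM; [exact: sqr_ge0|by apply: mulr_ge0; exact: sqr_ge0| |].
    rewrite -real_normK ?num_real// lerXn2r ?nnegrE//.
    by apply: F1_constP => //; exact: hdom.
  by apply: ler_wpM2r; [exact: sqr_ge0|exact: s_var].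
move=> x /= [k xk]; right.
apply: contrapT => noj; move: xk; apply/negP; rewrite -leNgt.
apply: xi1_bound => [|j]; first exact: tail_radius_ge0.
rewrite leNgt; apply/negP => jk.
by apply: noj; exists j.
Qed.

Let diam := R_const dd D0.

Let D_diam v : D0 v -> ((D v)%:E <= diam)%E.
Proof. by move=> Dv; apply: ereal_sup_ubound => /=; exists v, theta. Qed.

Let diam_ge0 : (0 <= diam)%E.
Proof. by apply: le_trans (D_diam htheta); rewrite lee_fin. Qed.

(** If the diameter is infinite and [F2] is positive, the threshold is infinite and
    the event empty; if [F2 = 0], the gaps vanish. *)
Lemma remainder_process_tail (q : R) : 0 < q < 1 ->
  tail_le P (sup_abs D0 xi)
    (sigma0%:E * (A_const H dd F2 diam * (Num.sqrt (ln (2 * p%:R)))%:E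
                  + B_const H dd F1 F2 diam * (tail_radius q)%:E))%E q.
Proof.
move=> q01; rewrite /A_const /B_const /phi_const /psi_const -/M.
have F20 : 0 <= F2 by exact: F2_const_ge0.
have psi0 : 0 <= F2 / 2 by rewrite divr_ge0.
have F10 : 0 <= 2 * F1 by rewrite mulr_ge0.
have [F2E|F2n0] := eqVneq F2 0.
  have tail0 := @xi_tail 0 0 q q01.
  rewrite !F2E !(mul0r, mulr0, mul0e, add0e, addr0) in tail0 *.
  rewrite (min_idPr _) ?lee_fin// !mul0e mule0.
  apply: tail0; [by move=> v _; rewrite mul0r| |by rewrite lexx].
  by move=> i v Dv; apply: (slope_gap_le i Dv); right; rewrite F2E !mul0r.
have psi_gt0 : 0 < F2 / 2 by rewrite divr_gt0// lt_neqAle eq_sym F2n0.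
case: diam diam_ge0 D_diam => [r||]//=.
  rewrite lee_fin => r0 Dr.
  have -> : (sigma0%:E * ((8 * (F2 / 2))%:E * r%:E * M%:E * (Num.sqrt (ln (2 * p%:R)))%:E
       + Order.min (2 * F1)%:E ((F2 / 2)%:E * r%:E) * M%:E * (tail_radius q)%:E))%E =
    (sigma0 * (8 * (F2 / 2 * r) * M * Num.sqrt (ln (2 * p%:R)) +
      Num.min (2 * F1) (F2 / 2 * r) * M * tail_radius q))%:E.
    by rewrite -!EFinM -EFin_min (mulrA 8 (F2 / 2)).
  have DE v : D0 v -> F2 / 2 * D v <= F2 / 2 * r.
    by move=> Dv; rewrite ler_wpM2l// -lee_fin Dr.
  apply: (xi_tail q01 DE).
    move=> i v Dv; apply: (slope_gap_le i Dv); rewrite /Order.min; case: ifP => _.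
      by left.
    by right; exact: DE.
  by rewrite le_min F10 mulr_ge0//= ge_min lexx orbT.
move=> _ _.
have ln2p : 0 < Num.sqrt (ln (2 * p%:R)) :> R.
  by rewrite sqrtr_gt0 ln_gt0// -natrM ltr1n mul2n; case: (p) p0.
have -> : (sigma0%:E * ((8 * (F2 / 2))%:E * +oo * M%:E * (Num.sqrt (ln (2 * p%:R)))%:E
       + Order.min (2 * F1)%:E ((F2 / 2)%:E * +oo) * M%:E * (tail_radius q)%:E))%E = +oo%E.
  have psi8 : (0 < (8 * (F2 / 2))%:E)%E by rewrite lte_fin mulr_gt0.
  rewrite (gt0_muley psi8).
  rewrite gt0_mulye ?lte_fin// gt0_mulye ?lte_fin//.
  rewrite gt0_muley ?lte_fin// (min_idPl _) ?leey//.
  by rewrite -!EFinM addye// gt0_muley ?lte_fin.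
have event0 : [set x | (+oo < sup_abs D0 xi x)%E] = set0.
  by apply/seteqP; split => x //=; rewrite ltNge leey.
by rewrite /tail_le /= event0 measure0 lee_fin; split => //; case/andP: q01 => /ltW.
Qed.

End regression_process.

Theorem corollary2p4 (R : realType)
    (dT : measure_display) (T : measurableType dT) (P : probability T R)
    (dZ : measure_display) (ZT : measurableType dZ)
    (N p : nat) (hp : (0 < p)%N)
    (Z : 'I_N -> ZT)
    (h : ZT -> 'rV[R]_p)
    (hmeas : forall j : 'I_p, measurable_fun [set: ZT] (fun z => h z 0 j))
    (f : 'I_N -> R -> R)
    (d : 'I_p -> R)
    (hd : forall j, d j = d_const (fun i => h (Z i)) j)
    (hd_gt0 : forall j, 0 < d j)
    (a b : 'I_N -> \bar R)
    (hab : forall i, (a i < b i)%E)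
    (hdiff : forall i t, open_interval (a i) (b i) t -> derivable (f i) t 1)
    (hbdd : forall i,
      [bounded derive1 (f i) t | t in open_interval (a i) (b i)])
    (hlip : forall i,
      [lipschitz derive1 (f i) t | t in open_interval (a i) (b i)])
    (D0 : set 'rV[R]_p)
    (hD0 : D0 !=set0)
    (hdom : forall v i, D0 v -> open_interval (a i) (b i) (dot (h (Z i)) v))
    (omega : 'I_N -> {RV P >-> R})
    (sigma0 : R)
    (hsigma0 : 0 < sigma0)
    (hsq : forall i, (omega i : T -> R) \in Lfun P 2%:E)
    (hmean : forall i, ('E_P[omega i] = 0)%E)
    (hindep : mutually_independent omega)
    (hgauss : forall i, gaussian (omega i))
    (hvar : forall i, ('V_P[omega i] <= (sigma0 ^+ 2)%:E)%E)
    (theta : 'rV[R]_p)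
    (htheta : D0 theta) :
  let H := fun i => h (Z i) in
  let F1 := F1_const f a b in
  let F2 := F2_const f a b in
  let diam := R_const d D0 in
  let A := A_const H d F2 diam in
  let B := B_const H d F1 F2 diam in
  let w := w_const H sigma0 (fun i => fine 'V_P[omega i]) in
  (* xi1 has to depend on v like xi: for p = N = 1, f(t) = t, h = 1, theta = 0,
     D0 = ]-1, 1[ one has F2 = 0, hence xi = 0 a.s., and the identity
     omega v = sigma0 F1 xi1 w |v| determines xi1 with the sign of v. *)
  exists xi1 xi : 'rV[R]_p -> {RV P >-> R},
    [/\ forall v, D0 v -> forall x : T,
          \sum_(i < N) omega i x * f i (dot (h (Z i)) v) =
          \sum_(i < N) omega i x * f i (dot (h (Z i)) theta)
          + sigma0 * F1 * xi1 v x * wdist1 w v theta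
          + xi v x * wdist1 d v theta,
        forall q : R, 0 < q < 1 ->
          tail_le P (sup_abs D0 xi)
            (sigma0%:E * (A * (Num.sqrt (ln (2 * p%:R)))%:E
                          + B * (Num.sqrt (2 * ln (p%:R / q)))%:E))%E q
      & forall q : R, 0 < q < 1 ->
          tail_le P (sup_abs D0 xi1)
            (Num.sqrt (2 * ln (p%:R / q)))%:E q].
Proof.
move=> H F1 F2 diam A B w.
have /choice[s Hs] i := gaussian_centered (hgauss i) (hsq i) (hmean i).
have Xs : gaussian_family omega s.
  by split => [|i]; [exact: mutually_independent_rect|exact: (Hs i).1].
have s_var i : s i ^+ 2 <= fine 'V_P[omega i] := (Hs i).2.
have var_sigma0 i : fine 'V_P[omega i] <= sigma0 ^+ 2.
  by rewrite -lee_fin fineK ?variance_fin_num.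
have mform (c : 'I_N -> R) : measurable_fun [set: T] (fun x => \sum_(i < N) c i * omega i x).
  by apply: measurable_sum => i; exact: measurable_funM.
pose form c : {RV P >-> R} := HB.pack (fun x => \sum_(i < N) c i * omega i x)
  (isMeasurableFun.Build _ _ _ _ _ (mform c)).
pose xi1 v := form (xi1_coef H f a b theta (fun i => fine 'V_P[omega i]) sigma0 v).
pose xi v := form (xi_coef H f d a b theta (fun i => fine 'V_P[omega i]) sigma0 v).
exists xi1, xi; split => [v Dv x|q q01|q q01].
- exact: (decomposition (H := H) (var := fun i => fine 'V_P[omega i])).
- exact: (remainder_process_tail hp hd hd_gt0 hdiff hbdd hlip hdom htheta
    hsigma0 Xs s_var var_sigma0).
- exact: (xi1_tail hp hbdd hdom htheta hsigma0 Xs s_var).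
Qed.
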